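(* Let $\sigma\in C([0,\infty);\mathbb{R}^{d\times r})$ and let $A\in C([0,\infty);\mathbb{R}^{d\times d})$ be $T$-periodic for some $T>0$. Let $\Psi$ be the unique continuous $\mathbb{R}^{d\times d}$-valued solution of \[ \Psi'(t)=A(t)\Psi(t),\quad t\ge 0;\quad \Psi(0)=I_d, \] and suppose that $\rho(\Psi(T))<1$. For $\xi\in\mathbb{R}^d$ let $X(\cdot,\xi)$ be the unique continuous adapted solution of \[ dX(t)=A(t)X(t)\,dt+\sigma(t)\,dB(t),\quad t\ge 0;\quad X(0)=\xi. \] Let $h>0$ and for $\epsilon>0$ define \[ S_h'(\epsilon)=\sum_{n=1}^\infty \sqrt{\int_{nh}^{(n+1)h}\|\sigma(s)\|_F^2\,ds}\cdot\exp\left(-\frac{\epsilon^2}{2\int_{nh}^{(n+1)h}\|\sigma(s)\|_F^2\,ds}\right). \] (A) If $S_h'(\epsilon)<+\infty$ for all $\epsilon>0$, then $\lim_{t\to\infty}X(t,\xi)=0$ a.s. for each $\xi\in\mathbb{R}^d$. (B) If there exists $\epsilon'>0$ such that $S_h'(\epsilon)<+\infty$ for all $\epsilon>\epsilon'$ and $S_h'(\epsilon)=+\infty$ for all $0<\epsilon<\epsilon'$, then there exist deterministic $0<c_1\le c_2<\infty$, independent of $\xi$, such that for each $\xi\in\mathbb{R}^d$ \[ c_1\le\limsup_{t\to\infty}\|X(t,\xi)\|\le c_2,\quad\text{a.s.} \] Moreover, for each $\xi\in\mathbb{R}^d$, \[ \liminf_{t\to\infty}\|X(t,\xi)\|=0,\quad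 \lim_{t\to\infty}\frac1t\int_0^t\|X(s,\xi)\|^2\,ds=0,\quad\text{a.s.} \] (C) If $S_h'(\epsilon)=+\infty$ for all $\epsilon>0$, then $\limsup_{t\to\infty}\|X(t,\xi)\|=+\infty$ a.s. for each $\xi\in\mathbb{R}^d$.
   Context: $d,r$ are positive integers, $B$ is an $r$-dimensional standard Brownian motion, $\sigma$ and $A$ are deterministic, $\|\cdot\|$ is the Euclidean norm on $\mathbb{R}^d$, $\|\cdot\|_F$ is the Frobenius norm on $\mathbb{R}^{d\times r}$, $\rho(C)$ denotes the spectral radius of a square matrix $C$, and $I_d$ is the $d\times d$ identity matrix. A term of $S_h'(\epsilon)$ for which $\int_{nh}^{(n+1)h}\|\sigma(s)\|_F^2\,ds=0$ is interpreted as $0$. *)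

(* Defs.v *)
From HB Require Import structures.
From mathcomp Require Import all_boot all_order all_algebra.
From mathcomp Require Import complex.
From mathcomp Require Import all_classical all_reals all_analysis.

Set Implicit Arguments.
Unset Strict Implicit.
Unset Printing Implicit Defensive.

Import Order.TTheory GRing.Theory Num.Theory.
Import numFieldNormedType.Exports.

Local Open Scope classical_set_scope.
Local Open Scope ring_scope.

(* The Frobenius norm; on column vectors ('cV[R]_d = 'M[R]_(d, 1)) it is the
   Euclidean norm.  The norm `|M| of the library on matrices is the sup norm. *)
Definition fnorm (R : rcfType) (m n : nat) (M : 'M[R]_(m, n)) : R :=
  Num.sqrt (\sum_i \sum_j M i j ^+ 2).

(* The spectral radius is taken over the complex spectrum of the real matrix C;
   for 0 < d the set below is finite and nonempty, so that sup is a maximum. *)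
Definition spectral_radius (R : realType) (d : nat) (C : 'M[R]_d) : R :=
  sup [set x : R | exists lambda : R[i],
         eigenvalue (map_mx (real_complex R) C) lambda /\
         x = ComplexField.Normc.normc lambda].

(* Functions on the half-line [0, +oo[ are functions on R of which only the
   values at nonnegative times matter. *)
Definition continuous_nonneg (R : realType) (U : topologicalType)
    (f : R -> U) : Prop :=
  {within `[0, +oo[, continuous f}.

(* f'(t) = l for a function f on [0, +oo[: two-sided derivative if 0 < t,
   right derivative if t = 0. *)
Definition has_derivative_nonneg (R : realType) (m n : nat)
    (f : R -> 'M[R]_(m, n)) (t : R) (l : 'M[R]_(m, n)) : Prop :=
  (s - t)^-1 *: (f s - f t) @[s --> within `[0, +oo[ t^'] --> l.

Definition is_fundamental_solution (R : realType) (d : nat)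
    (A Psi : R -> 'M[R]_d) : Prop :=
  [/\ continuous_nonneg Psi,
      forall t, 0 <= t -> has_derivative_nonneg Psi t (A t *m Psi t) &
      Psi 0 = 1%:M].

Section stochastic.
Context {R : realType} {disp : measure_display} {Omega : measurableType disp}.
Variable P : probability Omega R.

Definition filtration (F : R -> set (set Omega)) : Prop :=
  (forall t, 0 <= t -> sigma_algebra setT (F t) /\ F t `<=` measurable) /\
  (forall s t, 0 <= s -> s <= t -> F s `<=` F t).

Definition adapted (F : R -> set (set Omega)) (n : nat)
    (X : R -> Omega -> 'cV[R]_n) : Prop :=
  forall t, 0 <= t -> forall (i : 'I_n) (V : set R), measurable V ->
    F t [set w | V (X t w i 0)].

Definition increment_in (n : nat) (X : R -> Omega -> 'cV[R]_n) (s t : R)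
    (V : 'I_n -> set R) : set Omega :=
  [set w | forall i, V i ((X t w - X s w) i 0)].

(* Standard r-dimensional Brownian motion with respect to the filtration F.
   Boxes form a pi-system generating the Borel sets of R^r, so that it is enough
   to describe the law of the increments and their independence from F s on
   boxes.  The second parameter of normal_prob is the standard deviation. *)
Definition brownian_motion (F : R -> set (set Omega)) (r : nat)
    (B : R -> Omega -> 'cV[R]_r) : Prop :=
  [/\ adapted F B,
      {ae P, forall w, B 0 w = 0},
      {ae P, forall w, continuous_nonneg (B ^~ w)},
      (forall s t, 0 <= s -> s < t ->
        forall V : 'I_r -> set R, (forall i, measurable (V i)) ->
        P (increment_in B s t V) =
        (\big[*%E/1%E]_(i < r) normal_prob 0 (Num.sqrt (t - s)) (V i))%E) &
      (forall s t, 0 <= s -> s < t ->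
        forall V : 'I_r -> set R, (forall i, measurable (V i)) ->
        forall U, F s U ->
        P (U `&` increment_in B s t V) = (P U * P (increment_in B s t V))%E)].

(* The list of the ((a, b), c) denotes the deterministic step function
   s |-> \sum c 1_{]a, b]}(s). *)
Definition step (d r : nat) := seq ((R * R) * 'M[R]_(d, r)).

Definition step_on (d r : nat) (t : R) (phi : step d r) : Prop :=
  forall p, p \in phi -> [/\ 0 <= p.1.1, p.1.1 <= p.1.2 & p.1.2 <= t].

Definition step_eval (d r : nat) (phi : step d r) (s : R) : 'M[R]_(d, r) :=
  \sum_(p <- phi) (\1_`]p.1.1, p.1.2] s : R) *: p.2.

Definition step_integral (d r : nat) (phi : step d r)
    (B : R -> Omega -> 'cV[R]_r) (w : Omega) : 'cV[R]_d :=
  \sum_(p <- phi) p.2 *m (B p.1.2 w - B p.1.1 w).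

(* Y is (a version of) the stochastic integral of the deterministic integrand
   sigma with respect to B over [0, t]: the limit in L^2(P) of the integrals of
   step functions converging to sigma in L^2([0, t]). *)
Definition is_stochastic_integral (d r : nat) (sigma : R -> 'M[R]_(d, r))
    (B : R -> Omega -> 'cV[R]_r) (t : R) (Y : Omega -> 'cV[R]_d) : Prop :=
  (forall i, measurable_fun setT (fun w => Y w i 0)) /\
  forall phi : nat -> step d r, (forall k, step_on t (phi k)) ->
    (\int[lebesgue_measure]_(s in `[0%R, t])
       (fnorm (sigma s - step_eval (phi k) s) ^+ 2)%:E)%E
      @[k --> \oo] --> 0%E ->
    (\int[P]_w (fnorm (Y w - step_integral (phi k) B w) ^+ 2)%:E)%E
      @[k --> \oo] --> 0%E.

(* X is a continuous adapted solution of dX = A X dt + sigma dB, X(0) = xi;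
   M is the process of the integrals of sigma with respect to B. *)
Definition is_sde_solution (F : R -> set (set Omega)) (d r : nat)
    (A : R -> 'M[R]_d) (sigma : R -> 'M[R]_(d, r))
    (B : R -> Omega -> 'cV[R]_r) (xi : 'cV[R]_d)
    (X : R -> Omega -> 'cV[R]_d) : Prop :=
  [/\ adapted F X,
      {ae P, forall w, continuous_nonneg (X ^~ w)} &
      exists2 M : R -> Omega -> 'cV[R]_d,
        forall t, 0 <= t -> is_stochastic_integral sigma B t (M t) &
        {ae P, forall w, forall t, 0 <= t ->
          X t w = xi
            + \col_i (\int[lebesgue_measure]_(s in `[0, t])
                        ((A s *m X s w) i 0))
            + M t w}].

End stochastic.

Definition sq_integral (R : realType) (d r : nat) (sigma : R -> 'M[R]_(d, r))
    (a b : R) : R :=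
  \int[lebesgue_measure]_(s in `[a, b]) (fnorm (sigma s) ^+ 2).

(* If the integral over [n h, (n+1) h] vanishes then so does the n-th term,
   since its factor Num.sqrt 0 is 0. *)
Definition Sh' (R : realType) (d r : nat) (sigma : R -> 'M[R]_(d, r))
    (h eps : R) : \bar R :=
  (\sum_(1 <= n <oo)
    (let v := sq_integral sigma (n%:R * h) (n.+1%:R * h) in
     Num.sqrt v * expR (- (eps ^+ 2 / (2 * v))))%:E)%E.

Definition limsup_infty (R : realType) (f : R -> R) : \bar R :=
  limf_esup (fun t => (f t)%:E) (pinfty_nbhs R).

Definition liminf_infty (R : realType) (f : R -> R) : \bar R :=
  limf_einf (fun t => (f t)%:E) (pinfty_nbhs R).

(* Main.v *)
Require Import Defs.
From HB Require Import structures.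
From mathcomp Require Import all_boot all_order all_algebra.
From mathcomp Require Import complex ring lra.
From mathcomp Require Import all_classical all_reals all_analysis measurable_realfun.

Set Implicit Arguments.
Unset Strict Implicit.
Unset Printing Implicit Defensive.

Import Order.TTheory GRing.Theory Num.Theory.
Import numFieldNormedType.Exports.

Local Open Scope classical_set_scope.
Local Open Scope ring_scope.

(** Write [X = xi + int A X + M] with [M = int sigma dB]. The asymptotic size of [X]
    is that of the oscillations of [M] over windows of a fixed length, and these are
    governed by the Gaussian tails [exp (- c x^2 / v_n)], where [v_n] is the integral
    of the squared norm of [sigma] over the window [n].

    Deterministic part. The equation is read pathwise, as a linear integral equation
    driven by a continuous path. Since the spectral radius of [Psi T] is less than
    one, its powers tend to zero ([spectral_radius_lt1_powers], by Cayley-Hamilton),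
    and over windows of some length [L >= h], a multiple of [T], the homogeneous
    equation contracts by the factor 1/2. Gronwall's lemma compares [X] with the
    homogeneous solution, which gives a recursion [a_(j+1) <= a_j / 2 + K eta_j] for
    the values at the ends of the windows, [eta_j] being the oscillation of [M]
    ([stable_windows]). Hence [X] is eventually at most a constant times the
    oscillations ([path_eventually_le]), and its square averages to zero if theirs do
    ([path_average_cvg0]). Conversely, the increments of [M] over windows of length
    [h] are at most a constant times the size of [X] ([increment_le_bound]).

    Probabilistic part. On dyadic grids, [M] is the limit in probability of sums of
    weighted Brownian increments, which are exactly independent of the past. The
    exponential martingale of these sums gives a maximal inequality
    ([reaches_prob_le]), hence an upper Gaussian bound for the probability of large
    oscillations ([window_osc_prob]); the second moment method applied to their
    exponentials gives a lower Gaussian bound for the conditional probability of large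
    values given the past ([weighted_sum_tail_ge]). The constants in the exponents are
    lossy, but this only multiplies the threshold [eps] by a constant, which is
    harmless for the three claims; the factor [sqrt v_n] in the series changes its
    convergence no more than that.

    If the series converges at [eps], the first Borel-Cantelli lemma bounds the
    oscillations eventually by a multiple of [eps] ([solution_eventually_le]), and if
    it diverges, a conditional form of the second one makes the increments of [M] exceed
    a multiple of [eps] infinitely often ([solution_infinitely_often_ge]). This gives
    (A), the bounds on the upper limit in (B), and (C). For the averages in (B), the
    expected number of windows among the first [4^k] with an oscillation above a fixed
    level is of order [C^k] for some [C < 4] ([gauss_tail_split], [osc_rare]), so that
    the bounded oscillations have squares of mean zero ([solution_average_cvg0]); a
    path whose square averages to zero cannot stay away from zero
    ([liminf_of_average]). *)

(** * Powers of a matrix of spectral radius less than one *)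

(** Unrolling the recursion gives [q ^ n * a_0], which vanishes in the limit, plus
    a geometric series of sum [b / (1 - q)]; the factor 2 makes room for the former. *)
Lemma contraction_eventually_le (R : realType) (q b : R) (a : nat -> R) :
  0 <= q < 1 -> 0 < b -> (forall n, 0 <= a n) ->
  (\forall n \near \oo, a n.+1 <= q * a n + b) ->
  \forall n \near \oo, a n <= 2 * b / (1 - q).
Proof.
move=> /andP[q0 q1] b0 a0 [n0 _ an].
have q1' : 0 < 1 - q by lra.
have step k : a (n0 + k)%N <= q ^+ k * a n0 + b / (1 - q).
  elim: k => [|k IH].
    by rewrite addn0 expr0 mul1r lerDl divr_ge0// ltW.
  rewrite addnS (le_trans (an _ (leq_addr _ _)))//.
  have -> : b / (1 - q) = q * (b / (1 - q)) + b by field; lra.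
  by rewrite addrA lerD2r exprS -mulrA -mulrDr ler_wpM2l.
have : q ^+ n * a n0 @[n --> \oo] --> 0 * a n0.
  by apply: cvgM; [apply: cvg_expr; rewrite ger0_norm|exact: cvg_cst].
rewrite mul0r => /cvgrPdist_lt /(_ (b / (1 - q))).
rewrite divr_gt0// => /(_ erefl) [k0 _ kP].
exists (n0 + k0)%N => // n /= nk.
have nE : n = (n0 + (n - n0))%N by rewrite subnKC// (leq_trans _ nk)// leq_addr.
have /kP : (k0 <= n - n0)%N by rewrite leq_subRL // (leq_trans _ nk)// leq_addr.
rewrite sub0r normrN ger0_norm ?mulr_ge0 ?exprn_ge0// => h.
rewrite nE (le_trans (step _))// mulr2n mulrDl mul1r mulrDl lerD2r ltW//.
Qed.

Section powers.
Variables (R : realType) (d : nat).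
Local Notation normc := ComplexField.Normc.normc.
Implicit Types (u : nat -> R[i]) (C : 'M[R[i]]_d.+1).

Definition cvanish u := forall e : R, 0 < e -> \forall n \near \oo, normc (u n) <= e.

Lemma normc_ge0 (z : R[i]) : 0 <= normc z.
Proof. by case: z => x y; rewrite /= sqrtr_ge0. Qed.

(** One factor of the characteristic polynomial, seen as an operator on
    sequences, can be peeled off as soon as its root lies in the open disk. *)
Lemma cvanish_shift (l : R[i]) u : normc l < 1 ->
  cvanish (fun n => u n.+1 - l * u n) -> cvanish u.
Proof.
move=> l1 v e e0.
have l1' : 0 < 1 - normc l by lra.
have b0 : 0 < e * (1 - normc l) / 2 by rewrite divr_gt0// mulr_gt0.
have := @contraction_eventually_le R (normc l) _ (fun n => normc (u n)) _ b0
  (fun n => normc_ge0 _).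
rewrite normc_ge0 l1 => /(_ erefl) h.
have -> : e = 2 * (e * (1 - normc l) / 2) / (1 - normc l) by field; lra.
apply: h; apply: filterS (v _ b0) => n hn.
rewrite -ComplexField.Normc.normcM -[u n.+1](subrK (l * u n)) addrC.
by apply: (le_trans (le_normcD _ _)); rewrite lerD2l.
Qed.

Lemma cvanish_factors C (s : seq R[i]) :
  (forall l, l \in s -> normc l < 1) ->
  (forall i j, cvanish (fun n => (horner_mx C (\prod_(l <- s) ('X - l%:P)) * C ^+ n) i j)) ->
  forall i j, cvanish (fun n => (C ^+ n) i j).
Proof.
elim: s => [|l s IH] hs; first by rewrite big_nil rmorph1 => h i j e e0;
  have := h i j e e0; apply: filterS => n; rewrite mul1r.
rewrite big_cons => h; apply: IH => [k ks|i j].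
  by apply: hs; rewrite inE ks orbT.
apply: (@cvanish_shift l); first by apply: hs; rewrite inE eqxx.
move=> e e0; have := h i j e e0; apply: filterS => n.
set p := \prod_(_ <- _) _.
suff -> : horner_mx C (('X - l%:P) * p) * C ^+ n =
  horner_mx C p * C ^+ n.+1 - l *: (horner_mx C p * C ^+ n) by rewrite !mxE.
rewrite rmorphM rmorphB /= horner_mx_X horner_mx_C mulrBl mulrBl.
rewrite exprS mulrA; congr (_ * _ - _).
  by rewrite -{1 4}(horner_mx_X C) -!rmorphM mulrC.
by rewrite -mulrA -[_%:M * _]/(_ *m _) mul_scalar_mx.
Qed.

(** By Cayley-Hamilton the characteristic polynomial of [C] annihilates the
    sequence of the powers of [C], and it splits over the complex numbers. *)
Lemma powers_cvanish C : (forall l, eigenvalue C l -> normc l < 1) ->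
  forall i j, cvanish (fun n => (C ^+ n) i j).
Proof.
move=> hC; have [s] := closed_field_poly_normal (char_poly C).
rewrite (monicP (char_poly_monic C)) scale1r => sE.
apply: (@cvanish_factors _ s) => [l ls|i j e e0].
  by apply: hC; rewrite eigenvalue_root_char sE root_prod_XsubC.
apply: nearW => n; rewrite -sE Cayley_Hamilton mul0r mxE.
by rewrite ComplexField.Normc.normc0 ltW.
Qed.

End powers.

(** The spectrum is a finite set of roots of the characteristic polynomial, so
    that its supremum bounds every eigenvalue. *)
Lemma spectral_radius_lt1_powers (R : realType) (d : nat) (C : 'M[R]_d.+1) :
  spectral_radius C < 1 ->
  forall e : R, 0 < e -> \forall n \near \oo, forall i j, `|(C ^+ n) i j| <= e.
Proof.
move=> C1 e e0; pose f := real_complex R.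
have ev l : eigenvalue (map_mx f C) l -> ComplexField.Normc.normc l < 1.
  move=> lC; apply: le_lt_trans C1; apply: ub_le_sup; last by exists l.
  have [s sE] := closed_field_poly_normal (char_poly (map_mx f C)).
  rewrite (monicP (char_poly_monic _)) scale1r in sE.
  exists (\sum_(l <- s) ComplexField.Normc.normc l) => x [k [kC ->]].
  have ks : k \in s by move: kC; rewrite eigenvalue_root_char sE root_prod_XsubC.
  rewrite (big_rem _ ks)/= lerDl sumr_ge0// => i _; exact: normc_ge0.
have h := powers_cvanish ev.
have {}h : \forall n \near \oo, forall p : 'I_d.+1 * 'I_d.+1,
    `|(C ^+ n) p.1 p.2| <= e.
  apply: filter_forall => -[i j]; apply: filterS (h i j e e0) => n /=.
  rewrite -rmorphXn mxE /= expr0n/= addr0 sqrtr_sqr//.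
apply: filterS h => n hn i j; exact: (hn (i, j)).
Qed.

(** * Linear integral equations driven by a continuous path *)

Section matrix_norm.
Variables (R : realType) (m n : nat).
Implicit Types M : 'M[R]_(m, n).

Lemma mx_entry_le M i j : `|M i j| <= `|M|.
Proof.
rewrite /Num.norm/= mx_normrE.
exact: (le_bigmax _ (fun k : 'I_m * 'I_n => `|M k.1 k.2|) (i, j)).
Qed.

Lemma mx_norm_le M e : 0 <= e -> (forall i j, `|M i j| <= e) -> `|M| <= e.
Proof.
move=> e0 h; rewrite [X in X <= _]/Num.norm/= mx_normrE.
by apply: bigmax_le => // -[i j] _; exact: h.
Qed.

End matrix_norm.

Lemma mulmx_norm_le (R : realType) (d : nat) (A : 'M[R]_d) (y : 'cV[R]_d) (a : R) i :
  (forall i j, `|A i j| <= a) -> `|(A *m y) i 0| <= d%:R * a * `|y|.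
Proof.
move=> hA; rewrite mxE (le_trans (ler_norm_sum _ _ _))//.
rewrite (le_trans (ler_sum _ (G := fun=> a * `|y|) _))//.
  by move=> j _; rewrite normrM ler_pM// mx_entry_le.
by rewrite sumr_const card_ord -[leLHS]mulr_natl mulrA.
Qed.

Section within_continuity.
Variables (R : realType) (D : set R).
Implicit Types f g : R -> R.

Lemma within_cst (U : topologicalType) (c : U) : {within D, continuous (fun=> c)}.
Proof. by move=> x; exact: cvg_cst. Qed.

Lemma within_id : {within D, continuous (fun x => x : R)}.
Proof. by apply: continuous_subspaceT => x; exact: cvg_id. Qed.

Lemma within_add f g : {within D, continuous f} -> {within D, continuous g} ->
  {within D, continuous (fun x => f x + g x)}.
Proof. by move=> hf hg x; apply: cvgD; [exact: hf|exact: hg]. Qed.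

Lemma within_sub f g : {within D, continuous f} -> {within D, continuous g} ->
  {within D, continuous (fun x => f x - g x)}.
Proof. by move=> hf hg x; apply: cvgB; [exact: hf|exact: hg]. Qed.

Lemma within_mul f g : {within D, continuous f} -> {within D, continuous g} ->
  {within D, continuous (fun x => f x * g x)}.
Proof. by move=> hf hg x; apply: cvgM; [exact: hf|exact: hg]. Qed.

Lemma within_comp f (h : R -> R) : {within D, continuous f} -> continuous h ->
  {within D, continuous (fun x => h (f x))}.
Proof. by move=> hf hh x; apply: continuous_comp; [exact: hf|exact: hh]. Qed.

Lemma within_sum (I : Type) (s : seq I) (f : I -> R -> R) :
  (forall i, {within D, continuous (f i)}) ->
  {within D, continuous (fun x => \sum_(i <- s) f i x)}.
Proof.
move=> hf; elim: s => [|i s IH].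
  by under eq_fun do rewrite big_nil; exact: within_cst.
by under eq_fun do rewrite big_cons; exact: within_add.
Qed.

Lemma within_coord m n (M : R -> 'M[R]_(m, n)) i j :
  {within D, continuous M} -> {within D, continuous (fun x => M x i j)}.
Proof.
move=> hM x; apply: (@continuous_comp (subspace D) _ _ M (fun N => N i j)).
  exact: hM.
exact: coord_continuous.
Qed.

Lemma within_matrix_norm m n (M : R -> 'M[R]_(m, n)) :
  {within D, continuous M} -> {within D, continuous (fun x => `|M x|)}.
Proof.
move=> hM x; apply: (@continuous_comp (subspace D) _ _ M (fun N => `|N|)).
  exact: hM.
exact: norm_continuous.
Qed.

Lemma within_mulmx_coord m n p (M : R -> 'M[R]_(m, n)) (N : R -> 'M[R]_(n, p)) i j :
  {within D, continuous M} -> {within D, continuous N} ->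
  {within D, continuous (fun x => (M x *m N x) i j)}.
Proof.
move=> hM hN; under eq_fun do rewrite mxE.
by apply: within_sum => k; apply: within_mul; exact: within_coord.
Qed.

Lemma within_matrix m n (M : R -> 'M[R]_(m, n)) :
  (forall i j, {within D, continuous (fun x => M x i j)}) ->
  {within D, continuous M}.
Proof.
move=> hM x; apply/cvgrPdist_lt => e e0.
have e2 : 0 < e / 2 by rewrite divr_gt0.
have : \forall t \near (x : subspace D), forall p : 'I_m * 'I_n,
    `|M x p.1 p.2 - M t p.1 p.2| < e / 2.
  have FF : Filter (nbhs (x : subspace D)) by exact: nbhs_filter.
  apply: (@filter_forall _ _ _ _ FF) => -[i j].
  by have /cvgrPdist_lt /(_ _ e2) := hM i j x.
apply: filterS => t h; apply: (@le_lt_trans _ _ (e / 2)); last first.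
  by rewrite ltr_pdivrMr// ltr_pMr// ltr1n.
apply: mx_norm_le; first exact: ltW.
by move=> i j; rewrite !mxE ltW//; exact: (h (i, j)).
Qed.

Lemma within_expR_affine (b c : R) :
  {within D, continuous (fun x => expR (b * (x - c)))}.
Proof.
apply: within_comp => [|x]; last exact: continuous_expR.
apply: within_mul; first exact: within_cst.
by apply: within_sub; [exact: within_id|exact: within_cst].
Qed.

End within_continuity.

Section gronwall.
Variable R : realType.
Local Notation mu := (@lebesgue_measure R).

Lemma within_integrable (f : R -> R) (s t : R) :
  {within `[s, t], continuous f} -> mu.-integrable `[s, t] (EFin \o f).
Proof.
by move=> hf; apply: continuous_compact_integrable => //; exact: segment_compact.
Qed.

Lemma within_sub_itv (U : topologicalType) (f : R -> U) (s t s' t' : R) : s <= s' -> t' <= t ->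
  {within `[s, t], continuous f} -> {within `[s', t'], continuous f}.
Proof.
move=> ss tt; apply: continuous_subspaceW => x /=; rewrite !in_itv/= => /andP[h1 h2].
by rewrite (le_trans ss)//= (le_trans h2).
Qed.

Lemma integral_expR (b s t : R) : 0 < b -> s <= t ->
  \int[mu]_(x in `[s, t]) expR (b * (x - s)) = (expR (b * (t - s)) - 1) / b.
Proof.
move=> b0; rewrite le_eqVlt => /orP[/eqP <-|st].
  by rewrite set_itv1 Rintegral_set1 subrr mulr0 expR0 subrr mul0r.
have dF (x : R) : is_derive x (1 : R) (fun x : R => expR (b * (x - s)) / b) (expR (b * (x - s))).
  apply: is_derive_eq; rewrite scaler0 add0r subr0.
  by rewrite /GRing.scale/= mulr1 mulrCA mulVf ?mulr1// gt_eqF.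
rewrite /Rintegral (@continuous_FTC2 _ _ (fun x : R => expR (b * (x - s)) / b))//=.
- by rewrite subrr mulr0 expR0 mulrBl.
- exact: within_expR_affine.
- have cF (x : R) : {for x, continuous (fun x : R => expR (b * (x - s)) / b)}.
    by apply: differentiable_continuous; apply/derivable1_diffP; have [] := dF x.
  split => [x _||]; first by have [] := dF x.
    by apply: cvg_at_right_filter; exact: cF.
  by apply: cvg_at_left_filter; exact: cF.
- by move=> x _; rewrite derive1E; have [_ ->] := dF x.
Qed.

(** The weight [exp (-2a(x-s))] turns the integral operator into a contraction of
    ratio 1/2 for the supremum norm, and the bound is read off at the maximum. *)
Lemma gronwall (u : R -> R) (s t a c : R) : s <= t -> 0 < a -> 0 <= c ->
  {within `[s, t], continuous u} -> (forall x, s <= x <= t -> 0 <= u x) ->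
  (forall x, s <= x <= t -> u x <= c + a * \int[mu]_(y in `[s, x]) u y) ->
  forall x, s <= x <= t -> u x <= 2 * c * expR (2 * a * (t - s)).
Proof.
move=> st a0 c0 uc u0 uI.
pose f x := expR (- (2 * a) * (x - s)) * u x.
have fc : {within `[s, t], continuous f}.
  by apply: within_mul => //; exact: within_expR_affine.
have [z] := EVT_max st fc; rewrite in_itv/= => zst fz.
have uE x : u x = f x * expR (2 * a * (x - s)).
  by rewrite /f mulrAC -expRD mulNr addNr expR0 mul1r.
have a20 : 0 < 2 * a by rewrite mulr_gt0.
have [sz zt] := andP zst.
have fzc : f z <= 2 * c.
  have : f z <= c + f z / 2; last by lra.
  have f0 : 0 <= f z by rewrite mulr_ge0 ?expR_ge0// u0.
  have Iz : \int[mu]_(y in `[s, z]) u y <= f z * ((expR (2 * a * (z - s)) - 1) / (2 * a)).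
    rewrite -integral_expR// -RintegralZl//; last first.
      by apply: within_integrable; exact: within_expR_affine.
    apply: le_Rintegral => //.
    - by apply: within_integrable; exact: within_sub_itv uc.
    - apply: within_integrable; apply: within_mul; first exact: within_cst.
      exact: within_expR_affine.
    - move=> x; rewrite /= in_itv/= => /andP[sx xz].
      by rewrite [leLHS]uE ler_pM2r ?expR_gt0// fz// in_itv/= sx (le_trans xz).
  set E := expR (2 * a * (z - s)) in Iz.
  have E1 : 1 <= E by rewrite -expR0 ler_expR mulr_ge0 ?subr_ge0// ltW.
  have E0 : 0 < E by rewrite expR_gt0.
  have uz : u z <= c + f z * (E - 1) / 2.
    apply: (le_trans (uI _ zst)); rewrite lerD2l.
    rewrite (le_trans (ler_wpM2l (ltW a0) Iz))// le_eqVlt; apply/orP; left; apply/eqP.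
    by field; rewrite gt_eqF.
  have uzE : u z = f z * E by exact: uE.
  have p0 : 0 <= f z * (E - 1) by rewrite mulr_ge0 ?subr_ge0.
  have fzE : f z * E = f z + f z * (E - 1) by rewrite mulrBr mulr1 addrC subrK.
  by move: uz p0 f0; rewrite uzE fzE; move: (f z) (f z * (E - 1)) => p q; lra.
move=> x /andP[sx xt]; rewrite uE.
apply: ler_pM => //.
- by rewrite mulr_ge0 ?expR_ge0// u0// sx.
- by apply: le_trans fzc; apply: fz; rewrite in_itv/= sx.
- by rewrite ler_expR ler_pM2l// lerD2r.
Qed.

End gronwall.

Section half_line.
Variable R : realType.
Local Notation mu := (@lebesgue_measure R).

(** A path on the half-line is studied through its extension by the constant
    [f 0], which is continuous on the whole line. *)
Lemma continuous_nonneg_ext (U : topologicalType) (f : R -> U) :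
  continuous_nonneg f -> continuous (fun u : R => f (Num.max 0 u)).
Proof.
move=> /subspace_continuousP hf x.
have J (u : R) : [set` `[(0 : R), +oo[] (Num.max 0 u).
  by rewrite /= in_itv/= andbT le_max lexx.
apply: (@cvg_comp _ _ _ (Num.max (0:R)) f _ _ _ _ (hf _ (J x))) => V /= VP.
have c : {for x, continuous ((cst 0) \max (@idfun R))}.
  by apply: continuous_max; [exact: cvg_cst|exact: cvg_id].
have cV : nbhs x (fun u => ([set` `[(0 : R), +oo[] (Num.max 0 u) -> V (Num.max 0 u))).
  exact: (c _ VP).
by apply: filterS cV => u /(_ (J u)).
Qed.

Lemma continuous_nonneg_within (U : topologicalType) (f : R -> U) (s t : R) :
  0 <= s -> continuous_nonneg f -> {within `[s, t], continuous f}.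
Proof.
move=> s0; apply: continuous_subspaceW => x /=; rewrite !in_itv/= andbT.
by move=> /andP[sx _]; exact: le_trans sx.
Qed.

Lemma continuous_nonneg_shift (U : topologicalType) (f : R -> U) (c s t : R) :
  c <= s -> continuous_nonneg f -> {within `[s, t], continuous (fun u : R => f (u - c))}.
Proof.
move=> cs hf.
have h : continuous (fun u : R => f (Num.max 0 (u - c))).
  move=> x; apply: (@continuous_comp _ _ _ (fun u => u - c) (fun u => f (Num.max 0 u))).
    by apply: cvgB; [exact: cvg_id|exact: cvg_cst].
  exact: continuous_nonneg_ext.
have h' := @continuous_subspaceT _ _ `[s, t] _ h.
apply: subspace_eq_continuous h' => x; rewrite inE/= in_itv/= => /andP[sx _].
rewrite [LHS]/= [RHS]/=; have h0 : 0 <= x - c by rewrite subr_ge0 (le_trans cs).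
by rewrite /from_subspace (max_r h0).
Qed.

Lemma continuous_nonneg_bounded (m n : nat) (f : R -> 'M[R]_(m, n)) (t : R) :
  0 <= t -> continuous_nonneg f ->
  exists2 b, 0 < b & forall s i j, 0 <= s <= t -> `|f s i j| <= b.
Proof.
move=> t0 fc; have := within_matrix_norm (continuous_nonneg_within (t := t) (lexx 0) fc).
move=> /(EVT_max t0)[z _ hz]; exists (`|f z| + 1) => [|s i j st].
  by rewrite ltr_wpDl.
rewrite (le_trans (mx_entry_le _ _ _))// (le_trans (hz s _)) ?in_itv//.
by rewrite lerDl.
Qed.

Lemma periodic_mul (U : Type) (f : R -> U) (T : R) : 0 < T ->
  (forall t, 0 <= t -> f (t + T) = f t) ->
  forall (n : nat) t, 0 <= t -> f (t + n%:R * T) = f t.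
Proof.
move=> T0 fT; elim=> [|n IH] t t0; first by rewrite mul0r addr0.
by rewrite -natr1 mulrDl mul1r addrA fT ?IH// addr_ge0// mulr_ge0// ltW.
Qed.

Lemma periodic_bounded (m n : nat) (f : R -> 'M[R]_(m, n)) (T : R) : 0 < T ->
  continuous_nonneg f -> (forall t, 0 <= t -> f (t + T) = f t) ->
  exists2 b, 0 < b & forall s i j, 0 <= s -> `|f s i j| <= b.
Proof.
move=> T0 fc fT; have [b b0 hb] := continuous_nonneg_bounded (ltW T0) fc.
exists b => // s i j s0.
have /truncn_itv/andP[k1 k2] : 0 <= s / T by rewrite divr_ge0// ltW.
set k := Num.trunc _ in k1 k2.
rewrite ler_pdivlMr// in k1; rewrite ltr_pdivrMr// -natr1 mulrDl mul1r in k2.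
have sk : 0 <= s - k%:R * T by rewrite subr_ge0.
have -> : s = (s - k%:R * T) + k%:R * T by rewrite subrK.
by rewrite (periodic_mul T0 fT)// hb// sk/= lerBlDl ltW.
Qed.

End half_line.

Section linear_system.
Variables (R : realType) (d : nat) (A : R -> 'M[R]_d) (a : R).
Hypothesis A_cont : continuous_nonneg A.
Hypothesis a_gt0 : 0 < a.
Hypothesis A_le : forall s i j, 0 <= s -> `|A s i j| <= a.
Hypothesis d_gt0 : (0 < d)%N.
Local Notation mu := (@lebesgue_measure R).

Let da_gt0 : 0 < d%:R * a. Proof. by rewrite mulr_gt0 ?ltr0n. Qed.

Lemma drift_integrable (y : R -> 'cV[R]_d) (s t : R) i : 0 <= s ->
  {within `[s, t], continuous y} ->
  mu.-integrable `[s, t] (EFin \o (fun u => (A u *m y u) i 0)).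
Proof.
move=> s0 yc; apply: within_integrable; apply: within_mulmx_coord => //.
exact: continuous_nonneg_within.
Qed.

Lemma drift_integral_le (y : R -> 'cV[R]_d) (s t : R) i : 0 <= s ->
  {within `[s, t], continuous y} ->
  `|\int[mu]_(u in `[s, t]) ((A u *m y u) i 0)| <=
  d%:R * a * \int[mu]_(u in `[s, t]) `|y u|.
Proof.
move=> s0 yc; apply: (le_trans (le_normr_Rintegral _ (drift_integrable i s0 yc))) => //.
have yi : mu.-integrable `[s, t] (EFin \o (fun u => `|y u|)).
  by apply: within_integrable; exact: within_matrix_norm.
rewrite -RintegralZl//; apply: le_Rintegral => //.
- by apply: integrable_norm => //; exact: drift_integrable.
- by have := integrableZl _ (d%:R * a) yi; apply.
- move=> u; rewrite /= in_itv/= => /andP[su _]; apply: mulmx_norm_le => j k.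
  by apply: A_le; exact: le_trans su.
Qed.

Lemma linear_gronwall (y : R -> 'cV[R]_d) (s t c : R) : 0 <= s -> s <= t -> 0 <= c ->
  {within `[s, t], continuous y} ->
  (forall u i, s <= u <= t ->
     `|y u i 0 - \int[mu]_(v in `[s, u]) ((A v *m y v) i 0)| <= c) ->
  forall u, s <= u <= t -> `|y u| <= 2 * c * expR (2 * (d%:R * a) * (t - s)).
Proof.
move=> s0 st c0 yc hy; apply: gronwall => //; first exact: within_matrix_norm.
move=> u /andP[su ut].
have yc' : {within `[s, u], continuous y} by exact: within_sub_itv yc.
apply: mx_norm_le => [|i j].
  by rewrite addr_ge0// mulr_ge0 ?(ltW da_gt0)// Rintegral_ge0.
rewrite ord1 -[y u i 0](subrK (\int[mu]_(v in `[s, u]) ((A v *m y v) i 0))).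
rewrite (le_trans (ler_normD _ _))// lerD//; first by rewrite hy// su.
exact: drift_integral_le.
Qed.

(** Integral form of [dx = A x dt + dm] on [[c, +oo[]; it makes sense for paths
    [m] that are merely continuous, such as those of a stochastic integral. *)
Definition solution_from (c : R) (m x : R -> 'cV[R]_d) : Prop :=
  (forall t, {within `[c, t], continuous x}) /\
  forall t i, c <= t ->
    x t i 0 = x c i 0 + \int[mu]_(u in `[c, t]) ((A u *m x u) i 0) + (m t i 0 - m c i 0).

Lemma solution_restart (c s : R) (m x : R -> 'cV[R]_d) : 0 <= c -> c <= s ->
  solution_from c m x -> solution_from s m x.
Proof.
move=> c0 cs [xc xe]; split=> [t|t i st]; first exact: within_sub_itv (xc t).
have ct : c <= t by exact: le_trans st.
rewrite (xe t)// (xe s)//.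
have := Rintegral_itvB (drift_integrable i c0 (xc t)) (x := s).
rewrite !bnd_simp => /(_ cs st).
rewrite Rintegral_itv_obnd_cbnd; last first.
  apply: integrableS (drift_integrable i c0 (xc t)) => // u /=.
  by rewrite !in_itv/= => /andP[su ->]; rewrite (le_trans cs)// ltW.
by move=> <-; ring.
Qed.

Lemma solution_sub (c : R) (m x x' : R -> 'cV[R]_d) : 0 <= c ->
  solution_from c m x -> solution_from c (fun=> 0) x' ->
  solution_from c m (fun t => x t - x' t).
Proof.
move=> c0 [xc xe] [xc' xe']; split=> [t|t i ct].
  by move=> u; apply: cvgB; [exact: xc|exact: xc'].
rewrite !mxE (xe t)// (xe' t)// !mxE subr0 addr0.
have -> : \int[mu]_(u in `[c, t]) ((A u *m (x u - x' u)) i 0) =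
    \int[mu]_(u in `[c, t]) ((A u *m x u) i 0) - \int[mu]_(u in `[c, t]) ((A u *m x' u) i 0).
  rewrite -RintegralB//; try exact: drift_integrable.
  by apply: eq_Rintegral => u _; rewrite mulmxBr !mxE.
by ring.
Qed.

Lemma solution_growth (c t eta : R) (m x : R -> 'cV[R]_d) : 0 <= c -> 0 <= eta ->
  solution_from c m x ->
  (forall u i, c <= u <= t -> `|m u i 0 - m c i 0| <= eta) ->
  forall u, c <= u <= t -> `|x u| <= 2 * (`|x c| + eta) * expR (2 * (d%:R * a) * (t - c)).
Proof.
move=> c0 eta0 [xc xe] hm u /andP[cu ut].
apply: linear_gronwall => //; last by rewrite cu.
- exact: le_trans ut.
- by rewrite addr_ge0.
- move=> v i /andP[cv vt]; rewrite xe// [X in `|X|](_ : _ = x c i 0 + (m v i 0 - m c i 0)); last by ring.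
  by rewrite (le_trans (ler_normD _ _))// lerD ?mx_entry_le// hm// cv.
Qed.

End linear_system.

Section fundamental.
Variables (R : realType) (d : nat) (A Psi : R -> 'M[R]_d) (T : R).
Hypothesis A_cont : continuous_nonneg A.
Hypothesis T_gt0 : 0 < T.
Hypothesis A_periodic : forall t, 0 <= t -> A (t + T) = A t.
Hypothesis Psi_fund : is_fundamental_solution A Psi.
Local Notation mu := (@lebesgue_measure R).

(** At positive times the half-line is a neighbourhood, and the derivative is
    two-sided. *)
Lemma fundamental_derivable (u : R) i j : 0 < u ->
  is_derive u (1 : R) (fun u => Psi u i j) ((A u *m Psi u) i j).
Proof.
move=> u0; have [_ /(_ u (ltW u0)) h _] := Psi_fund.
have {}h : (s - u)^-1 *: (Psi s - Psi u) @[s --> u^'] --> A u *m Psi u.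
  apply: cvg_trans h => V /= [e /= e0 he].
  exists (Num.min e u); first by rewrite /= lt_min e0 u0.
  move=> s /= su; move: (su); rewrite lt_min => /andP[se su' sneq].
  apply: he => //; rewrite /= in_itv/= andbT.
  by move: su'; rewrite ltr_norml => /andP[_]; lra.
have {}h : (s - u)^-1 * (Psi s i j - Psi u i j) @[s --> u^'] --> (A u *m Psi u) i j.
  have := cvg_comp _ _ h (@coord_continuous _ _ _ i j _).
  by apply: cvg_trans; apply: near_eq_cvg; apply: nearW => s; rewrite /= !mxE.
have h' : k^-1 *: (Psi (k *: 1 + u) i j - Psi u i j) @[k --> (0 : R)^'] --> (A u *m Psi u) i j.
  have sh : k *: (1 : R) + u @[k --> (0 : R)^'] --> u^'.
    move=> V [e /= e0 he]; exists e => //= k; rewrite /= sub0r normrN => ke k0.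
    apply: he; rewrite /= /GRing.scale/= mulr1; last by rewrite -subr_eq0 addrK.
    by rewrite opprD addrCA subrr addr0 normrN.
  have := cvg_comp _ _ sh h; apply: cvg_trans; apply: near_eq_cvg; apply: nearW => k /=.
  by rewrite addrK /GRing.scale/= mulr1.
apply: DeriveDef; first by apply/cvg_ex; exists ((A u *m Psi u) i j).
exact: cvg_lim.
Qed.

(** Translates of a fundamental solution by multiples of the period solve the
    same homogeneous equation, because the coefficients are periodic. *)
Lemma fundamental_shift (v : 'cV[R]_d) (n : nat) :
  solution_from A (n%:R * T) (fun=> 0) (fun t => Psi (t - n%:R * T) *m v).
Proof.
have [Pc _ _] := Psi_fund; set c := n%:R * T.
have c0 : 0 <= c by rewrite mulr_ge0// ltW.
have Psic s t : c <= s -> {within `[s, t], continuous (fun u => Psi (u - c) *m v)}.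
  move=> cs; apply: within_matrix => i j.
  apply: within_mulmx_coord; last exact: within_cst.
  exact: continuous_nonneg_shift.
split=> [t|t i]; first exact: Psic.
rewrite le_eqVlt => /orP[/eqP <-|ct].
  by rewrite set_itv1 Rintegral_set1 !subrr !addr0.
pose F (u : R) := (Psi (u - c) *m v) i 0.
have dF u : c < u -> is_derive u (1 : R) F ((A u *m (Psi (u - c) *m v)) i 0).
  move=> cu; have uc : 0 < u - c by rewrite subr_gt0.
  have -> : A u = A (u - c).
    by rewrite -(periodic_mul T_gt0 A_periodic n (ltW uc)) subrK.
  have -> : F = \sum_k (fun u => Psi (u - c) i k * v k 0).
    by apply/funext => z; rewrite fct_sumE /F /= mxE.
  rewrite mulmxA mxE.
  apply: is_derive_sum => k.
  have dk : is_derive u (1:R) (fun u => Psi (u - c) i k) ((A (u - c) *m Psi (u - c)) i k).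
    have := fundamental_derivable i k uc.
    have : is_derive u (1 : R) (fun u : R => u - c) 1.
      by apply: is_derive_eq; rewrite subr0.
    move=> h1 h2; have := @is_derive1_comp _ _ (fun u : R => u - c) _ _ _ h2 h1.
    by rewrite mulr1.
  apply: is_derive_eq; rewrite scaler0 add0r /GRing.scale/= mulrC.
  by [].
have Fc : {within `[c, t], continuous F}.
  by apply: within_coord; exact: Psic.
have [_ Fc1 Fc2] := (continuous_within_itvP _ ct).1 Fc.
rewrite /Rintegral (@continuous_FTC2 _ _ F)//=.
- by rewrite -/(F c) -/(F t) subrr addr0 [RHS]addrC subrK.
- apply: within_mulmx_coord; first exact: continuous_nonneg_within.
  exact: Psic.
- split => // u; rewrite in_itv/= => /andP[cu _]; by have [] := dF _ cu.
- by move=> u; rewrite in_itv/= derive1E => /andP[cu _]; have [_ ->] := dF _ cu.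
Qed.

End fundamental.

(** * Contraction over long windows *)

Lemma mulmx_norm_le_half (R : realType) (d : nat) (C : 'M[R]_d) (v : 'cV[R]_d) :
  (0 < d)%N -> (forall i j, `|C i j| <= (2 * d%:R)^-1) -> `|C *m v| <= 2^-1 * `|v|.
Proof.
move=> d0 hC; apply: mx_norm_le => [|i j]; first by rewrite mulr_ge0.
rewrite ord1 (le_trans (mulmx_norm_le v i hC))// ler_wpM2r//.
by rewrite invfM mulrCA mulfV ?mulr1// pnatr_eq0 -lt0n.
Qed.

Section windows.
Variables (R : realType) (d : nat) (A Psi : R -> 'M[R]_d.+1) (a T : R).
Hypothesis A_cont : continuous_nonneg A.
Hypothesis a_gt0 : 0 < a.
Hypothesis A_le : forall s i j, 0 <= s -> `|A s i j| <= a.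
Hypothesis T_gt0 : 0 < T.
Hypothesis A_periodic : forall t, 0 <= t -> A (t + T) = A t.
Hypothesis Psi_fund : is_fundamental_solution A Psi.
Hypothesis Psi_stable : spectral_radius (Psi T) < 1.
Local Notation mu := (@lebesgue_measure R).
Local Notation D := (d.+1).

(** On a window starting at a multiple of the period, the path follows the
    homogeneous solution up to a multiple of the oscillation of [m]. *)
Lemma window_deviation (m x : R -> 'cV[R]_D) (j : nat) (t eta : R) :
  0 <= eta -> solution_from A 0 m x ->
  (forall u i, j%:R * T <= u <= t -> `|m u i 0 - m (j%:R * T) i 0| <= eta) ->
  forall u, j%:R * T <= u <= t ->
  `|x u - Psi (u - j%:R * T) *m x (j%:R * T)| <=
    2 * eta * expR (2 * (D%:R * a) * (t - j%:R * T)).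
Proof.
move=> eta0 xs hm u hu; set c := j%:R * T.
have c0 : 0 <= c by rewrite mulr_ge0// ltW.
have xs' := solution_sub A_cont c0 (solution_restart A_cont (lexx 0) c0 xs)
  (fundamental_shift A_cont T_gt0 A_periodic Psi_fund (x c) j).
have := solution_growth A_cont a_gt0 A_le (ltn0Sn _) c0 eta0 xs' hm hu.
have [_ _ Psi0] := Psi_fund.
by rewrite subrr Psi0 mul1mx subrr normr0 add0r.
Qed.

(** The columns of [Psi] are solutions with constant [m], for which the deviation
    from the homogeneous solution vanishes. *)
Lemma fundamental_power (j : nat) : Psi (j%:R * T) = Psi T ^+ j.
Proof.
have [_ _ Psi0] := Psi_fund.
elim: j => [|j IH]; first by rewrite mul0r Psi0 expr0.
rewrite exprS -IH; apply/matrixP => i k.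
have xs : solution_from A 0 (fun=> 0) (fun t => Psi t *m delta_mx k (0 : 'I_1)).
  have := fundamental_shift A_cont T_gt0 A_periodic Psi_fund (delta_mx k 0) 0.
  by congr solution_from; rewrite ?mul0r//; apply/funext => t; rewrite subr0.
have hm u (l : 'I_D) : j%:R * T <= u <= j.+1%:R * T ->
    `|((fun=> 0) u : 'cV[R]_D) l 0 - ((fun=> 0) (j%:R * T) : 'cV[R]_D) l 0| <= 0.
  by rewrite subrr normr0.
have jT : j%:R * T <= j.+1%:R * T <= j.+1%:R * T.
  by rewrite lexx andbT ler_wpM2r ?ler_nat// ltW.
have := window_deviation (lexx 0) xs hm jT.
rewrite mulr0 mul0r -mulrBl -natrB// subSn// subnn mul1r.
rewrite normr_le0 subr_eq0 => /eqP; rewrite mulmxA => h.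
by have := congr1 (fun M : 'cV[R]_D => M i 0) h; rewrite -!colE !mxE.
Qed.

Lemma contracting_window (h : R) : exists N : nat,
  h <= N%:R * T /\ forall v : 'cV[R]_D, `|Psi (N%:R * T) *m v| <= 2^-1 * `|v|.
Proof.
have e0 : 0 < (2 * D%:R : R)^-1 by rewrite invr_gt0 mulr_gt0 ?ltr0n.
have [N0 _ hN] := spectral_radius_lt1_powers Psi_stable e0.
exists (N0 + Num.trunc (h / T)).+1; split.
  rewrite -ler_pdivrMr//; apply: ltW; apply: lt_le_trans (truncnS_gt _) _.
  by rewrite ler_nat ltnS leq_addl.
move=> v; rewrite fundamental_power; apply: mulmx_norm_le_half => //.
by apply: hN; rewrite /= ltnW// ltnS leq_addr.
Qed.

Definition window_osc_le (L : R) (m : R -> 'cV[R]_D) (j : nat) (eta : R) : Prop :=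
  forall u i, j%:R * L <= u <= j.+1%:R * L -> `|m u i 0 - m (j%:R * L) i 0| <= eta.

(** One period need not be a contraction; a multiple [L] of it is, and it can be
    taken longer than any prescribed [h]. *)
Lemma stable_windows (h : R) : 0 < h -> exists L K : R, [/\ h <= L, 0 < K &
  forall m x, solution_from A 0 m x -> forall j eta, 0 <= eta ->
    window_osc_le L m j eta ->
    `|x (j.+1%:R * L)| <= 2^-1 * `|x (j%:R * L)| + K * eta /\
    forall u, j%:R * L <= u <= j.+1%:R * L -> `|x u| <= K * (`|x (j%:R * L)| + eta)].
Proof.
move=> h0; have [N [hN PsiN]] := contracting_window h.
set L := N%:R * T in hN PsiN *.
have L0 : 0 < L by exact: lt_le_trans hN.
exists L, (2 * expR (2 * (D%:R * a) * L)); split => //.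
  by rewrite mulr_gt0// expR_gt0.
move=> m x xs j eta eta0 hm.
have jL : j.+1%:R * L - j%:R * L = L.
  by rewrite -mulrBl -natrB// subSn// subnn mul1r.
have jLE : j%:R * L = (j * N)%:R * T by rewrite natrM mulrA.
have jLu : j%:R * L <= j.+1%:R * L <= j.+1%:R * L.
  by rewrite lexx andbT ler_wpM2r ?ler_nat// ltW.
split.
  have := hm; rewrite /window_osc_le jLE => hm'.
  have := jLu; rewrite {1}jLE => jLu'.
  have := window_deviation eta0 xs hm' jLu'.
  rewrite -jLE jL => hd; rewrite -[x (_ * _)](subrK (Psi L *m x (j%:R * L))).
  rewrite addrC (le_trans (ler_normD _ _))// lerD//.
  by rewrite (le_trans hd)// mulrAC.
move=> u hu; have c0 : 0 <= j%:R * L by rewrite mulr_ge0// ltW.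
have := solution_growth A_cont a_gt0 A_le (ltn0Sn _) c0 eta0
  (solution_restart A_cont (lexx 0) c0 xs) hm hu.
by rewrite jL mulrAC.
Qed.

(** The increment of [m] is that of [x] minus the integral of the drift, and both
    are controlled by a bound on [x]. *)
Lemma increment_le_bound (m x : R -> 'cV[R]_D) (h c s : R) i : 0 < h -> 0 <= s ->
  solution_from A 0 m x -> (forall t, s <= t -> `|x t| <= c) ->
  `|m (s + h) i 0 - m s i 0| <= (2 + D%:R * a * h) * c.
Proof.
move=> h0 s0 xs hx.
have [xc xe] := solution_restart A_cont (lexx 0) s0 xs.
have sh : s <= s + h by rewrite lerDl ltW.
have -> : m (s + h) i 0 - m s i 0 = x (s + h) i 0 - x s i 0 -
    \int[mu]_(u in `[s, (s + h)]) ((A u *m x u) i 0).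
  by rewrite (xe _ i sh); ring.
rewrite (le_trans (ler_normB _ _))// mulrDl lerD//.
  rewrite (le_trans (ler_normB _ _))// mulr_natl mulr2n.
  by rewrite lerD// (le_trans (mx_entry_le _ _ _))// hx.
rewrite (le_trans (drift_integral_le A_cont A_le i s0 (xc _)))//.
rewrite -[leRHS]mulrA ler_wpM2l//; first by rewrite mulr_ge0// ltW.
have -> : h * c = \int[mu]_(u in `[s, (s + h)]) c.
  rewrite Rintegral_cst//= lebesgue_measure_itv/= lte_fin ltrDl h0 /=.
  by rewrite addrAC subrr add0r mulrC.
apply: le_Rintegral => //.
- by apply: within_integrable; apply: within_matrix_norm; exact: xc.
- by apply: within_integrable; exact: within_cst.
- by move=> u /=; rewrite in_itv/= => /andP[su _]; exact: hx.
Qed.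

End windows.

(** * From oscillations of the driving path to asymptotics of the solution *)

Section euclidean_norm.
Variables (R : realType) (m n : nat).
Implicit Types M : 'M[R]_(m, n).

Lemma fnorm_ge0 M : 0 <= fnorm M. Proof. exact: sqrtr_ge0. Qed.

Lemma fnorm_sqr M : fnorm M ^+ 2 = \sum_i \sum_j M i j ^+ 2.
Proof.
by rewrite sqr_sqrtr//; apply: sumr_ge0 => i _; apply: sumr_ge0 => j _; exact: sqr_ge0.
Qed.

Lemma entry_sqr_le_fnorm M i j : M i j ^+ 2 <= fnorm M ^+ 2.
Proof.
rewrite fnorm_sqr (bigD1 i)//= (bigD1 j)//= -addrA lerDl addr_ge0//.
  by apply: sumr_ge0 => k _; exact: sqr_ge0.
by apply: sumr_ge0 => k _; apply: sumr_ge0 => l _; exact: sqr_ge0.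
Qed.

Lemma entry_le_fnorm M i j : `|M i j| <= fnorm M.
Proof.
by rewrite -ler_sqr ?nnegrE ?fnorm_ge0// real_normK ?num_real ?entry_sqr_le_fnorm.
Qed.

Lemma mx_norm_le_fnorm M : `|M| <= fnorm M.
Proof. by apply: mx_norm_le => [|i j]; [exact: fnorm_ge0|exact: entry_le_fnorm]. Qed.

End euclidean_norm.

Lemma fnorm_sqr_le_entries (R : realType) (m n : nat) (M : 'M[R]_(m, n)) e :
  (forall i j, `|M i j| <= e) -> fnorm M ^+ 2 <= m%:R * n%:R * e ^+ 2.
Proof.
move=> h; rewrite fnorm_sqr.
rewrite (le_trans (ler_sum _ (G := fun=> n%:R * e ^+ 2) _))//.
  move=> i _; rewrite (le_trans (ler_sum _ (G := fun=> e ^+ 2) _))//.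
    move=> j _; rewrite -real_normK ?num_real// ler_sqr ?nnegrE//.
    by rewrite (le_trans _ (h i j)).
  by rewrite sumr_const card_ord mulr_natl.
by rewrite sumr_const card_ord -[leLHS]mulr_natl mulrA.
Qed.

Lemma fnorm_sqr_le (R : realType) (d : nat) (x : 'cV[R]_d) :
  fnorm x ^+ 2 <= d%:R * `|x| ^+ 2.
Proof. by have := fnorm_sqr_le_entries (mx_entry_le x); rewrite mulr1. Qed.

Lemma fnorm_le (R : realType) (d : nat) (x : 'cV[R]_d) : fnorm x <= d%:R * `|x|.
Proof.
rewrite -ler_sqr ?nnegrE ?fnorm_ge0 ?mulr_ge0//.
rewrite (le_trans (fnorm_sqr_le x))// exprMn ler_wpM2r ?sqr_ge0//.
by rewrite -natrX ler_nat; case: d {x} => // k; rewrite leq_pmulr.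
Qed.

Section limits_at_infinity.
Variable R : realType.
Implicit Types f : R -> R.

Lemma near_pinfty_ge (c : R) : \forall t \near +oo, c <= t.
Proof. by apply: nbhs_pinfty_ge; exact: num_real. Qed.

Lemma limsup_infty_le f (c : R) : (\forall t \near +oo, f t <= c) ->
  (limsup_infty f <= c%:E)%E.
Proof.
move=> fc; rewrite /limsup_infty limf_esupE.
apply: ereal_inf_le; exists (ereal_sup [set (f t)%:E | t in [set t | f t <= c]]).
  by exists [set t | f t <= c].
by apply: ge_ereal_sup => _ [t /= ft <-]; rewrite lee_fin.
Qed.

Lemma le_limsup_infty f (c : R) : (forall t0, exists2 t, t0 <= t & c <= f t) ->
  (c%:E <= limsup_infty f)%E.
Proof.
move=> fc; rewrite /limsup_infty limf_esupE; apply: le_ereal_inf_tmp => _ [V [t0 [_ V0]] <-].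
have [t t0t ct] := fc (t0 + 1).
apply: (@le_trans _ _ (f t)%:E); first by rewrite lee_fin.
by apply: ereal_sup_ubound; exists t => //; apply: V0; apply: lt_le_trans t0t; rewrite ltrDl.
Qed.

Lemma liminf_infty_eq0 f : (forall t, 0 <= f t) ->
  (forall e, 0 < e -> forall t0, exists2 t, t0 <= t & f t <= e) ->
  liminf_infty f = 0%E.
Proof.
move=> f0 fe.
suff : limsup_infty (fun t => - f t) = 0%E.
  by rewrite /liminf_infty /limsup_infty /limf_einf => ->; rewrite oppe0.
apply/eqP; rewrite eq_le; apply/andP; split.
  by apply: limsup_infty_le; apply: nearW => t; rewrite oppr_le0.
apply/lee_addgt0Pr => e e0.
have : ((- e)%:E <= limsup_infty (fun t => - f t)%R)%E.
  apply: le_limsup_infty => t0; have [t tt0 ft] := fe _ e0 t0.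
  by exists t => //; rewrite lerN2.
by rewrite -(@leeD2rE _ e%:E)//= -EFinD addNr.
Qed.

End limits_at_infinity.

Section pathwise.
Variables (R : realType) (d : nat) (L K : R).
Hypothesis L_gt0 : 0 < L.
Hypothesis K_gt0 : 0 < K.
Local Notation D := (d.+1).
Local Notation mu := (@lebesgue_measure R).
Variables (m x : R -> 'cV[R]_D).
Hypothesis x_cont : forall t, {within `[0, t], continuous x}.
(* The driven linear equation enters only through these two estimates. *)
Hypothesis x_windows : forall j eta, 0 <= eta -> window_osc_le L m j eta ->
    `|x (j.+1%:R * L)| <= 2^-1 * `|x (j%:R * L)| + K * eta /\
    forall u, j%:R * L <= u <= j.+1%:R * L -> `|x u| <= K * (`|x (j%:R * L)| + eta).

Lemma path_energy_integrable t :
  mu.-integrable `[0, t] (EFin \o (fun s => fnorm (x s) ^+ 2)).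
Proof.
have -> : (fun s => fnorm (x s) ^+ 2) = (fun s => \sum_i \sum_j x s i j ^+ 2).
  by apply/funext => s; exact: fnorm_sqr.
apply: within_integrable.
apply: within_sum => i; apply: within_sum => j.
apply: (@within_comp _ _ (fun s => x s i j) (fun y => y ^+ 2)) => [|y].
  exact: within_coord.
exact: sqr_continuous.
Qed.

Lemma window_index (t : R) : 0 <= t ->
  (Num.trunc (t / L))%:R * L <= t <= (Num.trunc (t / L)).+1%:R * L.
Proof.
move=> t0; have /truncn_itv/andP[h1 h2] : 0 <= t / L by rewrite divr_ge0// ltW.
by rewrite -ler_pdivlMr// h1 -ler_pdivrMr// ltW.
Qed.

(** The values at the ends of the windows satisfy [a_(j+1) <= a_j / 2 + K b], and
    the windows are filled in from their left ends. *)
Lemma path_eventually_le (b : R) : 0 < b ->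
  (\forall j \near \oo, window_osc_le L m j b) ->
  \forall t \near +oo, `|x t| <= (4 * K ^+ 2 + K) * b.
Proof.
move=> b0 [j0 _ hj].
have Kb0 : 0 < K * b by rewrite mulr_gt0.
have q01 : 0 <= (2^-1 : R) < 1 by rewrite invr_ge0 ler0n invf_lt1// ltr1n.
have [|j1 _ hj1] := contraction_eventually_le q01 Kb0
  (a := fun j => `|x (j%:R * L)|) (fun j => normr_ge0 _).
  by exists j0 => // j /= jj; have [] := x_windows (ltW b0) (hj j jj).
near=> t.
have t0 : 0 <= t by near: t; exact: near_pinfty_ge.
have tj : (maxn j0 j1)%:R <= t / L.
  by rewrite ler_pdivlMr//; near: t; exact: near_pinfty_ge.
have := window_index t0; set j := Num.trunc _ => tjL.
have jj : (maxn j0 j1 <= j)%N by rewrite truncn_ge_nat// divr_ge0// ltW.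
move: jj; rewrite geq_max => /andP[jj0 jj1].
have [_ /(_ _ tjL) h] := x_windows (ltW b0) (hj j jj0).
rewrite (le_trans h)// mulrDl mulrDr lerD// expr2 -!mulrA mulrCA ler_wpM2l//.
  exact: ltW.
rewrite (le_trans (hj1 j jj1))// le_eqVlt; apply/orP; left; apply/eqP; field.
Unshelve. all: by end_near. Qed.

Variable eta : nat -> R.
Hypothesis eta_ge0 : forall j, 0 <= eta j.
Hypothesis eta_osc : forall j, window_osc_le L m j (eta j).

(** Squaring [a_(j+1) <= a_j / 2 + K eta_j] gives
    [a_(j+1)^2 <= a_j^2 / 2 + 2 K^2 eta_j^2], so that the sum of the [a_j^2] is
    controlled by that of the [eta_j^2]. *)
Lemma path_energy_le : exists C0 C1 : R, [/\ 0 <= C0, 0 <= C1 & forall J : nat,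
  \int[mu]_(s in `[0, J%:R * L]) (fnorm (x s) ^+ 2) <=
    C0 + C1 * \sum_(j < J) eta j ^+ 2].
Proof.
pose al j := `|x (j%:R * L)|.
have al0 j : 0 <= al j by exact: normr_ge0.
have K0 := ltW K_gt0.
have sq J : \sum_(j < J) al j ^+ 2 + 2 * al J ^+ 2 <=
    2 * al 0 ^+ 2 + 4 * K ^+ 2 * \sum_(j < J) eta j ^+ 2.
  elim: J => [|J IH]; first by rewrite !big_ord0 mulr0 addr0 add0r.
  rewrite !big_ord_recr/= mulrDr addrA; apply: le_trans (lerD IH (lexx _)).
  have [h _] := x_windows (eta_ge0 J) (@eta_osc J).
  rewrite -!addrA lerD2l.
  have h2 : al J.+1 ^+ 2 <= (2^-1 * al J + K * eta J) ^+ 2.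
    have n0 : 0 <= 2^-1 * al J + K * eta J by rewrite addr_ge0// mulr_ge0// invr_ge0.
    by rewrite ler_sqr ?nnegrE.
  have : 0 <= (2^-1 * al J - K * eta J) ^+ 2 by exact: sqr_ge0.
  move: h2; rewrite sqrrD sqrrB !exprMn; move: (K * eta J) => z.
  by lra.
pose C := D%:R * (2 * L * K ^+ 2).
have C_ge0 : 0 <= C by rewrite /C !mulr_ge0// ?sqr_ge0// ltW.
have xi2 t : mu.-integrable `[0, t] (EFin \o (fun s => fnorm (x s) ^+ 2)).
  exact: path_energy_integrable.
have en J : \int[mu]_(s in `[0, J%:R * L]) (fnorm (x s) ^+ 2) <=
    C * (\sum_(j < J) (al j ^+ 2 + eta j ^+ 2)).
  elim: J => [|J IH]; first by rewrite mul0r set_itv1 Rintegral_set1 big_ord0 mulr0.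
  have J0 : 0 <= J%:R * L by rewrite mulr_ge0// ltW.
  have JS : J%:R * L <= J.+1%:R * L by rewrite ler_pM2r// ler_nat.
  have := Rintegral_itvB (xi2 (J.+1%:R * L)) (x := J%:R * L).
  rewrite !bnd_simp => /(_ J0 JS) /eqP; rewrite subr_eq addrC => /eqP ->.
  rewrite big_ord_recr/= mulrDr lerD// Rintegral_itv_obnd_cbnd; last first.
    apply: integrableS (xi2 (J.+1%:R * L)) => // u /=.
    by rewrite !in_itv/= => /andP[su ->]; rewrite (le_trans J0)// ltW.
  have [_ hw] := x_windows (eta_ge0 J) (@eta_osc J).
  apply: (@le_trans _ _ (\int[mu]_(s in `[(J%:R * L)%R, (J.+1%:R * L)%R])
     (D%:R * (K * (al J + eta J)) ^+ 2))).
    apply: le_Rintegral => //.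
    - apply: integrableS (xi2 (J.+1%:R * L)) => // u /=.
      by rewrite !in_itv/= => /andP[su ->]; rewrite (le_trans J0).
    - by apply: within_integrable; exact: within_cst.
    - move=> s; rewrite /= in_itv/= => /hw hs.
      rewrite (le_trans (fnorm_sqr_le _))// ler_wpM2l//.
      rewrite ler_sqr ?nnegrE//.
      by rewrite mulr_ge0// addr_ge0.
  rewrite Rintegral_cst//= lebesgue_measure_itv/= lte_fin ltr_pM2r// ltr_nat ltnSn/=.
  rewrite -mulrBl -natrB// subSn// subnn mul1r /C exprMn.
  have : 0 <= (al J - eta J) ^+ 2 by exact: sqr_ge0.
  move: (al J) (eta J) => p q h.
  rewrite [leLHS](_ : _ = D%:R * L * K ^+ 2 * (p + q) ^+ 2); last by ring.
  rewrite [leRHS](_ : _ = D%:R * L * K ^+ 2 * (2 * (p ^+ 2 + q ^+ 2))); last by ring.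
  rewrite ler_wpM2l//; first by rewrite !mulr_ge0// ?sqr_ge0// ltW.
  by move: h; rewrite sqrrB sqrrD; lra.
exists (C * (2 * al 0 ^+ 2)), (C * (4 * K ^+ 2 + 1)); split.
- by apply: mulr_ge0 => //; apply: mulr_ge0 => //; exact: sqr_ge0.
- by apply: mulr_ge0 => //; apply: addr_ge0 => //; apply: mulr_ge0 => //; exact: sqr_ge0.
move=> J; apply: (le_trans (en J)); rewrite big_split/=.
have aJ : 0 <= al J ^+ 2 by exact: sqr_ge0.
move: (sq J) aJ; move: (\sum_(j < J) al j ^+ 2) (\sum_(j < J) eta j ^+ 2) (al J ^+ 2).
move=> S1 S2 z h z0.
rewrite -[C * (4 * _ + 1) * _]mulrA -mulrDr ler_wpM2l// [(_ + 1) * _]mulrDl mul1r addrA lerD2r.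
by apply: le_trans h; rewrite lerDl mulr_ge0.
Qed.

(** The energy up to time [t] is compared with the energy up to the next time of
    the form [4^k L], at the cost of a factor 4. *)
Lemma path_average_cvg0 :
  (4 ^+ k)^-1 * (\sum_(j < 4 ^ k) eta j ^+ 2) @[k --> \oo] --> (0 : R) ->
  t^-1 * (\int[mu]_(s in `[0, t]) (fnorm (x s) ^+ 2)) @[t --> +oo] --> (0 : R).
Proof.
have [C0 [C1 [C00 C10 en]]] := path_energy_le.
move=> avg.
have avg' : (4 ^+ k)^-1 * (C0 + C1 * \sum_(j < 4 ^ k) eta j ^+ 2) @[k --> \oo] --> (0 : R).
  have -> : (fun k => (4 ^+ k)^-1 * (C0 + C1 * \sum_(j < 4 ^ k) eta j ^+ 2)) =
     (fun k => (4^-1) ^+ k * C0 + C1 * ((4 ^+ k)^-1 * \sum_(j < 4 ^ k) eta j ^+ 2)).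
    by apply/funext => k; rewrite exprVn mulrDr (mulrCA C1).
  rewrite -[X in _ --> X](_ : 0 * C0 + C1 * 0 = 0); last by rewrite mul0r mulr0 addr0.
  apply: cvgD; last by apply: cvgM => //; exact: cvg_cst.
  apply: cvgM; last exact: cvg_cst.
  by apply: cvg_expr; rewrite ger0_norm ?invr_ge0// invf_lt1// ltr1n.
apply/cvgrPdist_le => e e0.
have e'0 : 0 < e * L / 4 by rewrite divr_gt0// mulr_gt0.
have [k0 _ hk] := (cvgrPdist_le _ _).1 avg' _ e'0.
near=> t; rewrite sub0r normrN.
have t0 : 0 < t by near: t; apply: nbhs_pinfty_gt; exact: num_real.
have tk : (4 ^ k0)%:R <= t / L.
  by rewrite ler_pdivlMr//; near: t; exact: near_pinfty_ge.
pose n := Num.trunc (t / L); pose k := trunc_log 4 n.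
have nk0 : (4 ^ k0 <= n)%N by rewrite truncn_ge_nat// divr_ge0 ?ltW.
have n0 : (0 < n)%N by apply: leq_trans nk0; rewrite expn_gt0.
have kk0 : (k0 <= k)%N by rewrite trunc_log_max.
have [kn nk] : (4 ^ k <= n)%N /\ (n < 4 ^ k.+1)%N.
  by split; [exact: trunc_logP|exact: trunc_log_ltn].
have tL : t <= (4 ^ k.+1)%:R * L.
  by rewrite -ler_pdivrMr// ltW// (lt_le_trans (truncnS_gt _))// ler_nat.
have Lt : (4 ^ k)%:R * L <= t.
  by rewrite -ler_pdivlMr// (le_trans _ (_ : n%:R <= _))// ?ler_nat// truncn_le divr_ge0// ltW.
have xi2 u : mu.-integrable `[0, u] (EFin \o (fun s => fnorm (x s) ^+ 2)).
  by exact: path_energy_integrable.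
have I0 : 0 <= \int[mu]_(s in `[0, t]) (fnorm (x s) ^+ 2).
  by apply: Rintegral_ge0 => s _; exact: sqr_ge0.
have It : \int[mu]_(s in `[0, t]) (fnorm (x s) ^+ 2) <=
    C0 + C1 * \sum_(j < 4 ^ k.+1) eta j ^+ 2.
  apply: le_trans (en _).
  have := Rintegral_itvB (xi2 ((4 ^ k.+1)%:R * L)) (x := t).
  rewrite !bnd_simp => /(_ (ltW t0) tL) /eqP; rewrite subr_eq addrC => /eqP ->.
  by rewrite lerDl Rintegral_ge0// => s _; exact: sqr_ge0.
have /= := hk k.+1 (leqW kk0); rewrite sub0r normrN ger0_norm; last first.
  by rewrite mulr_ge0 ?invr_ge0 ?exprn_ge0// (le_trans I0).
rewrite ler_pdivrMl ?exprn_gt0// => h.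
rewrite ger0_norm; last by rewrite mulr_ge0// invr_ge0 ltW.
rewrite ler_pdivrMl//.
rewrite (le_trans It)// (le_trans h)//.
rewrite exprS -natrX.
rewrite [leLHS](_ : _ = (4 ^ k)%:R * L * e); last by field.
by rewrite ler_pM2r.
Unshelve. all: by end_near. Qed.

End pathwise.

(** If [f] stayed above [e], the averages of [f ^+ 2] would stay above [e^2 / 2]. *)
Lemma liminf_of_average (R : realType) (f : R -> R) : (forall t, 0 <= f t) ->
  (forall t, lebesgue_measure.-integrable `[0, t] (EFin \o (fun s => f s ^+ 2))) ->
  t^-1 * (\int[lebesgue_measure]_(s in `[0, t]) (f s ^+ 2)) @[t --> +oo] --> (0 : R) ->
  liminf_infty f = 0%E.
Proof.
move=> f0 fi avg; apply: liminf_infty_eq0 => // e e0 t0.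
apply: contrapT => h.
have {}h t : t0 <= t -> e <= f t.
  move=> tt; rewrite leNgt; apply/negP => ft; apply: h; exists t => //; exact: ltW.
have e20 : 0 < e ^+ 2 / 4 by rewrite divr_gt0// exprn_gt0.
have [t1 [_ ht1]] := (cvgrPdist_le _ _).1 avg _ e20.
pose t2 := Num.max 0 t0; pose t := Num.max (t1 + 1) (2 * t2 + 1).
have t20 : 0 <= t2 by rewrite le_max lexx.
have t02 : t0 <= t2 by rewrite le_max lexx orbT.
have tt1 : t1 < t by rewrite lt_max ltrDl ltr01.
have tt2 : 2 * t2 + 1 <= t by rewrite le_max lexx orbT.
have tp : 0 < t by lra.
have /= := ht1 _ tt1; rewrite sub0r normrN.
suff I : e ^+ 2 * (t - t2) <= \int[lebesgue_measure]_(s in `[0, t]) (f s ^+ 2).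
  have I0 : 0 <= \int[lebesgue_measure]_(s in `[0, t]) (f s ^+ 2).
    by apply: Rintegral_ge0 => s _; exact: sqr_ge0.
  rewrite ger0_norm; last by rewrite mulr_ge0// invr_ge0 ltW.
  rewrite ler_pdivrMl// leNgt => /negP; apply.
  apply: lt_le_trans I; rewrite mulrCA ltr_pM2l ?exprn_gt0//.
  by lra.
have t2t : t2 <= t by lra.
have := Rintegral_itvB (fi t) (x := t2).
rewrite !bnd_simp => /(_ t20 t2t) /eqP; rewrite subr_eq addrC => /eqP ->.
have sub : `]t2, t] `<=` `[0, t].
  by move=> u /=; rewrite !in_itv/= => /andP[su ->]; rewrite (le_trans t20)// ltW.
have sub' : `[t2, t] `<=` `[0, t].
  by move=> u /=; rewrite !in_itv/= => /andP[su ->]; rewrite (le_trans t20).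
rewrite Rintegral_itv_obnd_cbnd; last by apply: integrableS (fi t).
apply: (@le_trans _ _ (\int[lebesgue_measure]_(s in `[t2, t]) (f s ^+ 2))); last first.
  by rewrite lerDr Rintegral_ge0// => s _; exact: sqr_ge0.
apply: (@le_trans _ _ (\int[lebesgue_measure]_(s in `[t2, t]) (e ^+ 2))).
  rewrite Rintegral_cst//= lebesgue_measure_itv/= lte_fin.
  by case: ltP => //= tt; rewrite mulr0 mulr_ge0_le0 ?sqr_ge0// subr_le0.
apply: le_Rintegral => //.
- by apply: within_integrable; exact: within_cst.
- by apply: integrableS (fi t).
- move=> s; rewrite /= in_itv/= => /andP[ts _].
  by rewrite ler_sqr ?nnegrE ?(ltW e0)// h// (le_trans t02).
Qed.

(** * Integrals of products of independent factors *)

Section factor_integral.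
Import HBNNSimple.
Context d d' (T : measurableType d) (U : measurableType d') (R : realType).
Variables (P : {measure set T -> \bar R}) (nu : {measure set U -> \bar R}).
Variables (H : T -> R) (Y : T -> U) (c : R).
Hypothesis mH : measurable_fun setT H.
Hypothesis H0 : forall w, 0 <= H w.
Hypothesis mY : measurable_fun setT Y.
Hypothesis HY : forall V, measurable V ->
  (\int[P]_w (H w * \1_V (Y w))%:E = c%:E * nu V)%E.

Lemma factor_integral_nnsfun (g : {nnsfun U >-> R}) :
  (\int[P]_w (H w * g (Y w))%:E = c%:E * \int[nu]_y (g y)%:E)%E.
Proof.
have mHV V : measurable V -> measurable_fun setT (fun w => (H w * \1_V (Y w))%:E).
  move=> mV; apply/measurable_EFinP; apply: measurable_funM => //.
  by apply: measurableT_comp => //; exact: measurable_indic.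
have gE : forall y, g y = \sum_(r \in range g) r * \1_(g @^-1` [set r]) y.
  by move=> y; rewrite fimfunE.
have mgr r : measurable (g @^-1` [set r]) by exact: measurable_sfunP.
transitivity (\int[P]_w (\sum_(r \in range g) (r%:E * (H w * \1_(g @^-1` [set r]) (Y w))%:E)))%E.
  apply: eq_integral => w _; rewrite gE fsumEFin// mulr_fsumr//; congr EFin.
  by apply: eq_fsbigr => r _; rewrite mulrCA.
rewrite ge0_integral_fsum//=; first last.
- move=> r w _; have [r0|r0] := leP 0 r.
    by rewrite lee_fin !mulr_ge0.
  rewrite preimage_nnfun0//  indic0 mulr0 mule0//.
- by move=> r; apply: measurable_funeM; exact: mHV.
transitivity (\sum_(r \in range g) (c%:E * (r%:E * nu (g @^-1` [set r]))))%E.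
  apply: eq_fsbigr => r /set_mem[y _ <-]; rewrite ge0_integralZl//.
  + by rewrite HY// muleCA.
  + exact: mHV.
  + by move=> w _; rewrite lee_fin mulr_ge0.
  + by rewrite lee_fin.
rewrite integralT_nnsfun sintegralE ge0_mule_fsumr//.
move=> r; have [r0|r0] := leP 0 r; first by rewrite mule_ge0.
by rewrite preimage_nnfun0// measure0 mule0.
Qed.

(** The hypothesis identifies the image under [Y] of the measure of density [H]
    with [c] times [nu]; integrals against both are compared on simple functions. *)
Lemma factor_integral (g : U -> R) : measurable_fun setT g -> (forall y, 0 <= g y) ->
  (\int[P]_w (H w * g (Y w))%:E = c%:E * \int[nu]_y (g y)%:E)%E.
Proof.
move=> mg g0; have mg' : measurable_fun setT (EFin \o g) by exact/measurable_EFinP.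
pose f_ := nnsfun_approx measurableT mg'.
have fg y : ((f_ n y)%:E @[n --> \oo] --> (g y)%:E)%E.
  by apply: (@cvg_nnsfun_approx _ _ _ _ measurableT (EFin \o g)) => // z _; rewrite lee_fin.
have f_nd y a b : (a <= b)%N -> f_ a y <= f_ b y.
  by move=> ab; exact/lefP/nd_nnsfun_approx.
transitivity (limn (fun n => \int[P]_w (H w * f_ n (Y w))%:E)%E).
  rewrite -monotone_convergence//=.
  - apply: eq_integral => w _; apply/esym/cvg_lim => //.
    under eq_fun do rewrite EFinM.
    by rewrite EFinM; apply: cvgeZl.
  - move=> n; apply/measurable_EFinP; apply: measurable_funM => //.
    exact: measurableT_comp.
  - by move=> n w _; rewrite lee_fin mulr_ge0.
  - by move=> w _ a b ab; rewrite lee_fin ler_wpM2l//; exact: f_nd.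
rewrite (_ : (\int[nu]_y (g y)%:E = limn (fun n => \int[nu]_y (f_ n y)%:E))%E); last first.
  rewrite -monotone_convergence//=.
  - by apply: eq_integral => y _; apply/esym/cvg_lim.
  - by move=> n; exact/measurable_EFinP.
  - by move=> n y _; rewrite lee_fin.
  - by move=> y _ a b ab; rewrite lee_fin; exact: f_nd.
rewrite -limeMl//.
  by congr (limn _); apply/funext => n /=; rewrite factor_integral_nnsfun.
apply/ereal_nondecreasing_is_cvgn => a b ab; apply: ge0_le_integral => //.
- by move=> y _; rewrite lee_fin.
- exact/measurable_EFinP.
- exact/measurable_EFinP.
- by move=> y _; rewrite lee_fin; exact: f_nd.
Qed.

End factor_integral.

(** Independence is assumed on indicators only; the factors are replaced one
    after the other by nonnegative functions. *)
Lemma product_integral d (T : measurableType d) (R : realType)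
    (P : {measure set T -> \bar R}) (nu : probability (measurableTypeR R) R)
    (H : T -> R) (c : R) (r : nat) (Y : 'I_r -> T -> R)
    (g : 'I_r -> R -> R) (e : 'I_r -> R) :
  measurable_fun setT H -> (forall w, 0 <= H w) ->
  (forall i, measurable_fun setT (Y i)) ->
  (forall V : 'I_r -> set R, (forall i, measurable (V i)) ->
    (\int[P]_w (H w * \prod_i \1_(V i) (Y i w))%:E = c%:E * \prod_i nu (V i))%E) ->
  (forall i, measurable_fun setT (g i)) -> (forall i y, 0 <= g i y) ->
  (forall i, \int[nu]_y (g i y)%:E = (e i)%:E)%E ->
  (\int[P]_w (H w * \prod_i g i (Y i w))%:E = (c * \prod_i e i)%:E)%E.
Proof.
move=> mH H0 mY HV mg g0 ge.
suff S (k : nat) : (k <= r)%N -> forall (f : 'I_r -> R -> R) (e' : 'I_r -> R),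
    (forall i, measurable_fun setT (f i)) -> (forall i y, 0 <= f i y) ->
    (forall i, \int[nu]_y (f i y)%:E = (e' i)%:E)%E ->
    (forall i : 'I_r, (k <= i)%N -> exists2 V, measurable V & f i = \1_V) ->
    (\int[P]_w (H w * \prod_i f i (Y i w))%:E = (c * \prod_i e' i)%:E)%E.
  by apply: (S r) => // i; rewrite leqNgt ltn_ord.
elim: k => [_|k IH kr] f e' mf f0 fe fV.
  pose V i := projT1 (cid2 (fV i isT)).
  have VP i : measurable (V i) /\ f i = \1_(V i) by rewrite /V; case: cid2.
  under eq_integral do under eq_bigr do rewrite (VP _).2.
  rewrite HV => [|i]; last exact: (VP i).1.
  rewrite EFinM -prodEFin; congr (_ * _)%E; apply: eq_bigr => i _.
  by rewrite -fe (VP i).2 integral_indic ?setIT//; exact: (VP i).1.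
pose k' := Ordinal kr.
have e'0 i : 0 <= e' i by rewrite -lee_fin -fe integral_ge0// => y _; rewrite lee_fin.
pose H' w := H w * \prod_(i | i != k') f i (Y i w).
pose c' := c * \prod_(i | i != k') e' i.
under eq_integral do rewrite (bigD1 k')//= [f k' _ * _]mulrC mulrA -/(H' _).
rewrite (bigD1 k')//= [e' k' * _]mulrC mulrA -/c' EFinM -fe.
have mprod (s : seq 'I_r) (h : 'I_r -> R -> R) (Q : pred 'I_r) :
    (forall i, measurable_fun setT (h i)) ->
    measurable_fun setT (fun w => \prod_(i <- s | Q i) h i (Y i w)).
  move=> mh; elim: s => [|i s IHs].
    by under eq_fun do rewrite big_nil; exact: measurable_cst.
  under eq_fun do rewrite big_cons.
  case: (Q i) => //; apply: measurable_funM => //.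
  exact: (measurableT_comp (mh i) (mY i)).
have H'0 w : 0 <= H' w by rewrite mulr_ge0// prodr_ge0.
have mH' : measurable_fun setT H' by apply: measurable_funM => //; exact: mprod.
apply: factor_integral => //; [exact: mY| |exact: mf] => V mV.
pose f' i := if i == k' then \1_V : R -> R else f i.
pose e'' i := if i == k' then fine (nu V) else e' i.
have nuV : (nu V = (fine (nu V))%:E)%E by rewrite fineK// fin_num_measure.
transitivity (\int[P]_w (H w * \prod_i f' i (Y i w))%:E)%E.
  apply: eq_integral => w _; congr EFin; rewrite /H' -mulrA; congr (_ * _).
  rewrite [RHS](bigD1 k')//= /f' eqxx mulrC; congr (_ * _).
  by apply: eq_bigr => i /negbTE ->.
rewrite (IH (ltnW kr) f' e'')//.
- rewrite (bigD1 k')//= /e'' eqxx [_ * \prod_(_ | _) _]mulrC mulrA EFinM -nuV.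
  by congr ((_ * _)%:E * _)%E; apply: eq_bigr => i /negbTE ->.
- by move=> i; rewrite /f'; case: ifP => // _; exact: measurable_indic.
- by move=> i y; rewrite /f'; case: ifP.
- move=> i; rewrite /f' /e''; case: ifP => // _.
  by rewrite integral_indic// setIT.
- move=> i ki; rewrite /f'; case: ifPn => [_|ik]; first by exists V.
  apply: fV; rewrite ltn_neqAle ki andbT; apply: contra ik => /eqP ki'.
  by apply/eqP; apply: val_inj.
Qed.

(** Completing the square: the weight [exp (l y)] shifts the mean of the density
    to [l s^2]. *)
Lemma normal_mgf (R : realType) (s l : R) : 0 < s ->
  (\int[normal_prob 0 s]_y (expR (l * y))%:E = (expR (l ^+ 2 * s ^+ 2 / 2))%:E)%E.
Proof.
move=> s0; have sn0 : s != 0 by rewrite gt_eqF.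
have mexp : measurable_fun setT (fun y : R => expR (l * y)).
  by apply: measurableT_comp => //; exact: measurable_funM.
have := @factor_integral _ _ _ _ R (@lebesgue_measure R) (normal_prob 0 s)
  (normal_pdf 0 s) id 1 (measurable_normal_pdf 0 s) (normal_pdf_ge0 0 s)
  (@measurable_id _ _ _) _ _ mexp (fun=> expR_ge0 _).
rewrite mul1e => <-; last first.
  move=> V mV; rewrite mul1e /normal_prob [RHS]integral_mkcond; apply: eq_integral => y _.
  by rewrite patchE indicE; case: ifP => /= _; rewrite ?mulr1 ?mulr0.
transitivity (\int[lebesgue_measure]_y
    ((expR (l ^+ 2 * s ^+ 2 / 2))%:E * (normal_pdf (l * s ^+ 2) s y)%:E))%E.
  apply: eq_integral => y _; rewrite -EFinM; congr EFin.
  rewrite !normal_pdfE// /normal_fun -[LHS]mulrA [RHS]mulrCA -!expRD.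
  by congr (_ * expR _); rewrite -!(mulr_natr (s ^+ 2) 2); field.
rewrite ge0_integralZl//; first by rewrite integral_normal_pdf mule1.
- by apply/measurable_EFinP; exact: measurable_normal_pdf.
- by move=> y _; rewrite lee_fin normal_pdf_ge0.
Qed.

Section past.
Context {R : realType} {disp : measure_display} {Omega : measurableType disp}.
Variables (P : probability Omega R) (F : R -> set (set Omega)).
Hypothesis F_filtration : filtration F.
Implicit Types f g : Omega -> R.

Definition known (s : R) f : Prop :=
  measurable_fun setT (f : g_sigma_algebraType (F s) -> R).

Lemma past_measurableE s (U : set Omega) : 0 <= s ->
  measurable (U : set (g_sigma_algebraType (F s))) = F s U.
Proof.
move=> s0; have [/(_ _ s0)[sF _] _] := F_filtration.
by rewrite measurable_g_measurableTypeE.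
Qed.

Lemma past_measurable s U : 0 <= s -> F s U -> measurable U.
Proof. by move=> s0; have [/(_ _ s0)[_ sF] _] := F_filtration; exact: sF. Qed.

Lemma knownP s f : 0 <= s ->
  known s f <-> (forall V : set R, measurable V -> F s (f @^-1` V)).
Proof.
move=> s0; split=> h.
  by move=> V mV; rewrite -past_measurableE// -[_ @^-1` _]setTI; exact: h.
by move=> _ V mV; rewrite setTI past_measurableE//; exact: h.
Qed.

Lemma known_measurable s f : 0 <= s -> known s f -> measurable_fun setT f.
Proof.
move=> s0 /(knownP _ s0) h _ V mV; rewrite setTI.
by apply: past_measurable (h _ mV).
Qed.

Lemma known_le s t f : 0 <= s -> s <= t -> known s f -> known t f.
Proof.
move=> s0 st; have t0 := le_trans s0 st; move=> /(knownP _ s0) h.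
apply/(knownP _ t0) => V mV; have [_ /(_ s t s0 st)] := F_filtration; apply.
exact: h.
Qed.

Lemma known_indic s (U : set Omega) : 0 <= s -> F s U -> known s (\1_U).
Proof. by move=> s0 FU; apply: measurable_indic; rewrite past_measurableE. Qed.

Lemma known_cst s (c : R) : known s (fun=> c).
Proof. exact: measurable_cst. Qed.

Lemma known_mul s f g : known s f -> known s g -> known s (fun w => f w * g w).
Proof. exact: measurable_funM. Qed.

Lemma known_add s f g : known s f -> known s g -> known s (fun w => f w + g w).
Proof. exact: measurable_funD. Qed.

Lemma known_sub s f g : known s f -> known s g -> known s (fun w => f w - g w).
Proof. exact: measurable_funB. Qed.

Lemma known_sum s (I : Type) (r : seq I) (f : I -> Omega -> R) :
  (forall i, known s (f i)) -> known s (fun w => \sum_(i <- r) f i w).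
Proof. by move=> h; exact: measurable_sum. Qed.

Lemma known_comp s (h : R -> R) f : measurable_fun setT h -> known s f ->
  known s (fun w => h (f w)).
Proof. exact: measurableT_comp. Qed.

Lemma known_ge s f (c : R) : 0 <= s -> known s f -> F s [set w | c <= f w].
Proof.
move=> s0 /(knownP _ s0)/(_ `[c, +oo[%classic) h.
have <- : f @^-1` `[c, +oo[ = [set w | c <= f w]; last exact: h.
by apply/seteqP; split=> w /=; rewrite in_itv/= andbT.
Qed.

Variables (r : nat) (B : R -> Omega -> 'cV[R]_r).
Hypothesis B_brownian : brownian_motion P F B.

Lemma brownian_known s i : 0 <= s -> known s (fun w => B s w i 0).
Proof.
by move=> s0; have [adB _ _ _ _] := B_brownian; apply/(knownP _ s0) => V; exact: adB.
Qed.

Lemma brownian_increment_known s t i : 0 <= s -> s <= t ->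
  known t (fun w => (B t w - B s w) i 0).
Proof.
move=> s0 st; have -> : (fun w => (B t w - B s w) i 0) = (fun w => B t w i 0 - B s w i 0).
  by apply/funext => w; rewrite !mxE.
by apply: known_sub; [|apply: (known_le s0 st)]; apply: brownian_known => //;
  exact: le_trans st.
Qed.

Lemma past_increment_integral s t U (l : 'I_r -> R) : 0 <= s -> s < t -> F s U ->
  (\int[P]_w (\1_U w * \prod_i expR (l i * (B t w - B s w) i 0))%:E =
   (fine (P U) * \prod_i expR ((l i) ^+ 2 * (t - s) / 2))%:E)%E.
Proof.
move=> s0 st FU; have mU := past_measurable s0 FU.
have ts : 0 < Num.sqrt (t - s) by rewrite sqrtr_gt0 subr_gt0.
apply: (@product_integral _ _ _ _ (normal_prob 0 (Num.sqrt (t - s))) _ _ _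
   (fun i w => (B t w - B s w) i 0) (fun i y => expR (l i * y))) => //.
- move=> i; apply: (@known_measurable t); first exact: ltW (le_lt_trans s0 st).
  by apply: brownian_increment_known => //; exact: ltW.
- move=> V mV; have [_ _ _ hN hI] := B_brownian.
  rewrite fineK ?fin_num_measure// -(hN s t s0 st V mV) -(hI s t s0 st V mV U FU).
  transitivity (\int[P]_w (\1_(U `&` increment_in B s t V) w)%:E)%E.
    apply: eq_integral => w _; rewrite indicI /=; congr (_ * _)%:E.
    rewrite indicE /increment_in; have [h|h] := pselect (forall i, V i ((B t w - B s w) i 0)).
      by rewrite mem_set// big1// => i _; rewrite indicE mem_set.
    rewrite memNset//; move/existsNP : h => [i Vi].
    by rewrite (bigD1 i)//= indicE memNset// mul0r.
  rewrite integral_indic ?setIT//.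
  apply: measurableI => //; rewrite /increment_in.
  have -> : [set w | forall i, V i ((B t w - B s w) i 0)] =
     \bigcap_(i in [set: 'I_r]) ((fun w => (B t w - B s w) i 0) @^-1` V i).
    by apply/seteqP; split=> [w h i _|w h i]; [exact: h|exact: h].
  apply: fin_bigcap_measurable => // i _; rewrite -[_ @^-1` _]setTI.
  apply: (@known_measurable t) => //; first exact: ltW (le_lt_trans s0 st).
  by apply: brownian_increment_known => //; exact: ltW.
- by move=> i; apply: measurableT_comp => //; exact: measurable_funM.
- by move=> i; rewrite normal_mgf// sqr_sqrtr// subr_ge0 ltW.
Qed.

(** Given the past, the coordinates of the increment are independent centred normal
    variables, and a product of moment generating functions is left. *)
Lemma past_exp_increment s t f (l : 'I_r -> R) : 0 <= s -> s < t ->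
  known s f -> (forall w, 0 <= f w) ->
  (\int[P]_w (f w * expR (\sum_i l i * (B t w - B s w) i 0))%:E =
   (\int[P]_w (f w)%:E) * (expR ((t - s) / 2 * \sum_i (l i) ^+ 2))%:E)%E.
Proof.
move=> s0 st kf f0.
pose Y := (fun w => w) : Omega -> g_sigma_algebraType (F s).
have mY : measurable_fun setT Y.
  by move=> _ V; rewrite setTI past_measurableE//; exact: past_measurable.
pose H w := expR (\sum_i l i * (B t w - B s w) i 0).
have mH : measurable_fun setT H.
  apply: measurableT_comp => //; apply: measurable_sum => i.
  apply: measurable_funM => //; apply: (@known_measurable t).
    exact: ltW (le_lt_trans s0 st).
  by apply: brownian_increment_known => //; exact: ltW.
pose c := expR ((t - s) / 2 * \sum_i (l i) ^+ 2).
have HY V : measurable V -> (\int[P]_w (H w * \1_V (Y w))%:E = c%:E * pushforward P Y V)%E.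
  move=> mV; have FV : F s V by rewrite -past_measurableE.
  transitivity (\int[P]_w (\1_V w * \prod_i expR (l i * (B t w - B s w) i 0))%:E)%E.
    by apply: eq_integral => w _; rewrite /H expR_sum mulrC.
  rewrite past_increment_integral// EFinM fineK ?fin_num_measure//; last first.
    exact: past_measurable FV.
  rewrite muleC /pushforward; congr (_%:E * _)%E.
  rewrite /c mulr_sumr expR_sum; apply: eq_bigr => i _.
  by congr (expR _); rewrite -mulrA [LHS]mulrC.
have H0 w : 0 <= H w by exact: expR_ge0.
have := factor_integral mH H0 mY HY kf f0.
move=> /(_ mY); rewrite ge0_integral_pushforward//=.
- by rewrite muleC => <-; apply: eq_integral => w _; rewrite mulrC.
- exact/measurable_EFinP.
- by move=> w _; rewrite lee_fin.
Qed.

End past.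

(** * Tail bounds for sums of weighted Brownian increments *)

Section weighted_increments.
Context {R : realType} {disp : measure_display} {Omega : measurableType disp}.
Variables (P : probability Omega R) (F : R -> set (set Omega)).
Hypothesis F_filtration : filtration F.
Variables (r : nat) (B : R -> Omega -> 'cV[R]_r).
Hypothesis B_brownian : brownian_motion P F B.
Variables (delta : R) (a : nat -> 'I_r -> R).
Hypothesis delta_gt0 : 0 < delta.

Local Notation tau l := (l%:R * delta).

Definition weighted_increment (l : nat) (w : Omega) : R :=
  \sum_i a l i * (B (tau l.+1) w - B (tau l) w) i 0.

Definition weighted_var (l : nat) : R := delta * \sum_i (a l i) ^+ 2.

Definition weighted_sum (p L : nat) (w : Omega) : R :=
  \sum_(l < L) weighted_increment (p + l) w.

Definition weighted_sum_var (p L : nat) : R := \sum_(l < L) weighted_var (p + l).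

Let tau_ge0 l : 0 <= tau l. Proof. by rewrite mulr_ge0// ltW. Qed.

Let tau_lt l : tau l < tau l.+1. Proof. by rewrite ltr_pM2r// ltr_nat. Qed.

Let tau_le l k : (l <= k)%N -> tau l <= tau k.
Proof. by move=> lk; rewrite ler_pM2r// ler_nat. Qed.

Lemma weighted_var_ge0 l : 0 <= weighted_var l.
Proof. by rewrite mulr_ge0 ?(ltW delta_gt0)// sumr_ge0// => i _; exact: sqr_ge0. Qed.

Lemma weighted_increment_known l : known F (tau l.+1) (weighted_increment l).
Proof.
apply: known_sum => i; apply: known_mul; first exact: known_cst.
exact: (brownian_increment_known F_filtration B_brownian i (tau_ge0 _) (ltW (tau_lt _))).
Qed.

Lemma weighted_sum_known p l L : (l <= L)%N -> known F (tau (p + L)) (weighted_sum p l).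
Proof.
move=> lL; apply: known_sum => k; apply: (known_le F_filtration (tau_ge0 _));
  last exact: weighted_increment_known.
by apply: tau_le; rewrite ltn_add2l (leq_trans (ltn_ord k)).
Qed.

Lemma exp_weighted_increment l (f : Omega -> R) (c : R) : known F (tau l) f ->
  (forall w, 0 <= f w) ->
  (\int[P]_w (f w * expR (c * weighted_increment l w))%:E =
   (\int[P]_w (f w)%:E) * (expR (c ^+ 2 / 2 * weighted_var l))%:E)%E.
Proof.
move=> kf f0.
have := past_exp_increment F_filtration B_brownian (fun i => c * a l i)
  (tau_ge0 l) (tau_lt l) kf f0.
rewrite -mulrBl -natrB// subSn// subnn mul1r => e.
transitivity (\int[P]_w (f w * expR (\sum_i c * a l i * (B (tau l.+1) w - B (tau l) w) i 0))%:E)%E.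
  apply: eq_integral => w _; rewrite /weighted_increment mulr_sumr.
  by congr (_ * expR _)%:E; apply: eq_bigr => i _; rewrite mulrA.
rewrite e; congr (_ * (expR _)%:E)%E; rewrite /weighted_var.
under eq_bigr do rewrite exprMn.
by rewrite -mulr_sumr; ring.
Qed.

Lemma exp_weighted_sum p L (f : Omega -> R) (c : R) : known F (tau p) f ->
  (forall w, 0 <= f w) ->
  (\int[P]_w (f w * expR (c * weighted_sum p L w))%:E =
   (\int[P]_w (f w)%:E) * (expR (c ^+ 2 / 2 * weighted_sum_var p L))%:E)%E.
Proof.
move=> kf f0; elim: L => [|L IH].
  rewrite /weighted_sum_var big_ord0 mulr0 expR0 mule1; apply: eq_integral => w _.
  by rewrite /weighted_sum big_ord0 mulr0 expR0 mulr1.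
have tp : tau p <= tau (p + L) by apply: tau_le; rewrite leq_addr.
transitivity (\int[P]_w ((f w * expR (c * weighted_sum p L w)) *
    expR (c * weighted_increment (p + L) w))%:E)%E.
  apply: eq_integral => w _; rewrite /weighted_sum big_ord_recr/= mulrDr expRD.
  by rewrite mulrA.
rewrite exp_weighted_increment; last by move=> w; rewrite mulr_ge0// expR_ge0.
  rewrite IH -muleA -EFinM -expRD -mulrDr; congr (_ * (expR (_ * _))%:E)%E.
  by rewrite [RHS]big_ord_recr.
apply: known_mul; first exact: known_le kf.
apply: (@known_comp _ _ _ _ _ (fun y => expR (c * y))).
  by apply: measurableT_comp => //; exact: measurable_funM.
exact: weighted_sum_known.
Qed.

Definition reaches (p L : nat) (x : R) : set Omega :=
  [set w | exists2 l, (l <= L)%N & x <= weighted_sum p l w].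

Lemma reaches_past p L x : F (tau (p + L)) (reaches p L x).
Proof.
have -> : reaches p L x = \bigcup_(l in [set l | (l <= L)%N]) [set w | x <= weighted_sum p l w].
  by apply/seteqP; split=> w [l lL xl]; exists l.
rewrite -(past_measurableE F_filtration)//; apply: bigcup_measurable => l lL.
by rewrite past_measurableE//; apply: known_ge => //; exact: weighted_sum_known.
Qed.

Lemma reaches_measurable p L x : measurable (reaches p L x).
Proof. exact: past_measurable (reaches_past p L x). Qed.

(** The exponential martingale of the partial sums, stopped when [x] is reached. *)
Fixpoint stopped_exp (p : nat) (x c : R) (L : nat) (w : Omega) : R :=
  if L is L'.+1 then
    stopped_exp p x c L' w * \1_(reaches p L' x) w +
    stopped_exp p x c L' w * \1_(~` reaches p L' x) w *
      expR (c * weighted_increment (p + L') w) * expR (- (c ^+ 2 / 2 * weighted_var (p + L')))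
  else 1.

Lemma stopped_exp_ge0 p x c L w : 0 <= stopped_exp p x c L w.
Proof.
by elim: L => [|L IH] //=; rewrite addr_ge0 ?mulr_ge0 ?expR_ge0.
Qed.

Lemma stopped_exp_known p x c L : known F (tau (p + L)) (stopped_exp p x c L).
Proof.
elim: L => [|L IH]; first exact: known_cst.
have le1 : tau (p + L) <= tau (p + L.+1) by apply: tau_le; rewrite addnS.
have k1 : known F (tau (p + L.+1)) (\1_(reaches p L x)).
  apply: (known_le F_filtration (tau_ge0 _) le1).
  by apply: known_indic => //; exact: reaches_past.
have k2 : known F (tau (p + L.+1)) (\1_(~` reaches p L x)).
  apply: (known_le F_filtration (tau_ge0 _) le1); apply: known_indic => //.
  rewrite -(past_measurableE F_filtration)//; apply: measurableC.
  by rewrite past_measurableE//; exact: reaches_past.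
have k3 : known F (tau (p + L.+1)) (stopped_exp p x c L) by exact: known_le IH.
apply: known_add; first exact: known_mul.
apply: known_mul; last exact: known_cst.
apply: known_mul; first exact: known_mul.
apply: (@known_comp _ _ _ _ _ (fun y => expR (c * y))).
  by apply: measurableT_comp => //; exact: measurable_funM.
by rewrite addnS; exact: weighted_increment_known.
Qed.

(** Each further factor has conditional mean one, and freezing the process once
    [x] has been reached does not change its integral. *)
Lemma stopped_exp_integral p x c L : (\int[P]_w (stopped_exp p x c L w)%:E = 1)%E.
Proof.
elim: L => [|L IH].
  transitivity (\int[P]_w cst 1%E w)%E; first by [].
  by rewrite integral_cst // mul1e; exact: probability_setT.
have mD : measurable_fun setT (stopped_exp p x c L).
  exact: (known_measurable F_filtration (tau_ge0 _) (@stopped_exp_known p x c L)).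
have m1 U : measurable U -> measurable_fun setT (fun w => stopped_exp p x c L w * \1_U w).
  by move=> mU; apply: measurable_funM => //; exact: measurable_indic.
have mr := reaches_measurable p L x.
have kf : known F (tau (p + L)) (fun w => stopped_exp p x c L w * \1_(~` reaches p L x) w).
  apply: known_mul; first exact: stopped_exp_known.
  apply: known_indic => //; rewrite -(past_measurableE F_filtration)//; apply: measurableC.
  by rewrite past_measurableE//; exact: reaches_past.
have f0 U w : 0 <= stopped_exp p x c L w * \1_U w by rewrite mulr_ge0// stopped_exp_ge0.
rewrite /= ; under eq_integral do rewrite EFinD.
rewrite ge0_integralD//=; first last.
- apply/measurable_EFinP; apply: measurable_funM => //; apply: measurable_funM.
    by apply: m1; exact: measurableC.
  apply: measurableT_comp => //; apply: measurable_funM => //.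
  exact: (known_measurable F_filtration (tau_ge0 _) (@weighted_increment_known _)).
- by move=> w _; rewrite lee_fin !mulr_ge0 ?expR_ge0// stopped_exp_ge0.
- by apply/measurable_EFinP; exact: m1.
- by move=> w _; rewrite lee_fin.
rewrite [X in (_ + X)%E](_ : _ = \int[P]_w (stopped_exp p x c L w * \1_(~` reaches p L x) w)%:E)%E.
  rewrite -ge0_integralD//=.
  - rewrite -[RHS]IH; apply: eq_integral => w _; rewrite -EFinD -mulrDr; congr EFin.
    rewrite !indicE in_setC; by case: (w \in _); rewrite ?addr0 ?add0r mulr1.
  - by move=> w _; rewrite lee_fin.
  - by apply/measurable_EFinP; exact: m1.
  - by move=> w _; rewrite lee_fin.
  - by apply/measurable_EFinP; apply: m1; exact: measurableC.
under eq_integral do rewrite mulrC EFinM.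
rewrite ge0_integralZl//=; first last.
- by move=> w _; rewrite lee_fin mulr_ge0// expR_ge0.
- apply/measurable_EFinP; apply: measurable_funM; first by apply: m1; exact: measurableC.
  apply: measurableT_comp => //; apply: measurable_funM => //.
  exact: (known_measurable F_filtration (tau_ge0 _) (@weighted_increment_known _)).
rewrite exp_weighted_increment// muleCA -EFinM -expRD addNr expR0 mule1//.
Qed.

Lemma stopped_exp_unreached p x c L w : (forall l, (l < L)%N -> weighted_sum p l w < x) ->
  stopped_exp p x c L w = expR (c * weighted_sum p L w - c ^+ 2 / 2 * weighted_sum_var p L).
Proof.
elim: L => [|L IH] h.
  by rewrite /weighted_sum /weighted_sum_var !big_ord0 !mulr0 subr0 expR0.
have nr : ~ reaches p L x w.
  by move=> [l lL]; rewrite leNgt h// ltnS.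
rewrite /= !indicE in_setC memNset//= mulr0 add0r mulr1 IH; last first.
  by move=> l lL; apply: h; rewrite ltnW// ltnS.
rewrite -!expRD /weighted_sum /weighted_sum_var !big_ord_recr/=; congr expR; ring.
Qed.

Lemma stopped_exp_reached p x c L w : 0 <= c -> reaches p L x w ->
  expR (c * x - c ^+ 2 / 2 * weighted_sum_var p L) <= stopped_exp p x c L w.
Proof.
move=> c0; elim: L => [|L IH] rw.
  case: rw => l; rewrite leqn0 => /eqP -> xl.
  rewrite (@stopped_exp_unreached _ _ _ 0)// ler_expR lerD2r ler_wpM2l//.
have [rL|nL] := pselect (reaches p L x w).
  rewrite /= !indicE in_setC mem_set//= mulr1 mulr0 !mul0r addr0.
  apply: le_trans (IH rL); rewrite ler_expR lerD2l lerN2 ler_wpM2l//.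
    by rewrite mulr_ge0 ?sqr_ge0.
  by rewrite /weighted_sum_var big_ord_recr/= lerDl weighted_var_ge0.
have nl l : (l < L.+1)%N -> weighted_sum p l w < x.
  by rewrite ltnS => lL; rewrite ltNge; apply/negP => xl; apply: nL; exists l.
rewrite stopped_exp_unreached// ler_expR lerD2r ler_wpM2l//.
case: rw => l; rewrite leq_eqVlt => /orP[/eqP ->//|/nl]; by rewrite ltNge => /negP.
Qed.

(** Doob's maximal inequality for the exponential martingale. *)
Lemma reaches_prob_le_exp p L (x c : R) : 0 <= c ->
  (P (reaches p L x) <= (expR (- (c * x) + c ^+ 2 / 2 * weighted_sum_var p L))%:E)%E.
Proof.
move=> c0; set E := expR (c * x - c ^+ 2 / 2 * weighted_sum_var p L).
have E0 : 0 < E by exact: expR_gt0.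
have mr := reaches_measurable p L x.
have PE : P (reaches p L x) = (\int[P]_w (\1_(reaches p L x) w)%:E)%E.
  by rewrite integral_indic// setIT.
have h : (E%:E * P (reaches p L x) <= 1)%E.
  rewrite -(stopped_exp_integral p x c L) PE -ge0_integralZl//=.
  - apply: ge0_le_integral => //=.
    + by move=> w _; rewrite lee_fin mulr_ge0// ltW.
    + apply: measurable_funeM; apply/measurable_EFinP; exact: measurable_indic.
    + apply/measurable_EFinP; exact: (known_measurable F_filtration (tau_ge0 _) (@stopped_exp_known p x c L)).
    + move=> w _; rewrite -EFinM lee_fin indicE.
      have [rw|rw] := pselect (reaches p L x w).
        by rewrite mem_set// mulr1; exact: stopped_exp_reached.
      by rewrite memNset// mulr0 stopped_exp_ge0.
  - by apply/measurable_EFinP; exact: measurable_indic.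
  - by rewrite lee_fin ltW.
rewrite -lee_pdivlMl// in h.
by rewrite (le_trans h)// mule1 lee_fin /E -expRN opprB addrC.
Qed.

Lemma reaches_prob_le p L (x v : R) : 0 <= x -> 0 < v -> weighted_sum_var p L <= v ->
  (P (reaches p L x) <= (expR (- (x ^+ 2 / (2 * v))))%:E)%E.
Proof.
move=> x0 v0 Vv; apply: (le_trans (reaches_prob_le_exp p L x (divr_ge0 x0 (ltW v0)))).
rewrite lee_fin ler_expR.
apply: (@le_trans _ _ (- (x / v * x) + (x / v) ^+ 2 / 2 * v)).
  by rewrite lerD2l ler_wpM2l// mulr_ge0// sqr_ge0.
by rewrite le_eqVlt; apply/orP; left; apply/eqP; field; rewrite gt_eqF.
Qed.

(** Paley-Zygmund for the exponential of the sum: if [Z] has conditional moments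
    [m1] and [m2], then 1_(Z >= m1/2) >= 2 k (Z - m1/2) - k^2 Z^2 for every [k];
    [k = m1 / (2 m2)] is the best choice. *)
Lemma weighted_sum_tail_ge p L (x : R) U : 0 < x -> F (tau p) U ->
  0 < weighted_sum_var p L ->
  ((4^-1 * expR (- (8 + 8 * x ^+ 2 / weighted_sum_var p L)))%:E * P U <=
   P (U `&` [set w | (x <= weighted_sum p L w)%R]))%E.
Proof.
move=> x0 FU V0; set V := weighted_sum_var p L in V0 *.
have mU : measurable U by exact: past_measurable FU.
set s := Num.sqrt V; have s0 : 0 < s by rewrite sqrtr_gt0.
have Vs : V = s ^+ 2 by rewrite sqr_sqrtr// ltW.
pose c := 2 * x / V + 2 / s.
have c0 : 0 < c by rewrite addr_gt0// divr_gt0// mulr_gt0.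
pose Z w := expR (c * weighted_sum p L w).
pose m1 := expR (c ^+ 2 / 2 * V); pose m2 := expR ((2 * c) ^+ 2 / 2 * V).
have m10 : 0 < m1 by exact: expR_gt0.
have m20 : 0 < m2 by exact: expR_gt0.
pose k := m1 / (2 * m2); have k0 : 0 < k by rewrite divr_gt0// mulr_gt0.
have kU : known F (tau p) (\1_U) by exact: known_indic.
have kS : measurable_fun setT (weighted_sum p L).
  by apply: (known_measurable F_filtration (tau_ge0 (p + L))); exact: weighted_sum_known.
have mZ : measurable_fun setT Z.
  by apply: measurableT_comp => //; exact: measurable_funM.
have PI U' : measurable U' -> P U' = (\int[P]_w (\1_U' w)%:E)%E.
  by move=> ?; rewrite integral_indic// setIT.
have EZ : (\int[P]_w (\1_U w * Z w)%:E = P U * m1%:E)%E.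
  by rewrite exp_weighted_sum// -PI.
have EZ2 : (\int[P]_w (\1_U w * Z w ^+ 2)%:E = P U * m2%:E)%E.
  rewrite (PI _ mU) -exp_weighted_sum//.
  apply: eq_integral => w _; rewrite /Z -expRM_natl; congr (_ * expR _)%:E; ring.
set E := [set w | x <= weighted_sum p L w].
have mE : measurable E.
  have -> : E = weighted_sum p L @^-1` `[x, +oo[.
    by apply/seteqP; split=> w /=; rewrite in_itv/= andbT.
  by rewrite -[_ @^-1` _]setTI; exact: kS.
have ZE w : ~ E w -> Z w <= m1 / 2.
  move=> /negP; rewrite -ltNge => wx.
  have : expR (c * x) <= m1 / 2.
    have h : c * x + 1 <= c ^+ 2 / 2 * V.
      have -> : c ^+ 2 / 2 * V = c * x + (2 + 2 * x / s).
        by rewrite /c Vs; field; rewrite gt_eqF.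
      rewrite lerD2l; have : 0 <= 2 * x / s by rewrite divr_ge0 ?mulr_ge0 ?ltW.
      by move=> ?; lra.
    rewrite ler_pdivlMr// /m1 (le_trans _ (_ : expR (c * x + 1) <= _)) ?ler_expR//.
    by rewrite expRD ler_pM2l ?expR_gt0// (le_trans _ (expR_ge1Dx _)).
  by apply: le_trans; rewrite ler_expR ler_pM2l// ltW.
have pt w : (2 * k) * (\1_U w * Z w) <=
    \1_(U `&` E) w + (k ^+ 2 * (\1_U w * Z w ^+ 2) + k * m1 * \1_U w).
  rewrite !indicE in_setI.
  have [Uw|Uw] := boolP (w \in U); rewrite /= ?mul0r ?mulr0 ?addr0// !mul1r mulr1.
  have Z0 : 0 <= Z w by exact: expR_ge0.
  have [Ew|Ew] := pselect (E w).
    rewrite mem_set//=; have : 0 <= (1 - k * Z w) ^+ 2 by exact: sqr_ge0.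
    have : 0 <= k * m1 by rewrite mulr_ge0// ltW.
    by rewrite sqrrB expr1n !mul1r exprMn -mulrA; nra.
  rewrite memNset//= add0r.
  have := ZE _ Ew => h.
  have : k * (2 * Z w) <= k * m1 by rewrite ler_pM2l//; lra.
  have : 0 <= k ^+ 2 * Z w ^+ 2 by rewrite mulr_ge0// sqr_ge0.
  by rewrite mulrA [k * 2]mulrC; lra.
have mI U' : measurable U' -> measurable_fun setT (\1_U' : Omega -> R).
  by move=> ?; exact: measurable_indic.
have nn1 w : 0 <= \1_U w * Z w by rewrite mulr_ge0// expR_ge0.
have nn2 w : 0 <= \1_U w * Z w ^+ 2 by rewrite mulr_ge0// exprn_ge0// expR_ge0.
have mm1 : measurable_fun setT (fun w => \1_U w * Z w).
  by apply: measurable_funM => //; exact: mI.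
have mm2 : measurable_fun setT (fun w => \1_U w * Z w ^+ 2).
  by apply: measurable_funM; [exact: mI|exact: measurable_funX].
have main : ((2 * k)%:E * (P U * m1%:E) <=
   P (U `&` E) + ((k ^+ 2)%:E * (P U * m2%:E) + (k * m1)%:E * P U))%E.
  have ZI (f : Omega -> R) b : measurable_fun setT f -> (forall w, 0 <= f w) -> 0 <= b ->
      (b%:E * \int[P]_w (f w)%:E = \int[P]_w (b * f w)%:E)%E.
    move=> mf f0 b0; rewrite -ge0_integralZl//; first exact/measurable_EFinP.
    by move=> w _; rewrite lee_fin.
  have DI (f g : Omega -> R) : measurable_fun setT f -> (forall w, 0 <= f w) ->
      measurable_fun setT g -> (forall w, 0 <= g w) ->
      (\int[P]_w (f w)%:E + \int[P]_w (g w)%:E = \int[P]_w (f w + g w)%:E)%E.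
    move=> mf f0 mg g0; rewrite -ge0_integralD//; try exact/measurable_EFinP.
      by move=> w _; rewrite lee_fin.
    by move=> w _; rewrite lee_fin.
  have k20 : 0 <= k ^+ 2 by exact: sqr_ge0.
  have km0 : 0 <= k * m1 by rewrite mulr_ge0// ltW.
  have k0' : 0 <= 2 * k by rewrite mulr_ge0// ltW.
  have mIE : measurable_fun setT (\1_(U `&` E) : Omega -> R) by apply: mI; exact: measurableI.
  have mIU : measurable_fun setT (\1_U : Omega -> R) by exact: mI.
  have mf1 : measurable_fun setT (fun w => k ^+ 2 * (\1_U w * Z w ^+ 2)).
    exact: measurable_funM.
  have mf2 : measurable_fun setT (fun w => k * m1 * \1_U w) by exact: measurable_funM.
  have mf3 : measurable_fun setT (fun w => k ^+ 2 * (\1_U w * Z w ^+ 2) + k * m1 * \1_U w).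
    exact: measurable_funD.
  have f10 w : 0 <= k ^+ 2 * (\1_U w * Z w ^+ 2) by rewrite mulr_ge0.
  have f20 w : 0 <= k * m1 * \1_U w by rewrite mulr_ge0.
  rewrite -EZ -EZ2 (PI _ mU) (PI _ (measurableI _ _ mU mE)) !ZI// !DI//; last first.
    by move=> w; rewrite addr_ge0.
  apply: ge0_le_integral => //.
  - by move=> w _; rewrite lee_fin mulr_ge0.
  - by apply/measurable_EFinP; exact: measurable_funM.
  - by apply/measurable_EFinP; exact: measurable_funD.
  - by move=> w _; rewrite lee_fin; exact: pt.
have PU : P U = (fine (P U))%:E by rewrite fineK// fin_num_measure.
have PUE : P (U `&` E) = (fine (P (U `&` E)))%:E.
  by rewrite fineK// fin_num_measure//; exact: measurableI.
move: main; rewrite PU PUE -!EFinM -!EFinD !lee_fin.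
set u := fine (P U); set ue := fine _ => main.
have u0 : 0 <= u by rewrite fine_ge0.
have : m1 ^+ 2 / (4 * m2) * u <= ue.
  move: main; rewrite /k.
  have -> : 2 * (m1 / (2 * m2)) * (u * m1) = 4 * (m1 ^+ 2 / (4 * m2) * u).
    by field; rewrite gt_eqF.
  have -> : (m1 / (2 * m2)) ^+ 2 * (u * m2) = m1 ^+ 2 / (4 * m2) * u.
    by field; rewrite gt_eqF.
  have -> : m1 / (2 * m2) * m1 * u = 2 * (m1 ^+ 2 / (4 * m2) * u).
    by field; rewrite gt_eqF.
  lra.
apply: le_trans; rewrite ler_wpM2r//.
rewrite [X in _ <= X](_ : _ = 4^-1 * (m1 ^+ 2 / m2)); last by rewrite invfM mulrCA.
rewrite ler_pM2l ?invr_gt0//.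
rewrite /m1 /m2 -expRM_natl -expRN -expRD ler_expR.
have -> : 2%:R * (c ^+ 2 / 2 * V) + - ((2 * c) ^+ 2 / 2 * V) = - (2 * x / s + 2) ^+ 2.
  by rewrite /c Vs; field; rewrite gt_eqF.
rewrite lerN2 Vs.
have -> : 8 * x ^+ 2 / s ^+ 2 = 2 * (2 * x / s) ^+ 2 by field; rewrite gt_eqF.
have : 0 <= (2 * x / s - 2) ^+ 2 by exact: sqr_ge0.
rewrite sqrrB sqrrD; lra.
Qed.

End weighted_increments.

(** * Step function approximation of the stochastic integral *)

Section uniform_continuity.
Variable R : realType.
Local Notation mu := (@lebesgue_measure R).

Lemma uniform_continuity_segment (V : normedModType R) (f : R -> V) (a b e : R) :
  continuous f -> 0 < e ->
  exists2 delta, 0 < delta & forall s s', a <= s <= b -> `|s - s'| < delta ->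
    `|f s - f s'| < e.
Proof.
move=> fc e0.
have cK : compact `[a, b] by exact: segment_compact.
have e2 : 0 < e / 2 by rewrite divr_gt0.
pose Q (delta : R) s := forall s', `|s - s'| < delta -> `|f s - f s'| < e.
have /(_ _ (0^'+) Q) := (compact_near_coveringP `[a, b]).1 cK.
have h (x : R) : [set` `[a, b]] x -> \forall x' \near x & delta \near 0^'+, Q delta x'.
  move=> _; have /cvgrPdist_lt /(_ _ e2) [/= eta eta0 he] := fc x.
  have eta2 : 0 < eta / 2 by rewrite divr_gt0.
  exists (ball x (eta / 2), [set delta | 0 < delta < eta / 2]) => /=.
    split; first exact: nbhsx_ballx.
    exists (eta / 2) => //= y; rewrite /= sub0r normrN => y1 y0.
    by rewrite y0 (le_lt_trans (ler_norm y)).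
  move=> [x' delta] /= [xx' /andP[d0 dd]] s' ss'.
  have xx : `|x - x'| < eta / 2 by exact: xx'.
  have h1 : `|f x - f x'| < e / 2.
    by apply: he => /=; rewrite (lt_trans xx)// ltr_pdivrMr// ltr_pMr// ltr1n.
  have h2 : `|f x - f s'| < e / 2.
    apply: he => /=; rewrite -[x - s'](subrKA x') (le_lt_trans (ler_normD _ _))//.
    by rewrite [eta]splitr ltrD// (lt_trans ss').
  rewrite -[f x' - _](subrKA (f x)) (le_lt_trans (ler_normD _ _))//.
  by rewrite [e]splitr ltrD// distrC.
move=> /(_ _ h) [delta0 /= d0 hd].
exists (delta0 / 2); first by rewrite divr_gt0.
move=> s s' sab; apply: (hd (delta0 / 2)) => //=.
- by rewrite sub0r normrN gtr0_norm ?divr_gt0// ltr_pdivrMr// ltr_pMr// ltr1n.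
- by rewrite divr_gt0.
Qed.

Lemma continuous_nonneg_uniform (m n : nat) (f : R -> 'M[R]_(m, n)) (t e : R) :
  continuous_nonneg f -> 0 < e ->
  exists2 delta, 0 < delta & forall s s', 0 <= s <= t -> 0 <= s' -> `|s - s'| < delta ->
    `|f s - f s'| < e.
Proof.
move=> /continuous_nonneg_ext fc e0.
have [delta d0 hd] := @uniform_continuity_segment _ _ 0 t e fc e0.
exists delta => // s s' /andP[s0 st] s'0 ss'; have := hd s s'.
by rewrite s0 st (max_r s0) (max_r s'0); apply.
Qed.

Lemma riemann_sum_le (f : R -> R) (delta e : R) (p L : nat) : 0 < delta -> 0 <= e ->
  (forall t, {within `[0, t], continuous f}) ->
  (forall l s, (l < L)%N -> (p + l)%:R * delta <= s <= (p + l).+1%:R * delta ->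
     `|f s - f ((p + l)%:R * delta)| <= e) ->
  `|\int[mu]_(s in `[(p%:R * delta), ((p + L)%:R * delta)]) f s -
    \sum_(l < L) delta * f ((p + l)%:R * delta)| <= e * (L%:R * delta).
Proof.
move=> d0 e0 fc; elim: L => [|L IH] he.
  by rewrite addn0 set_itv1 Rintegral_set1 big_ord0 subrr normr0 mul0r mulr0.
have {}IH := IH (fun l s lL => he l s (leqW lL)).
have tau0 l : 0 <= l%:R * delta by rewrite mulr_ge0// ltW.
have taule l k : (l <= k)%N -> l%:R * delta <= k%:R * delta.
  by move=> lk; rewrite ler_pM2r// ler_nat.
have fci s t : 0 <= s -> mu.-integrable `[s, t] (EFin \o f).
  move=> s0; apply: within_integrable; apply: continuous_subspaceW (fc t) => x /=.
  by rewrite !in_itv/= => /andP[sx ->]; rewrite (le_trans s0).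
have := Rintegral_itvB (fci (p%:R * delta) ((p + L.+1)%:R * delta) (tau0 _))
  (x := (p + L)%:R * delta).
rewrite !bnd_simp => /(_ (taule _ _ (leq_addr _ _))).
rewrite taule ?addnS// => /(_ isT) /eqP; rewrite subr_eq => /eqP ->.
rewrite Rintegral_itv_obnd_cbnd; last first.
  apply: integrableS (fci ((p + L)%:R * delta) ((p + L).+1%:R * delta) (tau0 _)) => // u /=.
  by rewrite !in_itv/= => /andP[su ->]; rewrite ltW.
rewrite big_ord_recr/=.
set I1 := \int[mu]_(s in _) _ s; set I2 := \int[mu]_(s in _) _ s; set S := \sum_(_ < _) _.
have -> : I1 + I2 - (S + delta * f ((p + L)%:R * delta)) =
    (I2 - S) + (I1 - delta * f ((p + L)%:R * delta)) by ring.
rewrite (le_trans (ler_normD _ _))// -natr1 mulrDl mulrDr lerD// mul1r.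
have cE : \int[mu]_(s in `[((p + L)%:R * delta), ((p + L).+1%:R * delta)])
    f ((p + L)%:R * delta) = delta * f ((p + L)%:R * delta).
  rewrite Rintegral_cst//= lebesgue_measure_itv/= lte_fin ltr_pM2r// ltr_nat ltnSn/=.
  by rewrite -mulrBl -natrB// subSn// subnn mul1r mulrC.
have ci (c : R) : mu.-integrable `[((p + L)%:R * delta), ((p + L).+1%:R * delta)] (EFin \o (fun=> c)).
  by apply: within_integrable; exact: within_cst.
rewrite -cE -RintegralB//; last exact: fci.
have hI := @le_normr_Rintegral _ _ _ mu `[((p + L)%:R * delta), ((p + L).+1%:R * delta)]
  (fun s => f s - f ((p + L)%:R * delta)).
have fdi : mu.-integrable `[((p + L)%:R * delta), ((p + L).+1%:R * delta)]
    (EFin \o (fun s => f s - f ((p + L)%:R * delta))).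
  apply: within_integrable; apply: within_sub; last exact: within_cst.
  apply: continuous_subspaceW (fc ((p + L).+1%:R * delta)) => x /=.
  by rewrite !in_itv/= => /andP[sx ->]; rewrite (le_trans (tau0 _) sx).
apply: (le_trans (hI _ fdi)) => //.
apply: (@le_trans _ _ (\int[mu]_(s in `[((p + L)%:R * delta), ((p + L).+1%:R * delta)]) e)).
  apply: le_Rintegral => //; first exact: integrable_norm.
  by move=> s; rewrite /= in_itv/= => hs; exact: he.
rewrite Rintegral_cst//= lebesgue_measure_itv/= lte_fin ltr_pM2r// ltr_nat ltnSn/=.
by rewrite -mulrBl -natrB// subSn// subnn mul1r.
Qed.

End uniform_continuity.

Section ereal_null_sequence.
Variable R : realType.

Lemma ereal_cvg0P (u : nat -> \bar R) : (forall n, (0 <= u n)%E) ->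
  u @ \oo --> 0%E <-> (forall e : R, 0 < e -> \forall n \near \oo, (u n <= e%:E)%E).
Proof.
move=> u0; split.
  move=> /fine_cvgP[fu ucvg] e e0.
  have uc := (cvgrPdist_le _ _).1 ucvg _ e0; near=> n.
  have fn : u n \is a fin_num by near: n; exact: fu.
  have : `|0 - (fine \o u) n| <= e by near: n; exact: uc.
  by rewrite sub0r normrN => h; rewrite -(fineK fn) lee_fin (le_trans (ler_norm _)).
move=> h; apply/fine_cvgP.
have fu : \forall n \near \oo, u n \is a fin_num.
  by apply: filterS (h 1 ltr01) => n un; rewrite ge0_fin_numE// (le_lt_trans un)// ltry.
split => //; apply/cvgrPdist_le => e e0.
near=> n.
have fn : u n \is a fin_num by near: n; exact: fu.
by rewrite sub0r normrN /= ger0_norm ?fine_ge0// -lee_fin fineK//; near: n; exact: h.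
Unshelve. all: by end_near. Qed.

End ereal_null_sequence.

Section step_approximation.
Context {R : realType} {disp : measure_display} {Omega : measurableType disp}.
Variables (P : probability Omega R) (F : R -> set (set Omega)).
Hypothesis F_filtration : filtration F.
Variables (d r : nat) (B : R -> Omega -> 'cV[R]_r).
Hypothesis B_brownian : brownian_motion P F B.
Variable sigma : R -> 'M[R]_(d, r).
Hypothesis sigma_cont : continuous_nonneg sigma.
Local Notation mu := (@lebesgue_measure R).

Definition left_step (delta : R) (N : nat) : @step R d r :=
  [seq ((l%:R * delta, l.+1%:R * delta), sigma (l%:R * delta)) | l <- iota 0 N].

(** The weights for which the sums of weighted increments are the integrals of
    the left-endpoint step approximations of row [i] of [sigma]. *)
Definition row_weights (delta : R) (i : 'I_d) (l : nat) (j : 'I_r) : R :=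
  sigma (l%:R * delta) i j.

Lemma left_step_on (delta t : R) N : 0 < delta -> N%:R * delta <= t ->
  step_on t (left_step delta N).
Proof.
move=> d0 Nt p /mapP[l]; rewrite mem_iota add0n => /andP[_ lN] ->; split => /=.
- by rewrite mulr_ge0// ltW.
- by rewrite ler_pM2r// ler_nat.
- by rewrite (le_trans _ Nt)// ler_pM2r// ler_nat.
Qed.

Lemma left_step_eval (delta s : R) N l : 0 < delta -> (l < N)%N ->
  l%:R * delta < s <= l.+1%:R * delta ->
  step_eval (left_step delta N) s = sigma (l%:R * delta).
Proof.
move=> d0 lN /andP[ls sl]; rewrite /step_eval big_map -[N in iota 0 N]subn0 -/(index_iota 0 N).
rewrite big_mkord (bigD1 (Ordinal lN))//= [X in _ + X]big1 => [|k kl].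
  by rewrite addr0 indicE mem_set ?scale1r//= in_itv/= ls.
rewrite indicE memNset ?scale0r//= in_itv/= => /andP[ks sk].
move/eqP: kl; apply; apply: val_inj => /=; apply/eqP; rewrite eqn_leq.
have := lt_le_trans ks sl; rewrite ltr_pM2r// ltr_nat ltnS => ->.
by have := lt_le_trans ls sk; rewrite ltr_pM2r// ltr_nat ltnS.
Qed.

Lemma left_step_integral (delta : R) N w i :
  step_integral (left_step delta N) B w i 0 =
  weighted_sum B delta (row_weights delta i) 0 N w.
Proof.
rewrite /step_integral big_map -[N in iota 0 N]subn0 -/(index_iota 0 N) big_mkord summxE.
by apply: eq_bigr => l _; rewrite mxE add0n.
Qed.

Lemma step_eval_entry (phi : @step R d r) s i j :
  step_eval phi s i j = \sum_(p <- phi) \1_`]p.1.1, p.1.2] s * p.2 i j.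
Proof. by rewrite summxE; apply: eq_bigr => p _; rewrite mxE. Qed.

Lemma left_step_L2_le (delta e : R) N : 0 < delta -> 0 <= e ->
  (forall s l, (l < N)%N -> l%:R * delta < s <= l.+1%:R * delta ->
     forall i j, `|sigma s i j - sigma (l%:R * delta) i j| <= e) ->
  (\int[mu]_(s in `[0%R, (N%:R * delta)%R])
     (fnorm (sigma s - step_eval (left_step delta N) s) ^+ 2)%:E <=
   (d%:R * r%:R * e ^+ 2 * (N%:R * delta))%:E)%E.
Proof.
move=> d0 e0 h; have N0 : 0 <= N%:R * delta by rewrite mulr_ge0// ltW.
set phi := left_step delta N; set t := N%:R * delta.
pose f s := fnorm (sigma s - step_eval phi s) ^+ 2.
have mf : measurable_fun `[0%R, t] (EFin \o f).
  have -> : f = (fun s => \sum_i \sum_j (sigma s i j - step_eval phi s i j) ^+ 2).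
    apply/funext => s; rewrite /f fnorm_sqr.
    by apply: eq_bigr => i _; apply: eq_bigr => j _; rewrite !mxE.
  apply/measurable_EFinP; apply: measurable_sum => i; apply: measurable_sum => j.
  apply: (@measurable_funX _ _ _ _ (fun s => sigma s i j - step_eval phi s i j)).
  apply: measurable_funB.
    apply: subspace_continuous_measurable_fun => //.
    by apply: within_coord; exact: continuous_nonneg_within.
  have -> : (fun s => step_eval phi s i j) =
      (fun s => \sum_(p <- phi) \1_`]p.1.1, p.1.2] s * p.2 i j).
    by apply/funext => s; exact: step_eval_entry.
  apply: measurable_sum => p; apply: measurable_funM; last exact: measurable_cst.
  exact: measurable_indic.
have mf' : measurable_fun `]0%R, t] (EFin \o f).
  apply: measurable_funS mf => // u /=; rewrite !in_itv/= => /andP[u0 ->].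
  by rewrite ltW.
rewrite -[X in (X <= _)%E]/(\int[mu]_(s in `[0%R, t]) (EFin \o f) s)%E.
rewrite -integral_itv_obnd_cbnd//.
apply: (@le_trans _ _ (\int[mu]_(s in `]0%R, t]) (d%:R * r%:R * e ^+ 2)%:E)%E).
  apply: ge0_le_integral => //.
  - by move=> s _; rewrite lee_fin sqr_ge0.
  - move=> s; rewrite /= in_itv/= => /andP[s0 st]; rewrite lee_fin.
    apply: fnorm_sqr_le_entries => i j.
    (* the cell of the subdivision that contains s *)
    pose l := (Num.trunc (s / delta)).
    have sd0 : 0 <= s / delta by rewrite divr_ge0// ltW.
    have /andP[l1 l2] := truncn_itv sd0; rewrite -/l in l1 l2.
    rewrite ler_pdivlMr// in l1; rewrite ltr_pdivrMr// in l2.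
    move: l1; rewrite le_eqVlt => /orP[/eqP ls|ls].
      have l0 : (0 < l)%N.
        by rewrite lt0n; apply: contraTneq s0 => l0; rewrite -ls l0 mul0r ltxx.
      have lE : l.-1.+1 = l by rewrite prednK.
      have lN : (l.-1 < N)%N.
        by rewrite lE -(ler_nat R) -(ler_pM2r d0) ls.
      have hs : l.-1%:R * delta < s <= l.-1.+1%:R * delta.
        by rewrite lE ls lexx andbT -ls ltr_pM2r// ltr_nat -[ltnRHS]lE.
      by rewrite (left_step_eval d0 lN hs) !mxE; exact: h.
    have lN : (l < N)%N.
      by rewrite -(ltr_nat R) -(ltr_pM2r d0) (lt_le_trans ls).
    have hs : l%:R * delta < s <= l.+1%:R * delta by rewrite ls ltW.
    by rewrite (left_step_eval d0 lN hs) !mxE; exact: h.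
rewrite integral_cst//= lebesgue_measure_itv/= lte_fin.
case: ltP => [t0|t0]; last first.
  by rewrite mule0 lee_fin; apply: mulr_ge0 => //; apply: mulr_ge0 => //; exact: sqr_ge0.
by rewrite oppr0 adde0 -EFinM lee_fin.
Qed.

Section approximation.
Variable M : R -> Omega -> 'cV[R]_d.
Hypothesis M_integral : forall t, 0 <= t -> is_stochastic_integral P sigma B t (M t).
Variable L : R.
Hypothesis L_gt0 : 0 < L.

(** Dyadic meshes, so that the grid points of one level remain grid points of all
    finer ones. *)
Definition mesh (k : nat) : R := L / 2 ^+ k.

Lemma mesh_gt0 k : 0 < mesh k.
Proof. by rewrite divr_gt0// exprn_gt0. Qed.

Lemma mesh_refine (N m n : nat) : (N * 2 ^ n)%:R * mesh (m + n) = N%:R * mesh m.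
Proof.
have n2 k : (2 : R) ^+ k != 0 by rewrite expf_neq0// pnatr_eq0.
by rewrite /mesh exprD natrM natrX; field; rewrite !n2.
Qed.

Lemma mesh_small (e : R) (m : nat) : 0 < e -> \forall n \near \oo, mesh (m + n) < e.
Proof.
move=> e0; have : L / 2 ^+ m * (2^-1) ^+ n @[n --> \oo] --> L / 2 ^+ m * 0.
  apply: cvgM; first exact: cvg_cst.
  by apply: cvg_expr; rewrite ger0_norm ?invr_ge0// invf_lt1// ltr1n.
rewrite mulr0 => /cvgrPdist_lt /(_ e e0); apply: filterS => n.
rewrite sub0r normrN ger0_norm; first by rewrite exprVn -mulrA -invfM -exprD.
by rewrite mulr_ge0// ?divr_ge0 ?exprn_ge0 ?invr_ge0// ltW.
Qed.

Lemma left_step_L2_cvg0 (N m : nat) :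
  (\int[mu]_(s in `[0%R, (N%:R * mesh m)%R])
     (fnorm (sigma s - step_eval (left_step (mesh (m + n)) (N * 2 ^ n)) s) ^+ 2)%:E
     @[n --> \oo] --> 0)%E.
Proof.
have t0 : 0 <= N%:R * mesh m by rewrite mulr_ge0// ltW// mesh_gt0.
set t := N%:R * mesh m in t0 *.
apply/ereal_cvg0P => [n|e e0].
  by apply: integral_ge0 => s _; rewrite lee_fin sqr_ge0.
pose C := d%:R * r%:R * t + 1.
have C1 : 0 < C by rewrite /C ltr_wpDl// mulr_ge0.
pose e' := Num.min 1 (e / C).
have e'0 : 0 < e' by rewrite lt_min ltr01 divr_gt0.
have [eta eta0 he] := continuous_nonneg_uniform t sigma_cont e'0.
apply: filterS (mesh_small m eta0) => n dn.
have tE : t = (N * 2 ^ n)%:R * mesh (m + n) by rewrite mesh_refine.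
rewrite [in X in (X <= _)%E]tE.
apply: le_trans (left_step_L2_le (mesh_gt0 _) (ltW e'0) _) _.
  move=> s l lN /andP[ls sl] i j.
  have l0 : 0 <= l%:R * mesh (m + n) by rewrite mulr_ge0// ltW// mesh_gt0.
  have ss : `|s - l%:R * mesh (m + n)| < eta.
    rewrite ger0_norm ?subr_ge0 ?(ltW ls)//; apply: le_lt_trans dn.
    by rewrite lerBlDl; move: sl; rewrite -natr1 mulrDl mul1r.
  have st : 0 <= s <= t.
    rewrite (le_trans l0 (ltW ls))//= (le_trans sl)// tE.
    by rewrite ler_pM2r ?mesh_gt0// ler_nat.
  have := he _ _ st l0 ss; move=> /ltW; apply: le_trans.
  by have := mx_entry_le (sigma s - sigma (l%:R * mesh (m + n))) i j; rewrite !mxE.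
rewrite mesh_refine -/t lee_fin.
have e'1 : e' ^+ 2 <= e'.
  by rewrite expr2 ler_piMl ?(ltW e'0)// ge_min lexx.
have e'2 : e' <= e / C by rewrite ge_min lexx orbT.
have c0 : 0 <= d%:R * r%:R * t by apply: mulr_ge0 => //; exact: mulr_ge0.
rewrite mulrAC; apply: (le_trans (ler_wpM2l c0 e'1)).
apply: (le_trans (ler_wpM2l c0 e'2)).
by rewrite mulrCA -[leRHS]mulr1 ler_pM2l// ler_pdivrMr// mul1r /C lerDl.
Qed.

(** Chebyshev's inequality for the convergence in mean square that defines the
    stochastic integral. *)
Lemma integral_in_probability (N m : nat) (i : 'I_d) (x e : R) : 0 < x -> 0 < e ->
  \forall n \near \oo,
  (P [set w | (x < `|M (N%:R * mesh m) w i 0 -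
        weighted_sum B (mesh (m + n)) (row_weights (mesh (m + n)) i) 0 (N * 2 ^ n) w|)%R] <= e%:E)%E.
Proof.
move=> x0 e0; have t0 : 0 <= N%:R * mesh m by rewrite mulr_ge0// ltW// mesh_gt0.
have [mM hM] := M_integral t0.
have := hM _ _ (left_step_L2_cvg0 N m).
have on n : step_on (N%:R * mesh m) (left_step (mesh (m + n)) (N * 2 ^ n)).
  by apply: left_step_on; [exact: mesh_gt0|rewrite mesh_refine].
move=> /(_ on) hc.
have xe0 : 0 < x ^+ 2 * e by rewrite mulr_gt0// exprn_gt0.
have /ereal_cvg0P h : forall n, (0 <= \int[P]_w (fnorm (M (N%:R * mesh m) w -
    step_integral (left_step (mesh (m + n)) (N * 2 ^ n)) B w) ^+ 2)%:E)%E.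
  by move=> n; apply: integral_ge0 => w _; rewrite lee_fin sqr_ge0.
apply: filterS (h.1 hc _ xe0) => n.
set Y := M _; set S := step_integral _ _ => hn.
have mS k : measurable_fun setT (fun w => S w k 0).
  have -> : (fun w => S w k 0) = weighted_sum B (mesh (m + n)) (row_weights (mesh (m + n)) k) 0 (N * 2 ^ n).
    by apply/funext => w; exact: left_step_integral.
  apply: (@known_measurable _ _ _ _ F_filtration ((0 + N * 2 ^ n)%:R * mesh (m + n))).
    by rewrite mulr_ge0// ltW// mesh_gt0.
  exact: (weighted_sum_known F_filtration B_brownian _ (mesh_gt0 _)).
have mD k : measurable_fun setT (fun w => Y w k 0 - S w k 0) by exact: measurable_funB.
have mf : measurable_fun setT (fun w => fnorm (Y w - S w) ^+ 2).
  have -> : (fun w => fnorm (Y w - S w) ^+ 2) = (fun w => \sum_k (Y w k 0 - S w k 0) ^+ 2).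
    by apply/funext => w; rewrite fnorm_sqr; apply: eq_bigr => k _; rewrite big_ord1 !mxE.
  by apply: measurable_sum => k; apply: measurable_funX.
have mN : measurable_fun setT (fun w => `|Y w i 0 - S w i 0|) by exact: measurableT_comp.
set A := [set w | _].
have AE : A = (fun w => `|Y w i 0 - S w i 0|) @^-1` `]x, +oo[.
  by apply/seteqP; split=> w; rewrite /A /= in_itv/= andbT /S left_step_integral.
have mA : measurable A by rewrite AE -[_ @^-1` _]setTI; exact: mN.
have x20 : 0 < x ^+ 2 by rewrite exprn_gt0.
rewrite -(@lee_pmul2l _ (x ^+ 2)%:E)//.
rewrite -EFinM; apply: le_trans hn.
have -> : P A = (\int[P]_w (\1_A w)%:E)%E by rewrite integral_indic// setIT.
rewrite -ge0_integralZl//=.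
- apply: ge0_le_integral => //=.
  + by move=> w _; rewrite lee_fin mulr_ge0// ltW.
  + by apply: measurable_funeM; apply/measurable_EFinP; exact: measurable_indic.
  + exact/measurable_EFinP.
  + move=> w _; rewrite -EFinM lee_fin indicE.
    have [Aw|Aw] := boolP (w \in A); last by rewrite mulr0 sqr_ge0.
    rewrite mulr1 (le_trans _ (entry_sqr_le_fnorm (Y w - S w) i 0))//.
    move: Aw; rewrite inE AE /= in_itv/= andbT => xw.
    rewrite !mxE -[leRHS]real_normK ?num_real// ler_sqr ?nnegrE ?(ltW x0)//.
    exact: ltW.
- by apply/measurable_EFinP; exact: measurable_indic.
- by rewrite lee_fin ltW.
Qed.

End approximation.
End step_approximation.

(** * Oscillation of the stochastic integral over a window *)

Section gauss_tail.
Variable R : realType.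
Implicit Types c u v : R.

(** The value zero for [v = 0] is the limit as [v] decreases to 0, which keeps the
    function monotone in [v]. *)
Definition gauss_tail c v : R := if 0 < v then expR (- (c / v)) else 0.

Lemma gauss_tail_ge0 c v : 0 <= gauss_tail c v.
Proof. by rewrite /gauss_tail; case: ifP => // _; exact: expR_ge0. Qed.

Lemma gauss_tail_le1 c v : 0 <= c -> gauss_tail c v <= 1.
Proof.
move=> c0; rewrite /gauss_tail; case: ifP => // v0.
by rewrite -[leRHS]expR0 ler_expR oppr_le0 divr_ge0// ltW.
Qed.

Lemma gauss_tail_le c u v : 0 <= c -> u <= v -> gauss_tail c u <= gauss_tail c v.
Proof.
move=> c0 uv; rewrite /gauss_tail; case: (ltP 0 u) => u0; last first.
  by case: ifP => // _; exact: expR_ge0.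
have v0 := lt_le_trans u0 uv.
by rewrite v0 ler_expR lerN2 ler_wpM2l// lef_pV2.
Qed.

Lemma gauss_tail_scale c q v : 0 < q -> gauss_tail c (q * v) = gauss_tail (c / q) v.
Proof.
by move=> q0; rewrite /gauss_tail pmulr_rgt0//; case: ifP => // _; rewrite invfM mulrA.
Qed.

(** A sum of [q] terms is at most [q] times its largest term. *)
Lemma gauss_tail_sum_le c (q : nat) (v : nat -> R) : 0 <= c ->
  gauss_tail c (\sum_(i < q) v i) <= \sum_(i < q) gauss_tail (c / q%:R) (v i).
Proof.
move=> c0; have [V0|V0] := ltP 0 (\sum_(i < q) v i); last first.
  rewrite {1}/gauss_tail ltNge V0/=; apply: sumr_ge0 => i _; exact: gauss_tail_ge0.
have q0 : 0 < q%:R :> R.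
  by rewrite ltr0n lt0n; apply: contraTneq V0 => ->; rewrite big_ord0 ltxx.
have [i hi] : exists i : 'I_q, \sum_(k < q) v k <= q%:R * v i.
  apply: contrapT => /forallNP h.
  have : \sum_(k < q) (q%:R * v k) < \sum_(k < q) \sum_(l < q) v l.
    apply: ltr_sum => [|k _]; last by rewrite ltNge; apply/negP; exact: h.
    apply/hasP; move: q0; rewrite ltr0n => q0; exists (Ordinal q0) => //.
  by rewrite -mulr_sumr sumr_const card_ord -[X in _ < X]mulr_natl ltxx.
apply: (le_trans (gauss_tail_le c0 hi)); rewrite gauss_tail_scale//.
by rewrite (bigD1 i)//= lerDl sumr_ge0// => k _; exact: gauss_tail_ge0.
Qed.

Lemma gauss_tail_anti c c' u : c <= c' -> gauss_tail c' u <= gauss_tail c u.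
Proof.
move=> cc; rewrite /gauss_tail; case: ltP => // u0.
by rewrite ler_expR lerN2 ler_wpM2r// invr_ge0 ltW.
Qed.

(** Either [c / u <= k ln 2], and the factor [2 ^ k] lifts [exp (- c / u)] above 1,
    or the left side is itself at most [2 ^ (- th k)]. This makes the bound
    [gauss_tail c u] useful when summed over [4 ^ k] windows even if the exponent at
    hand is smaller than [c], since [2 ^ k] is small against [4 ^ k]. *)
Lemma gauss_tail_split (th : R) c u (k : nat) : 0 < th -> 0 < c ->
  gauss_tail (th * c) u <= gauss_tail c u * 2 ^+ k + expR (- (th * ln 2)) ^+ k.
Proof.
move=> th0 c0; rewrite /gauss_tail; case: ltP => u0; last first.
  by rewrite mul0r add0r exprn_ge0// expR_ge0.
have two : (2 : R) ^+ k = expR (k%:R * ln 2) by rewrite expRM_natl lnK// posrE.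
have [y|y] := leP (c / u) (k%:R * ln 2).
  apply: (@le_trans _ _ 1).
    rewrite -[leRHS]expR0 ler_expR oppr_le0 divr_ge0 ?(ltW u0)//.
    by rewrite mulr_ge0// ltW.
  rewrite two -expRD -[leLHS]addr0 lerD ?exprn_ge0 ?expR_ge0//.
  by rewrite -[leLHS]expR0 ler_expR addrC subr_ge0.
rewrite -[leLHS]add0r; apply: lerD; first by apply: mulr_ge0; rewrite ?expR_ge0 ?exprn_ge0.
rewrite -expRM_natl ler_expR mulrN lerN2 mulrCA -mulrA ler_pM2l//.
exact: ltW.
Qed.

End gauss_tail.

Section window_tail.
Context {R : realType} {disp : measure_display} {Omega : measurableType disp}.
Variables (P : probability Omega R) (F : R -> set (set Omega)).
Hypothesis F_filtration : filtration F.
Variables (d r : nat) (B : R -> Omega -> 'cV[R]_r).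
Hypothesis B_brownian : brownian_motion P F B.
Variable sigma : R -> 'M[R]_(d, r).
Hypothesis sigma_cont : continuous_nonneg sigma.
Variable M : R -> Omega -> 'cV[R]_d.
Hypothesis M_integral : forall t, 0 <= t -> is_stochastic_integral P sigma B t (M t).
Variable L : R.
Hypothesis L_gt0 : 0 < L.
Local Notation mu := (@lebesgue_measure R).
Local Notation mesh := (mesh L).

Definition row_sq (i : 'I_d) (s : R) : R := \sum_j sigma s i j ^+ 2.

Definition row_integral (i : 'I_d) (j : nat) : R :=
  \int[mu]_(s in `[(j%:R * L), (j.+1%:R * L)]) row_sq i s.

Lemma row_sq_cont i : continuous_nonneg (row_sq i).
Proof.
apply: within_sum => j; apply: (@within_comp _ _ (fun s => sigma s i j) (fun y => y ^+ 2)).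
  exact: within_coord.
exact: sqr_continuous.
Qed.

Lemma row_sq_ge0 i s : 0 <= row_sq i s.
Proof. by apply: sumr_ge0 => j _; exact: sqr_ge0. Qed.

Lemma row_integral_ge0 i j : 0 <= row_integral i j.
Proof. by apply: Rintegral_ge0 => s _; exact: row_sq_ge0. Qed.

Lemma sq_integral_row j :
  sq_integral sigma (j%:R * L) (j.+1%:R * L) = \sum_i row_integral i j.
Proof.
have j0 : 0 <= j%:R * L by rewrite mulr_ge0// ltW.
have ri i : mu.-integrable `[(j%:R * L), (j.+1%:R * L)] (EFin \o row_sq i).
  by apply: within_integrable; apply: continuous_nonneg_within => //; exact: row_sq_cont.
rewrite /sq_integral /row_integral.
have -> : (fun s => fnorm (sigma s) ^+ 2) = (fun s => \sum_i row_sq i s).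
  by apply/funext => s; exact: fnorm_sqr.
elim: (index_enum _) => [|i s IH].
  rewrite big_nil (_ : (fun x => _) = cst 0); last by apply/funext => s; rewrite big_nil.
  by rewrite Rintegral_cst// mul0r.
rewrite big_cons -IH (_ : (fun x => _) = (fun x => row_sq i x + \sum_(k <- s) row_sq k x)).
  rewrite RintegralD//; apply: within_integrable; apply: within_sum => k.
  by apply: continuous_nonneg_within => //; exact: row_sq_cont.
by apply/funext => u; rewrite big_cons.
Qed.

Lemma row_integral_le i j :
  row_integral i j <= sq_integral sigma (j%:R * L) (j.+1%:R * L).
Proof.
rewrite sq_integral_row (bigD1 i)//= lerDl sumr_ge0// => k _.
exact: row_integral_ge0.
Qed.

Lemma mesh_window (j n : nat) : (j * 2 ^ n)%:R * mesh n = j%:R * L.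
Proof. by have := mesh_refine L j 0 n; rewrite add0n /mesh expr0 divr1. Qed.

Lemma mesh_unit (n : nat) : (2 ^ n)%:R * mesh n = L.
Proof. by have := mesh_window 1 n; rewrite mul1n mul1r. Qed.

Local Notation weights n i := (row_weights sigma (mesh n) i).
Local Notation window_var n i j := (weighted_sum_var (mesh n) (weights n i) (j * 2 ^ n) (2 ^ n)).

Lemma window_var_cvg (i : 'I_d) (j : nat) (e : R) : 0 < e ->
  \forall n \near \oo, `|window_var n i j - row_integral i j| <= e.
Proof.
move=> e0; have eL : 0 < e / L by rewrite divr_gt0.
have [eta eta0 he] := @uniform_continuity_segment _ _ _ 0 (j.+1%:R * L) _
   (continuous_nonneg_ext (@row_sq_cont i)) eL.
have := mesh_small L_gt0 0 eta0; apply: filterS => n; rewrite add0n => dn.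
have m0 := mesh_gt0 L_gt0 n.
have := @riemann_sum_le _ (row_sq i) (mesh n) (e / L) (j * 2 ^ n) (2 ^ n) m0 (ltW eL).
have -> : (j * 2 ^ n + 2 ^ n)%N = (j.+1 * 2 ^ n)%N by rewrite mulSn addnC.
rewrite !mesh_window mesh_unit divfK ?gt_eqF// => h.
rewrite distrC; apply: h => [t|l s lL /andP[s1 s2]].
  by apply: continuous_nonneg_within => //; exact: row_sq_cont.
have l0 : 0 <= (j * 2 ^ n + l)%:R * mesh n by rewrite mulr_ge0// ltW.
have s0 := le_trans l0 s1.
have sT : s <= j.+1%:R * L.
  rewrite (le_trans s2)// -(mesh_window j.+1 n) ler_pM2r// ler_nat mulSnr.
  by rewrite -addnS leq_add2l.
have := he s ((j * 2 ^ n + l)%:R * mesh n).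
rewrite s0 sT (max_r s0) (max_r l0) => /(_ isT) h'; apply/ltW/h'.
rewrite ger0_norm ?subr_ge0//; apply: le_lt_trans dn.
by rewrite lerBlDl; move: s2; rewrite -natr1 mulrDl mul1r.
Qed.

Let M_meas t i : 0 <= t -> measurable_fun setT (fun w => M t w i 0).
Proof. by move=> t0; have [h _] := M_integral t0; exact: h. Qed.

Let S_meas n i p l : measurable_fun setT (weighted_sum B (mesh n) (weights n i) p l).
Proof.
apply: (@known_measurable _ _ _ _ F_filtration ((p + l)%:R * mesh n)).
  by rewrite mulr_ge0// ltW// mesh_gt0.
exact: (weighted_sum_known F_filtration B_brownian _ (mesh_gt0 L_gt0 _)).
Qed.

Lemma weighted_sum_cat n (a : nat -> 'I_r -> R) p l w :
  weighted_sum B (mesh n) a 0 (p + l) w =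
  weighted_sum B (mesh n) a 0 p w + weighted_sum B (mesh n) a p l w.
Proof. by rewrite /weighted_sum big_split_ord/=; congr (_ + _); apply: eq_bigr. Qed.

Lemma measurable_abs_gt (f : Omega -> R) (x : R) : measurable_fun setT f ->
  measurable [set w | x < `|f w|].
Proof.
move=> mf; have -> : [set w | x < `|f w|] = (fun w => `|f w|) @^-1` `]x, +oo[.
  by apply/seteqP; split=> w; rewrite /= in_itv/= andbT.
by rewrite -[_ @^-1` _]setTI; apply: (measurableT_comp _ mf).
Qed.

Definition deviates (m n N : nat) (i : 'I_d) (x : R) : set Omega :=
  [set w | x < `|M (N%:R * mesh m) w i 0 -
                 weighted_sum B (mesh (m + n)) (weights (m + n) i) 0 (N * 2 ^ n) w|].

Lemma deviates_measurable m n N i x : measurable (deviates m n N i x).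
Proof.
apply: measurable_abs_gt; apply: measurable_funB; last exact: S_meas.
by apply: M_meas; rewrite mulr_ge0// ltW// mesh_gt0.
Qed.

Lemma deviates_small m N i (x e : R) : 0 < x -> 0 < e ->
  \forall n \near \oo, (P (deviates m n N i x) <= e%:E)%E.
Proof.
move=> x0 e0.
exact: (integral_in_probability F_filtration B_brownian sigma_cont M_integral L_gt0).
Qed.

Lemma increment_approximation (i : 'I_d) (j : nat) (x e : R) : 0 < x -> 0 < e ->
  \forall n \near \oo,
  (P [set w | (x < `|(M (j.+1%:R * L) w i 0 - M (j%:R * L) w i 0) -
     weighted_sum B (mesh n) (weights n i) (j * 2 ^ n) (2 ^ n) w|)%R] <= e%:E)%E.
Proof.
move=> x0 e0; have x2 : 0 < x / 2 by rewrite divr_gt0.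
have e2 : 0 < e / 2 by rewrite divr_gt0.
have tE N : N%:R * mesh 0 = N%:R * L by rewrite /mesh expr0 divr1.
near=> n.
have h1 : (P (deviates 0 n j.+1 i (x / 2)) <= (e / 2)%:E)%E.
  by near: n; exact: deviates_small.
have h2 : (P (deviates 0 n j i (x / 2)) <= (e / 2)%:E)%E.
  by near: n; exact: deviates_small.
rewrite [e]splitr EFinD; apply: le_trans (leeD h1 h2).
have m1 := deviates_measurable 0 n j.+1 i (x / 2).
have m2 := deviates_measurable 0 n j i (x / 2).
apply: le_trans (measureU2 P m1 m2).
apply: le_measure; rewrite ?inE.
- apply: measurable_abs_gt; apply: measurable_funB; last exact: S_meas.
  by apply: measurable_funB; apply: M_meas; rewrite mulr_ge0// ltW.
- exact: measurableU.
move=> w /= xw; apply: contrapT => /not_orP[/negP n1 /negP n2].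
move: n1 n2; rewrite /deviates /= !tE add0n -!leNgt => n1 n2.
have := weighted_sum_cat n (weights n i) (j * 2 ^ n) (2 ^ n) w.
have -> : (j * 2 ^ n + 2 ^ n)%N = (j.+1 * 2 ^ n)%N by rewrite mulSn addnC.
move=> e1; rewrite e1 in n1.
move: xw; rewrite ltNge => /negP; apply.
move: n1 n2; set m1' := M _ _ _ _; set m2' := M _ _ _ _.
set s1 := weighted_sum _ _ _ _ _ _; set s2 := weighted_sum _ _ _ _ _ _ => n1 n2.
have -> : m1' - m2' - s2 = (m1' - (s1 + s2)) - (m2' - s1) by ring.
by rewrite [x]splitr (le_trans (ler_normB _ _))// lerD.
Unshelve. all: by end_near. Qed.

Definition grid_osc_gt (j m : nat) (i : 'I_d) (x : R) : set Omega :=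
  [set w | exists2 l, (l <= 2 ^ m)%N &
     x < `|M ((j * 2 ^ m + l)%:R * mesh m) w i 0 - M (j%:R * L) w i 0|].

Lemma grid_osc_measurable j m i x : measurable (grid_osc_gt j m i x).
Proof.
have -> : grid_osc_gt j m i x = \bigcup_(l in [set l | (l <= 2 ^ m)%N])
    [set w | x < `|M ((j * 2 ^ m + l)%:R * mesh m) w i 0 - M (j%:R * L) w i 0|].
  by apply/seteqP; split=> w [l lm xl]; exists l.
apply: bigcup_measurable => l _; apply: measurable_abs_gt.
by apply: measurable_funB; apply: M_meas; rewrite mulr_ge0// ltW// mesh_gt0.
Qed.

Lemma weighted_sum_opp n (a : nat -> 'I_r -> R) p l w :
  weighted_sum B (mesh n) (fun l j => - a l j) p l w = - weighted_sum B (mesh n) a p l w.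
Proof.
rewrite /weighted_sum -sumrN; apply: eq_bigr => k _; rewrite /weighted_increment -sumrN.
by apply: eq_bigr => i _; rewrite mulNr.
Qed.

Lemma weighted_sum_var_opp n (a : nat -> 'I_r -> R) p l :
  weighted_sum_var (mesh n) (fun l j => - a l j) p l = weighted_sum_var (mesh n) a p l.
Proof.
apply: eq_bigr => k _; rewrite /weighted_var; congr (_ * _).
by apply: eq_bigr => i _; rewrite sqrrN.
Qed.

(** If the integral moves by more than [2 x] along the grid, either the
    approximating sums reach [x] upwards or downwards, or the approximation is off
    by more than [x / 2] at some point of the grid. *)
Lemma grid_osc_sub j m n i (x : R) : 0 < x ->
  grid_osc_gt j m i (2 * x) `<=`
    (reaches B (mesh (m + n)) (weights (m + n) i) (j * 2 ^ (m + n)) (2 ^ (m + n)) x `|`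
     reaches B (mesh (m + n)) (fun l k => - weights (m + n) i l k) (j * 2 ^ (m + n)) (2 ^ (m + n)) x) `|`
    \big[setU/set0]_(l < (2 ^ m).+1) deviates m n (j * 2 ^ m + l) i (x / 2).
Proof.
move=> x0 w [l lm]; rewrite -(mesh_window j m) => xl.
apply: contrapT => /not_orP[/not_orP[nr1 nr2] nd].
have nd' k : (k <= 2 ^ m)%N -> ~ deviates m n (j * 2 ^ m + k) i (x / 2) w.
  move=> km dk; apply: nd.
  by rewrite -(bigcup_mkord _ (fun k => deviates m n (j * 2 ^ m + k) i (x / 2))); exists k.
move: (nd' l lm) (nd' 0%N (leq0n _)); rewrite addn0.
rewrite /deviates/= => /negP; rewrite -leNgt => d1 /negP; rewrite -leNgt => d2.
move: d1; rewrite mulnDl weighted_sum_cat -mulnA -expnD => d1.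
rewrite -mulnA -expnD in d2.
have lk : (l * 2 ^ n <= 2 ^ (m + n))%N by rewrite expnD leq_mul2r lm orbT.
move: xl d1 d2; set m1' := M _ _ _ _; set m2' := M _ _ _ _.
set s1 := weighted_sum _ _ _ _ _ _.
set s2 := weighted_sum _ _ _ (j * _) _ _ => xl d1 d2.
have s2x : `|s2| < x.
  rewrite ltr_norml; apply/andP; split.
    rewrite ltrNl ltNge; apply/negP => h; apply: nr2; exists (l * 2 ^ n)%N => //.
    by rewrite weighted_sum_opp.
  by rewrite ltNge; apply/negP => h; apply: nr1; exists (l * 2 ^ n)%N.
move: xl; apply/negP; rewrite -leNgt.
have -> : m1' - m2' = (m1' - (s1 + s2)) - (m2' - s1) + s2 by ring.
rewrite (le_trans (ler_normD _ _))// mulr_natl mulr2n lerD//; last exact: ltW.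
by rewrite [x]splitr (le_trans (ler_normB _ _))// lerD.
Qed.

(** The cost of the approximation disappears as its level tends to infinity, and
    only the maximal inequality remains. *)
Lemma grid_osc_prob j m i (x v : R) : 0 < x -> row_integral i j < v ->
  (P (grid_osc_gt j m i (2 * x)) <= (2 * expR (- (x ^+ 2 / (2 * v))))%:E)%E.
Proof.
move=> x0 Iv; have v0 : 0 < v by apply: le_lt_trans Iv; exact: row_integral_ge0.
have x2 : 0 < x / 2 by rewrite divr_gt0.
have N0 : 0 < (2 ^ m).+1%:R :> R by rewrite ltr0n.
apply/lee_addgt0Pr => e e0.
have eN : 0 < e / (2 ^ m).+1%:R by rewrite divr_gt0.
have vI : 0 < v - row_integral i j by rewrite subr_gt0.
have [n0 _ h] := window_var_cvg i j vI.
near \oo => n.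
have hv : window_var (m + n) i j <= v.
  have /h /= : (n0 <= m + n)%N.
    by apply: leq_trans (leq_addl _ _); near: n; exists n0.
  by move=> /(le_trans (ler_norm _)); rewrite lerD2r.
have hd (l : 'I_(2 ^ m).+1) :
    (P (deviates m n (j * 2 ^ m + l) i (x / 2)) <= (e / (2 ^ m).+1%:R)%:E)%E.
  move: l; near: n; apply: filter_forall => l; exact: deviates_small.
set p := (j * 2 ^ (m + n))%N; set q := (2 ^ (m + n))%N.
have d0 := mesh_gt0 L_gt0 (m + n).
have mr1 := reaches_measurable F_filtration B_brownian (weights (m + n) i) d0 p q x.
pose a' := fun (l : nat) (k : 'I_r) => - weights (m + n) i l k.
have mr2 := reaches_measurable F_filtration B_brownian a' d0 p q x.
pose E1 := reaches B (mesh (m + n)) (weights (m + n) i) p q x.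
pose E2 := reaches B (mesh (m + n)) a' p q x.
pose D l := deviates m n (j * 2 ^ m + l) i (x / 2).
have mb : measurable (\big[setU/set0]_(l < (2 ^ m).+1) D l).
  by apply: bigsetU_measurable => l _; exact: deviates_measurable.
apply: (@le_trans _ _ (P E1 + P E2 + \sum_(l < (2 ^ m).+1) P (D l))%E).
  apply: le_trans (leeD (measureU2 P mr1 mr2) (Boole_inequality P _)); last first.
    by move=> l _; exact: deviates_measurable.
  apply: le_trans (measureU2 P (measurableU _ _ mr1 mr2) mb).
  apply: le_measure; rewrite ?inE.
  - exact: grid_osc_measurable.
  - by apply: measurableU => //; exact: measurableU.
  - exact: grid_osc_sub.
have r1 := reaches_prob_le F_filtration B_brownian (a := weights (m + n) i) d0 (p := p)
  (L := q) (ltW x0) v0 hv.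
have r2 := reaches_prob_le F_filtration B_brownian
  (a := a') d0 (p := p) (L := q) (ltW x0) v0.
rewrite weighted_sum_var_opp in r2; have {}r2 := r2 hv.
apply: leeD.
  by rewrite [(2 * _)%R]mulr_natl mulr2n EFinD; exact: leeD.
apply: (@le_trans _ _ (\sum_(l < (2 ^ m).+1) (e / (2 ^ m).+1%:R)%:E)%E).
  by apply: lee_sum => l _; exact: hd.
rewrite sumEFin sumr_const card_ord lee_fin -[leLHS]mulr_natr divfK//.
Unshelve. all: by end_near. Qed.

Definition window_osc_gt (j : nat) (i : 'I_d) (x : R) : set Omega :=
  \bigcup_m grid_osc_gt j m i x.

Lemma window_osc_measurable j i x : measurable (window_osc_gt j i x).
Proof. by apply: bigcupT_measurable => m; exact: grid_osc_measurable. Qed.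

(** Continuity from below of [P] along the refining grids. The strict bound
    [V < v] of the previous estimate is met by [v = 2 V], or by arbitrarily small
    [v] if [V = 0]. *)
Lemma window_osc_prob j i (x : R) : 0 < x ->
  (P (window_osc_gt j i x) <=
   (2 * gauss_tail (x ^+ 2 / 16) (sq_integral sigma (j%:R * L) (j.+1%:R * L)))%:E)%E.
Proof.
move=> x0; set V := sq_integral _ _ _.
have x2 : 0 < x / 2 by rewrite divr_gt0.
have IV : row_integral i j <= V by exact: row_integral_le.
have I0 := row_integral_ge0 i j.
have nd : nondecreasing_seq (fun m => grid_osc_gt j m i x).
  apply/nondecreasing_seqP => m; apply/subsetPset => w [l lm xl].
  exists (l * 2)%N; first by rewrite expnSr leq_mul2r lm orbT.
  have := mesh_refine L (j * 2 ^ m + l) m 1.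
  by rewrite addn1 expn1 mulnDl -mulnA -expnSr => ->.
have bound v : V < v -> (P (window_osc_gt j i x) <= (2 * expR (- (x ^+ 2 / (8 * v))))%:E)%E.
  move=> Vv.
  have c := nondecreasing_cvg_mu (mu := P) (fun m => grid_osc_measurable j m i x)
    (window_osc_measurable j i x) nd.
  rewrite -(cvg_lim _ c)//; apply: lime_le; first by apply/cvg_ex; eexists; exact: c.
  apply: nearW => m /=.
  have := @grid_osc_prob j m i (x / 2) v x2 (le_lt_trans IV Vv).
  have -> : 2 * (x / 2) = x by field.
  have -> // : (x / 2) ^+ 2 / (2 * v) = x ^+ 2 / (8 * v).
  have v0 : 0 < v by apply: le_lt_trans Vv; exact: le_trans IV.
  by field; rewrite gt_eqF.
rewrite /gauss_tail; case: ltP => V0.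
  have := bound (2 * V); rewrite ltr_pMl// ltr1n => /(_ isT).
  have -> // : x ^+ 2 / (8 * (2 * V)) = x ^+ 2 / 16 / V.
  by field; rewrite gt_eqF.
rewrite mulr0; apply/lee_addgt0Pr => e e0; rewrite add0e.
(* the bound [2 exp (-x^2/(8v))] is at most [2/(1+x^2/(8v))], small for small [v] *)
pose v := x ^+ 2 * e / 16.
have v0 : 0 < v by rewrite divr_gt0// mulr_gt0// exprn_gt0.
apply: (le_trans (bound v (le_lt_trans V0 v0))); rewrite lee_fin.
have -> : x ^+ 2 / (8 * v) = 2 / e.
  by rewrite /v; field; rewrite !gt_eqF.
rewrite expRN -ler_pdivlMl//.
have e2 : 0 < 2 / e by rewrite divr_gt0.
have -> : 2^-1 * e = (2 / e)^-1 by rewrite invf_div mulrC.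
rewrite lef_pV2 ?posrE ?expR_gt0//.
by apply: le_trans (expR_ge1Dx _); rewrite lerDr.
Qed.

(** The grids are dense in the window, and the path is continuous. *)
Lemma window_osc_path j i x w : ~ window_osc_gt j i x w ->
  {within `[0, j.+1%:R * L], continuous (fun t => M t w i 0)} ->
  forall u, j%:R * L <= u <= j.+1%:R * L -> `|M u w i 0 - M (j%:R * L) w i 0| <= x.
Proof.
move=> nosc mc u /andP[u1 u2].
have j0 : 0 <= j%:R * L by rewrite mulr_ge0// ltW.
have grid m l : (l <= 2 ^ m)%N ->
    `|M ((j * 2 ^ m + l)%:R * mesh m) w i 0 - M (j%:R * L) w i 0| <= x.
  by move=> lm; rewrite leNgt; apply/negP => xl; apply: nosc; exists m => //; exists l.
apply/ler_addgt0Pr => e e0.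
have u0 : 0 <= u <= j.+1%:R * L by rewrite u2 (le_trans j0).
move/subspace_continuousP: mc => /(_ u).
rewrite /= in_itv/= u0 => /(_ isT) /cvgrPdist_le /(_ e e0).
rewrite near_withinE => -[eta /= eta0 he].
near \oo => m.
have dm : mesh m < eta.
  by near: m; have := mesh_small L_gt0 0 eta0; apply: filterS => m; rewrite add0n.
have m0 := mesh_gt0 L_gt0 m.
pose l := Num.trunc ((u - j%:R * L) / mesh m).
have q0 : 0 <= (u - j%:R * L) / mesh m by rewrite divr_ge0 ?subr_ge0// ltW.
have /andP[l1 l2] := truncn_itv q0; rewrite -/l in l1 l2.
rewrite ler_pdivlMr// in l1; rewrite ltr_pdivrMr// in l2.
have tE : (j * 2 ^ m + l)%:R * mesh m = j%:R * L + l%:R * mesh m.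
  by rewrite natrD mulrDl mesh_window.
have lm : (l <= 2 ^ m)%N.
  rewrite -(ler_nat R) -(ler_pM2r m0) (le_trans l1)//.
  by rewrite mesh_unit lerBlDr -[X in X + _]mul1r -mulrDl -natr1 addrC in u2 *.
have ul : (j * 2 ^ m + l)%:R * mesh m <= u by rewrite tE -lerBrDl.
have ue : `|u - (j * 2 ^ m + l)%:R * mesh m| < eta.
  rewrite ger0_norm ?subr_ge0//; apply: lt_trans dm.
  rewrite tE ltrBlDl -addrA -ltrBlDl (lt_le_trans l2)// -natr1 mulrDl mul1r//.
have t0 : 0 <= (j * 2 ^ m + l)%:R * mesh m by rewrite mulr_ge0// ltW.
have /= := he _ ue; rewrite in_itv/= t0 (le_trans ul u2) => /(_ isT) h.
rewrite -[_ - M (j%:R * L) w i 0](subrKA (M ((j * 2 ^ m + l)%:R * mesh m) w i 0)).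
by rewrite addrC (le_trans (ler_normD _ _))// lerD// grid.
Unshelve. all: by end_near. Qed.

End window_tail.

(** * Borel-Cantelli lemmas *)

Section borel_cantelli.
Context {R : realType} {disp : measure_display} {Omega : measurableType disp}.
Variable P : probability Omega R.

Lemma nneseries_le_bound (u : nat -> R) (m : nat) (S : R) : (forall n, 0 <= u n) ->
  (forall N, \sum_(m <= n < N) u n <= S) -> (\sum_(m <= n <oo) (u n)%:E <= S%:E)%E.
Proof.
move=> u0 uS; apply: lime_le.
  by apply: is_cvg_nneseries => n _ _; rewrite lee_fin.
by apply: nearW => N; rewrite sumEFin lee_fin.
Qed.

Lemma borel_cantelli_eventually (E : nat -> set Omega) (p : nat -> R) (S : R) :
  (forall n, measurable (E n)) -> (forall n, (P (E n) <= (p n)%:E)%E) ->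
  (forall N, \sum_(0 <= n < N) p n <= S) ->
  {ae P, forall w, exists n0, forall n, (n0 <= n)%N -> ~ E n w}.
Proof.
move=> mE Ep pS.
have p0 n : 0 <= p n by rewrite -lee_fin (le_trans _ (Ep n)).
have h : (\sum_(n <oo) P (E n) < +oo)%E.
  apply: (@le_lt_trans _ _ (\sum_(n <oo) (p n)%:E)%E).
    by apply: lee_nneseries => n *.
  by apply: le_lt_trans (nneseries_le_bound p0 pS) _; rewrite ltry.
exists (lim_sup_set E); split.
- by apply: bigcapT_measurable => n; apply: bigcup_measurable => k _; exact: mE.
- exact: lim_sup_set_cvg0.
move=> w /= nw n _; apply: contrapT => h1; apply: nw; exists n => k nk Ek.
by apply: h1; exists k.
Qed.

Variable G : nat -> set (set Omega).
Hypothesis G_setT : forall n, G n setT.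
Hypothesis G_measurable : forall n U, G n U -> measurable U.
Hypothesis G_avoid : forall n U V, G n U -> G n.+1 V -> G n.+1 (U `\` V).

(** Second Borel-Cantelli lemma, where independence is replaced by a lower bound
    on the conditional probability of each event given the past: the probability of
    avoiding all events from [n0] on is at most the product of the [1 - p n], hence
    at most [exp (- sum p n) = 0]. *)
Lemma borel_cantelli_infinitely_often (E : nat -> set Omega) (p : nat -> R) :
  (forall n, G n.+1 (E n)) -> (forall n, 0 <= p n) ->
  (forall n U, G n U -> ((p n)%:E * P U <= P (U `&` E n))%E) ->
  (forall S, exists N, S < \sum_(0 <= n < N) p n) ->
  {ae P, forall w, forall n0, exists2 n, (n0 <= n)%N & E n w}.
Proof.
move=> GE p0 pE pS.
apply/ae_foralln => n0.
pose U N := iteri N (fun k V => V `\` E (n0 + k)%N) setT.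
have GU N : G (n0 + N)%N (U N).
  by elim: N => [|N IH]; [exact: G_setT|rewrite addnS; apply: G_avoid].
have mU N : measurable (U N) by exact: G_measurable (GU N).
have mE n : measurable (E n) by exact: G_measurable (GE n).
have PU N : (P (U N) <= (expR (- \sum_(n0 <= n < n0 + N) p n))%:E)%E.
  elim: N => [|N IH].
    by rewrite addn0 big_geq// oppr0 expR0 probability_le1.
  have fU : P (U N) \is a fin_num by exact: fin_num_measure.
  have h := pE _ _ (GU N).
  have fI : P (U N `&` E (n0 + N)%N) \is a fin_num.
    by apply: fin_num_measure; exact: measurableI.
  rewrite -(fineK fU) -(fineK fI) -EFinM lee_fin in h.
  rewrite -(fineK fU) lee_fin in IH.
  have hD : P (U N.+1) = (fine (P (U N)) - fine (P (U N `&` E (n0 + N)%N)))%:E.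
    transitivity (P (U N) - P (U N `&` E (n0 + N)%N))%E.
      by apply: measureD => //; rewrite ltey_eq fU.
    by rewrite EFinB !fineK.
  rewrite hD lee_fin.
  rewrite addnS big_nat_recr ?leq_addr//= opprD expRD.
  set u := fine (P (U N)) in h IH *; set s := fine _ in h *.
  have u0 : 0 <= u by rewrite fine_ge0.
  apply: (@le_trans _ _ ((1 - p (n0 + N)%N) * u)); first by rewrite mulrBl mul1r lerD2l lerN2.
  rewrite mulrC; apply: (@le_trans _ _ (u * expR (- p (n0 + N)%N))).
    by rewrite ler_wpM2l// (le_trans _ (expR_ge1Dx _)).
  by rewrite ler_wpM2r// expR_ge0.
exists (\bigcap_N U N); split.
- by apply: bigcapT_measurable => N; exact: mU.
- apply/eqP; rewrite eq_le measure_ge0 andbT.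
  apply/lee_addgt0Pr => e e0; rewrite add0e.
  have [N hN] := pS (- ln e + \sum_(0 <= n < n0) p n).
  have hN' : - ln e < \sum_(n0 <= n < n0 + N) p n.
    have : - ln e + \sum_(0 <= n < n0) p n < \sum_(0 <= n < n0 + N) p n.
      apply: lt_le_trans hN _.
      rewrite (@big_cat_nat _ _ _ N 0%N (n0 + N)%N)//= ?leq_addl//.
      by rewrite lerDl sumr_ge0.
    have -> : \sum_(0 <= n < n0 + N) p n =
        \sum_(0 <= n < n0) p n + \sum_(n0 <= n < n0 + N) p n.
      by rewrite -big_cat_nat// leq_addr.
    by rewrite [X in X < _]addrC ltrD2l.
  apply: (@le_trans _ _ (P (U N))).
    apply: le_measure; rewrite ?inE//; first exact: bigcapT_measurable.
    exact: bigcap_inf.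
  apply: (le_trans (PU N)); rewrite lee_fin -[leRHS]lnK ?posrE// ler_expR.
  by rewrite lerNl ltW.
- move=> w /= nw N _; elim: N => [//|N IH]; split => // Ew.
  by apply: nw; exists (n0 + N)%N => //; rewrite leq_addr.
Qed.

End borel_cantelli.

(** * Series of Gaussian tails *)

Section series_bounds.
Variable R : realType.

Lemma sum_subsequence_le (u : nat -> R) (f : nat -> nat) (J : nat) :
  (forall n, 0 <= u n) -> (forall j, (f j < f j.+1)%N) ->
  \sum_(0 <= j < J) u (f j) <= \sum_(0 <= n < f J) u n.
Proof.
move=> u0 fi; elim: J => [|J IH]; first by rewrite big_geq// sumr_ge0.
rewrite big_nat_recr//= (@big_cat_nat _ _ _ (f J).+1 0%N (f J.+1))//=.
rewrite big_nat_recr//= -[leLHS]addr0 lerD ?lerD2r//.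
by rewrite sumr_ge0.
Qed.

Lemma bounded_nonneg_eventually_lt (u : nat -> R) (S e : R) : (forall n, 0 <= u n) ->
  (forall N, \sum_(0 <= n < N) u n <= S) -> 0 < e -> \forall n \near \oo, u n < e.
Proof.
move=> u0 uS e0.
have cu : cvgn (series u).
  apply: nondecreasing_is_cvgn; last by exists S => _ [N _ <-]; exact: uS.
  by apply/nondecreasing_seqP => N; rewrite /series/= big_nat_recr//= lerDl.
have /cvgrPdist_lt /(_ e e0) := cvg_series_cvg_0 cu.
by apply: filterS => n; rewrite sub0r normrN ger0_norm.
Qed.

Lemma geometric_sum_le (q : R) (N : nat) : 0 <= q < 1 ->
  \sum_(0 <= k < N) q ^+ k <= (1 - q)^-1.
Proof.
move=> /andP[q0 q1]; have q1' : 0 < 1 - q by rewrite subr_gt0.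
suff -> : \sum_(0 <= k < N) q ^+ k = (1 - q ^+ N) / (1 - q).
  by rewrite ler_piMl ?invr_ge0 ?(ltW q1')// lerBlDr lerDl exprn_ge0.
elim: N => [|N IH]; first by rewrite big_geq// expr0 subrr mul0r.
by rewrite big_nat_recr//= IH exprS; field; rewrite gt_eqF.
Qed.

End series_bounds.

Section variance_series.
Variables (R : realType) (d r : nat) (sigma : R -> 'M[R]_(d, r)) (h : R).
Hypothesis sigma_cont : continuous_nonneg sigma.
Hypothesis h_gt0 : 0 < h.
Local Notation mu := (@lebesgue_measure R).
Local Notation v n := (sq_integral sigma (n%:R * h) (n.+1%:R * h)).

Lemma fnorm_sqr_integrable a b : 0 <= a ->
  mu.-integrable `[a, b] (EFin \o (fun s => fnorm (sigma s) ^+ 2)).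
Proof.
move=> a0; have -> : (fun s => fnorm (sigma s) ^+ 2) = (fun s => \sum_i row_sq sigma i s).
  by apply/funext => s; exact: fnorm_sqr.
apply: within_integrable; apply: within_sum => i.
by apply: continuous_nonneg_within => //; exact: row_sq_cont.
Qed.

Lemma sq_integral_ge0 a b : 0 <= sq_integral sigma a b.
Proof. by apply: Rintegral_ge0 => s _; exact: sqr_ge0. Qed.

Lemma sq_integral_add a b c : 0 <= a -> a <= b -> b <= c ->
  sq_integral sigma a c = sq_integral sigma a b + sq_integral sigma b c.
Proof.
move=> a0 ab bc; have := Rintegral_itvB (fnorm_sqr_integrable c a0) (x := b).
rewrite !bnd_simp => /(_ ab bc) /eqP; rewrite subr_eq addrC => /eqP e.
rewrite [LHS]e; congr (_ + _); apply: Rintegral_itv_obnd_cbnd.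
apply: integrableS (fnorm_sqr_integrable c a0) => // u /=.
by rewrite !in_itv/= => /andP[su ->]; rewrite (le_trans ab)// ltW.
Qed.

Lemma sq_integral_le a b a' b' : 0 <= a' -> a' <= a -> a <= b -> b <= b' ->
  sq_integral sigma a b <= sq_integral sigma a' b'.
Proof.
move=> a0 aa ab bb.
rewrite (sq_integral_add a0 aa (le_trans ab bb)) (sq_integral_add (le_trans a0 aa) ab bb).
by rewrite addrCA lerDl addr_ge0// sq_integral_ge0.
Qed.

Lemma sq_integral_sum n q :
  sq_integral sigma (n%:R * h) ((n + q)%:R * h) = \sum_(i < q) v (n + i)%N.
Proof.
elim: q => [|q IH]; first by rewrite addn0 big_ord0 /sq_integral set_itv1 Rintegral_set1.
rewrite big_ord_recr/= -IH addnS; apply: sq_integral_add.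
- by rewrite mulr_ge0// ltW.
- by rewrite ler_pM2r// ler_nat leq_addr.
- by rewrite ler_pM2r// ler_nat.
Qed.

Definition Sh_term (eps u : R) : R := Num.sqrt u * expR (- (eps ^+ 2 / (2 * u))).

Lemma Sh_term_ge0 eps u : 0 <= Sh_term eps u.
Proof. by rewrite mulr_ge0 ?sqrtr_ge0 ?expR_ge0. Qed.

(** Half of the exponent absorbs the factor [sqrt u], since
    [exp (-y) <= 1 / (1 + y)]. *)
Lemma gauss_tail_le_Sh_term (eps u : R) : 0 < eps ->
  gauss_tail (eps ^+ 2) u <= eps^-1 * Sh_term eps u.
Proof.
move=> e0; rewrite /gauss_tail; case: ltP => u0; last first.
  by rewrite mulr_ge0 ?invr_ge0 ?(ltW e0)// Sh_term_ge0.
rewrite /Sh_term; set s := Num.sqrt u; have s0 : 0 < s by rewrite sqrtr_gt0.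
have us : u = s ^+ 2 by rewrite sqr_sqrtr// ltW.
set y := eps ^+ 2 / (2 * u).
have -> : eps ^+ 2 / u = y + y by rewrite /y; field; rewrite gt_eqF.
rewrite opprD expRD mulrA ler_pM2r ?expR_gt0// expRN ler_pdivlMl//.
rewrite ler_pdivrMr ?expR_gt0//.
apply: (@le_trans _ _ (s * (1 + y))); last by rewrite ler_wpM2l ?(ltW s0)// expR_ge1Dx.
have -> : s * (1 + y) = s + eps ^+ 2 / (2 * s).
  by rewrite /y us; field; rewrite gt_eqF.
rewrite -subr_ge0.
have -> : s + eps ^+ 2 / (2 * s) - eps = ((s - eps) ^+ 2 + s ^+ 2) / (2 * s).
  by field; rewrite gt_eqF.
by rewrite divr_ge0 ?addr_ge0 ?sqr_ge0// mulr_ge0// ltW.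
Qed.

Lemma Sh_sum_le (eps : R) : 0 < eps -> (Sh' sigma h eps < +oo)%E ->
  exists S, forall N, \sum_(0 <= n < N) gauss_tail (eps ^+ 2) (v n) <= S.
Proof.
move=> e0 Sfin.
have SE : Sh' sigma h eps = (\sum_(1 <= n <oo) (Sh_term eps (v n))%:E)%E by [].
have S0 : (0 <= Sh' sigma h eps)%E.
  by rewrite SE; apply: nneseries_ge0 => n _ _; rewrite lee_fin Sh_term_ge0.
have [S hS] : exists S : R, Sh' sigma h eps = S%:E.
  by exists (fine (Sh' sigma h eps)); rewrite fineK// ge0_fin_numE.
exists (1 + eps^-1 * S) => N.
have [->|N0] := posnP N.
  rewrite big_geq// addr_ge0// mulr_ge0 ?invr_ge0 ?(ltW e0)//.
  by rewrite -lee_fin -hS.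
rewrite big_ltn// lerD//; first by apply: gauss_tail_le1; exact: sqr_ge0.
apply: (@le_trans _ _ (\sum_(1 <= n < N) eps^-1 * Sh_term eps (v n))).
  by apply: ler_sum => n _; exact: gauss_tail_le_Sh_term.
rewrite -mulr_sumr ler_pM2l ?invr_gt0// -lee_fin -hS SE -sumEFin.
by apply: nneseries_lim_ge => n _ _; rewrite lee_fin Sh_term_ge0.
Qed.

(** Summable Gaussian tails force the variances to tend to zero; then the factors
    [sqrt v] are eventually at most one, and the series with these factors
    converges as well. *)
Lemma Sh_sum_unbounded (eps : R) : Sh' sigma h eps = +oo%E ->
  forall S, exists N, S < \sum_(0 <= n < N) gauss_tail (eps ^+ 2 / 2) (v n).
Proof.
move=> Soo S; apply: contrapT => /forallNP nS.
have {}nS N : \sum_(0 <= n < N) gauss_tail (eps ^+ 2 / 2) (v n) <= S.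
  by rewrite leNgt; apply/negP; exact: nS.
have c0 : 0 <= eps ^+ 2 / 2 by rewrite divr_ge0// sqr_ge0.
have [n0 _ hn0] := bounded_nonneg_eventually_lt (fun n => gauss_tail_ge0 (eps ^+ 2 / 2) (v n))
  nS (expR_gt0 (- (eps ^+ 2 / 2 / 1))).
have v1 n : (n0 <= n)%N -> v n <= 1.
  move=> nn; rewrite leNgt; apply/negP => vn.
  have := hn0 n nn; apply/negP; rewrite -leNgt.
  have := gauss_tail_le c0 (ltW vn); by rewrite {1}/gauss_tail ltr01.
have term_le n : (n0 <= n)%N -> Sh_term eps (v n) <= gauss_tail (eps ^+ 2 / 2) (v n).
  move=> nn; rewrite /gauss_tail; case: ltP => [v0|v0]; last first.
    have -> : v n = 0 by apply/eqP; rewrite eq_le v0 sq_integral_ge0.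
    by rewrite /Sh_term sqrtr0 mul0r.
  rewrite /Sh_term invfM mulrA ler_piMl ?expR_ge0//.
  by have := ler_wsqrtr (v1 n nn); rewrite sqrtr1.
suff : (Sh' sigma h eps <= (\sum_(0 <= n < n0) Sh_term eps (v n) + S)%:E)%E.
  by rewrite Soo leye_eq.
apply: nneseries_le_bound => [n|N]; first exact: Sh_term_ge0.
apply: (@le_trans _ _ (\sum_(0 <= n < n0 + N) Sh_term eps (v n))).
  apply: (@le_trans _ _ (\sum_(0 <= n < N) Sh_term eps (v n))).
    have [->|N0] := posnP N; first by rewrite !big_geq.
    by rewrite [leRHS]big_ltn// lerDr Sh_term_ge0.
  rewrite [leRHS](@big_cat_nat _ _ _ N 0%N (n0 + N)%N)//= ?leq_addl//.
  by rewrite lerDl sumr_ge0// => n _; exact: Sh_term_ge0.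
rewrite (@big_cat_nat _ _ _ n0 0%N (n0 + N)%N)//= ?leq_addr// lerD2l.
apply: (@le_trans _ _ (\sum_(n0 <= n < n0 + N) gauss_tail (eps ^+ 2 / 2) (v n))).
  by rewrite !big_nat; apply: ler_sum => n /andP[nn _]; exact: term_le.
apply: le_trans (nS (n0 + N)%N).
rewrite [leRHS](@big_cat_nat _ _ _ n0 0%N (n0 + N)%N)//= ?leq_addr//.
by rewrite lerDr sumr_ge0// => n _; exact: gauss_tail_ge0.
Qed.

(** Longer windows meet at most [q] of the short ones, and distinct long windows
    start in distinct short ones. *)
Lemma long_window_sum_le (L : R) : h <= L ->
  exists2 q : nat, (0 < q)%N & forall c S, 0 <= c ->
    (forall N, \sum_(0 <= n < N) gauss_tail c (v n) <= S) -> forall J,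
    \sum_(0 <= j < J) gauss_tail (q%:R * c) (sq_integral sigma (j%:R * L) (j.+1%:R * L)) <=
    q%:R * S.
Proof.
move=> hL; pose q := (Num.trunc (L / h)).+2; exists q => // c S c0 hS J.
have L0 : 0 < L by exact: lt_le_trans hL.
have q0 : 0 < q%:R :> R by rewrite ltr0n.
pose n0 j := Num.trunc (j%:R * L / h).
have x0 (j : nat) : 0 <= j%:R * L / h by rewrite divr_ge0 ?mulr_ge0// ltW.
have n0le j : (n0 j)%:R * h <= j%:R * L.
  by rewrite -ler_pdivlMr//; have /andP[] := truncn_itv (x0 j).
have n0lt j : j%:R * L < (n0 j).+1%:R * h.
  by rewrite -ltr_pdivrMr//; have /andP[] := truncn_itv (x0 j).
have n0S j : (n0 j < n0 j.+1)%N.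
  rewrite [(_ < _)%N]truncn_ge_nat// -natr1 ler_pdivlMr// mulrDl mul1r.
  by rewrite -natr1 [leRHS]mulrDl mul1r lerD.
have Lq : L < (Num.trunc (L / h)).+1%:R * h.
  rewrite -ltr_pdivrMr//.
  by have /andP[] := truncn_itv (divr_ge0 (ltW L0) (ltW h_gt0)).
have V_le j : sq_integral sigma (j%:R * L) (j.+1%:R * L) <= \sum_(i < q) v (n0 j + i)%N.
  rewrite -sq_integral_sum; apply: sq_integral_le => //.
  - by rewrite mulr_ge0// ltW.
  - by rewrite ler_pM2r// ler_nat.
  - have -> : (n0 j + q)%N = ((n0 j).+1 + (Num.trunc (L / h)).+1)%N.
      by rewrite /q !addnS addSn.
    by rewrite natrD -[j.+1%:R]natr1 !mulrDl mul1r lerD// ltW.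
apply: (@le_trans _ _ (\sum_(0 <= j < J) \sum_(i < q) gauss_tail c (v (n0 j + i)%N))).
  apply: ler_sum => j _.
  have qc0 : 0 <= q%:R * c by rewrite mulr_ge0.
  apply: (le_trans (gauss_tail_le qc0 (V_le j))).
  apply: (le_trans (gauss_tail_sum_le q (fun i => v (n0 j + i)%N) qc0)).
  by rewrite mulrAC divff ?mul1r// gt_eqF.
rewrite exchange_big/= (le_trans (ler_sum _ (G := fun=> S) _))//; last first.
  by rewrite sumr_const card_ord mulr_natl.
move=> i _; apply: le_trans (hS (n0 J + i)%N).
apply: (@sum_subsequence_le _ (fun n => gauss_tail c (v n)) (fun j => n0 j + i)%N).
  by move=> n; exact: gauss_tail_ge0.
by move=> j; rewrite ltn_add2r.
Qed.

End variance_series.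

(** * Almost sure behaviour of the stochastic integral *)

Section almost_sure.
Context {R : realType} {disp : measure_display} {Omega : measurableType disp}.
Variables (P : probability Omega R) (F : R -> set (set Omega)).
Hypothesis F_filtration : filtration F.
Variables (d r : nat) (B : R -> Omega -> 'cV[R]_r).
Hypothesis B_brownian : brownian_motion P F B.
Variable sigma : R -> 'M[R]_(d, r).
Hypothesis sigma_cont : continuous_nonneg sigma.
Variable M : R -> Omega -> 'cV[R]_d.
Hypothesis M_integral : forall t, 0 <= t -> is_stochastic_integral P sigma B t (M t).
Variable L : R.
Hypothesis L_gt0 : 0 < L.
Local Notation V j := (sq_integral sigma (j%:R * L) (j.+1%:R * L)).

Definition osc_exceeds (j : nat) (x : R) : set Omega :=
  \big[setU/set0]_(i < d) window_osc_gt M L j i x.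

Lemma osc_exceeds_measurable j x : measurable (osc_exceeds j x).
Proof.
by apply: bigsetU_measurable => i _; exact: (window_osc_measurable M_integral L_gt0).
Qed.

Lemma osc_exceeds_prob j (x : R) : 0 < x ->
  (P (osc_exceeds j x) <= (d%:R * (2 * gauss_tail (x ^+ 2 / 16) (V j)))%:E)%E.
Proof.
move=> x0; have mo (i : 'I_d) : measurable (window_osc_gt M L j i x).
  exact: (window_osc_measurable M_integral L_gt0).
have lS (s : seq 'I_d) : (P (\big[setU/set0]_(i <- s) window_osc_gt M L j i x) <=
    \sum_(i <- s) P (window_osc_gt M L j i x))%E.
  elim: s => [|i s IH]; first by rewrite !big_nil measure0.
  rewrite !big_cons; apply: le_trans (leeD (lexx _) IH); apply: measureU2 => //.
  by apply: bigsetU_measurable => k _.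
apply: le_trans (lS _) _.
apply: (@le_trans _ _ (\sum_(i < d) (2 * gauss_tail (x ^+ 2 / 16) (V j))%:E)%E).
  apply: lee_sum => i _.
  exact: (window_osc_prob F_filtration B_brownian sigma_cont M_integral L_gt0).
by rewrite sumEFin lee_fin sumr_const card_ord -[leLHS]mulr_natl.
Qed.

Lemma osc_exceeds_path j (x : R) w : 0 <= x -> ~ osc_exceeds j x w ->
  (forall i, {within `[0, j.+1%:R * L], continuous (fun t => M t w i 0)}) ->
  forall u i, j%:R * L <= u <= j.+1%:R * L -> `|M u w i 0 - M (j%:R * L) w i 0| <= x.
Proof.
move=> x0 nE mc u i; apply: (window_osc_path L_gt0) => // Ei; apply: nE.
by rewrite /osc_exceeds -bigcup_seq; exists i => //=; rewrite mem_index_enum.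
Qed.

Lemma osc_eventually_small (c x S : R) : 0 < x -> c <= x ^+ 2 / 16 ->
  (forall J, \sum_(0 <= j < J) gauss_tail c (V j) <= S) ->
  {ae P, forall w, exists j0, forall j, (j0 <= j)%N -> ~ osc_exceeds j x w}.
Proof.
move=> x0 cx hS.
apply: (@borel_cantelli_eventually _ _ _ P _ (fun j => d%:R * (2 * gauss_tail c (V j)))
  (d%:R * (2 * S))).
- by move=> j; exact: osc_exceeds_measurable.
- move=> j; apply: le_trans (osc_exceeds_prob j x0) _; rewrite lee_fin.
  by rewrite ler_wpM2l// ler_wpM2l// gauss_tail_anti.
- by move=> J; rewrite -mulr_sumr -mulr_sumr ler_wpM2l// ler_wpM2l.
Qed.

(** Markov's inequality for the number of windows, among the first [4^k], in
    which the oscillation exceeds [x]. *)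
Lemma osc_rare (c x y S : R) : 0 < x -> 0 < y -> 0 < c ->
  (forall J, \sum_(0 <= j < J) gauss_tail c (V j) <= S) ->
  {ae P, forall w, exists k0, forall k, (k0 <= k)%N ->
    \sum_(j < 4 ^ k) \1_(osc_exceeds j x) w < y * 4 ^+ k}.
Proof.
move=> x0 y0 c0 hS; pose th := x ^+ 2 / 16 / c.
have th0 : 0 < th by rewrite !divr_gt0// exprn_gt0.
pose rho := expR (- (th * ln 2)).
have rho01 : 0 <= rho < 1.
  by rewrite expR_ge0/= -[ltRHS]expR0 ltr_expR oppr_lt0 mulr_gt0// ln_gt0// ltr1n.
pose E k := [set w | y * 4 ^+ k <= \sum_(j < 4 ^ k) \1_(osc_exceeds j x) w].
have m1 j : measurable_fun setT (\1_(osc_exceeds j x) : Omega -> R).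
  by apply: measurable_indic; exact: osc_exceeds_measurable.
have ms k : measurable_fun setT (fun w => \sum_(j < 4 ^ k) \1_(osc_exceeds j x) w : R).
  by apply: measurable_sum => j.
have mE k : measurable (E k).
  have -> : E k = (fun w => \sum_(j < 4 ^ k) \1_(osc_exceeds j x) w : R) @^-1` `[y * 4 ^+ k, +oo[.
    by apply/seteqP; split=> w; rewrite /E /= in_itv/= andbT.
  by rewrite -[_ @^-1` _]setTI; exact: ms.
have four k : 0 < (4 : R) ^+ k by rewrite exprn_gt0.
have S0 : 0 <= S by have := hS 0%N; rewrite big_geq.
pose p k := y^-1 * (d%:R * (2 * (S * 2^-1 ^+ k + rho ^+ k))).
have Ep k : (P (E k) <= (p k)%:E)%E.
  have yk : 0 < y * 4 ^+ k by rewrite mulr_gt0.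
  have h : ((y * 4 ^+ k)%:E * P (E k) <= (d%:R * (2 * (S * 2 ^+ k + 4 ^+ k * rho ^+ k)))%:E)%E.
    have -> : P (E k) = (\int[P]_w (\1_(E k) w)%:E)%E by rewrite integral_indic// setIT.
    rewrite -ge0_integralZl//=; first last.
    - by rewrite lee_fin ltW.
    - by apply/measurable_EFinP; exact: measurable_indic.
    apply: (@le_trans _ _ (\int[P]_w (\sum_(j < 4 ^ k) (\1_(osc_exceeds j x) w)%:E))%E).
      apply: ge0_le_integral => //=.
      + by move=> w _; rewrite lee_fin mulr_ge0// ltW.
      + by apply: measurable_funeM; apply/measurable_EFinP; exact: measurable_indic.
      + by apply: emeasurable_sum => j; apply/measurable_EFinP.
      + move=> w _; rewrite sumEFin -EFinM lee_fin indicE.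
        have [Ew|Ew] := boolP (w \in E k).
          by rewrite mulr1; move: Ew; rewrite inE.
        by rewrite mulr0; apply: sumr_ge0 => j _.
    rewrite ge0_integral_sum//=; last by move=> j; exact/measurable_EFinP.
    apply: (@le_trans _ _ (\sum_(j < 4 ^ k)
        (d%:R * (2 * (gauss_tail c (V j) * 2 ^+ k + rho ^+ k)))%:E)%E).
      apply: lee_sum => j _; rewrite integral_indic ?setIT//; last exact: osc_exceeds_measurable.
      apply: le_trans (osc_exceeds_prob j x0) _; rewrite lee_fin.
      rewrite ler_wpM2l// ler_wpM2l//.
      have -> : x ^+ 2 / 16 = th * c by rewrite /th divfK// gt_eqF.
      exact: gauss_tail_split.
    rewrite sumEFin lee_fin -mulr_sumr ler_wpM2l// -mulr_sumr ler_wpM2l//.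
    rewrite big_split/= lerD//.
      rewrite -mulr_suml ler_wpM2r ?exprn_ge0//.
      by have := hS (4 ^ k)%N; rewrite big_mkord.
    by rewrite sumr_const card_ord -[leLHS]mulr_natl natrX.
  rewrite -lee_pdivlMl// in h; apply: le_trans h _.
  rewrite -EFinM lee_fin le_eqVlt; apply/orP; left; apply/eqP; rewrite /p.
  have -> : (4 : R) ^+ k = 2 ^+ k * 2 ^+ k by rewrite -exprMn -natrM.
  have n2 : (2 : R) ^+ k != 0 by rewrite expf_neq0// pnatr_eq0.
  by rewrite exprVn; field; rewrite n2 gt_eqF.
have half01 : 0 <= (2^-1 : R) < 1 by rewrite invr_ge0 ler0n invf_lt1// ltr1n.
have hp N : \sum_(0 <= k < N) p k <=
    y^-1 * (d%:R * (2 * (S * (1 - 2^-1)^-1 + (1 - rho)^-1))).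
  rewrite /p -mulr_sumr ler_wpM2l ?invr_ge0 ?(ltW y0)//.
  rewrite -mulr_sumr ler_wpM2l// -mulr_sumr ler_wpM2l//.
  rewrite big_split/= lerD//; last exact: geometric_sum_le.
  by rewrite -mulr_sumr ler_wpM2l//; exact: geometric_sum_le.
have := borel_cantelli_eventually mE Ep hp; apply: filterS => w [k0 hk].
by exists k0 => k kk; rewrite ltNge; apply/negP; exact: hk.
Qed.

End almost_sure.

Section lower_bound.
Context {R : realType} {disp : measure_display} {Omega : measurableType disp}.
Variables (P : probability Omega R) (F : R -> set (set Omega)).
Hypothesis F_filtration : filtration F.
Variables (d r : nat) (B : R -> Omega -> 'cV[R]_r).
Hypothesis B_brownian : brownian_motion P F B.
Variable sigma : R -> 'M[R]_(d, r).
Hypothesis sigma_cont : continuous_nonneg sigma.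
Variable M : R -> Omega -> 'cV[R]_d.
Hypothesis M_integral : forall t, 0 <= t -> is_stochastic_integral P sigma B t (M t).
Variable L : R.
Hypothesis L_gt0 : 0 < L.
Hypothesis d_gt0 : (0 < d)%N.
Local Notation V j := (sq_integral sigma (j%:R * L) (j.+1%:R * L)).

Let d0 : 0 < d%:R :> R. Proof. by rewrite ltr0n. Qed.

(** A coordinate of largest variance carries the fraction [1 / d] of [V n], of which
    a fine enough step approximation keeps one half. The bounds [2 ^ - n] make the
    errors of approximation summable. *)
Lemma window_choice (x : R) : 0 < x -> forall n : nat, exists ik : 'I_d * nat,
  V n / (2 * d%:R) <= weighted_sum_var (mesh L ik.2)
       (row_weights sigma (mesh L ik.2) ik.1) (n * 2 ^ ik.2) (2 ^ ik.2) /\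
  (P [set w | (x < `|(M (n.+1%:R * L) w ik.1 0 - M (n%:R * L) w ik.1 0) -
     weighted_sum B (mesh L ik.2) (row_weights sigma (mesh L ik.2) ik.1)
       (n * 2 ^ ik.2) (2 ^ ik.2) w|)%R] <= (2^-1 ^+ n)%:E)%E.
Proof.
move=> x0 n.
have VE := sq_integral_row sigma_cont L_gt0 n.
have [i hi] : exists i : 'I_d, V n <= d%:R * row_integral sigma L i n.
  apply: contrapT => /forallNP h.
  have : \sum_(i < d) (d%:R * row_integral sigma L i n) < \sum_(i < d) V n.
    apply: ltr_sum => [|i _]; last by rewrite ltNge; apply/negP; exact: h.
    by apply/hasP; exists (Ordinal d_gt0).
  by rewrite -mulr_sumr -VE sumr_const card_ord -[X in _ < X]mulr_natl ltxx.
have V0 : 0 <= V n by exact: sq_integral_ge0.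
have e0 : 0 < (2^-1 : R) ^+ n by rewrite exprn_gt0// invr_gt0.
have var_ok : \forall k \near \oo, V n / (2 * d%:R) <=
    weighted_sum_var (mesh L k) (row_weights sigma (mesh L k) i) (n * 2 ^ k) (2 ^ k).
  move: V0; rewrite le_eqVlt => /orP[/eqP <-|V0].
    apply: nearW => k; rewrite mul0r; apply: sumr_ge0 => l _.
    by apply: weighted_var_ge0; exact: mesh_gt0.
  have eV : 0 < V n / (2 * d%:R) by rewrite divr_gt0// mulr_gt0.
  apply: filterS (window_var_cvg sigma_cont L_gt0 i n eV) => k.
  rewrite ler_norml => /andP[h _].
  have hi' : V n / d%:R <= row_integral sigma L i n by rewrite ler_pdivrMr// [leRHS]mulrC.
  have VV : V n / d%:R = V n / (2 * d%:R) + V n / (2 * d%:R).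
    by field; rewrite gt_eqF.
  by move: h hi'; rewrite VV; lra.
have close_ok := increment_approximation F_filtration B_brownian sigma_cont M_integral
  L_gt0 i n x0 e0.
near \oo => k; exists (i, k); split => /=.
  by near: k; exact: var_ok.
by near: k; exact: close_ok.
Unshelve. all: by end_near. Qed.

(** The increments are replaced by step sums, which are independent of the past
    exactly and stay within [x] of them for all but finitely many windows. The
    step sums exceed [2 x] infinitely often, because their conditional tails are
    bounded below by Gaussian ones. *)
Lemma increments_infinitely_often (eps : R) : 0 < eps ->
  (forall S, exists N, S < \sum_(0 <= n < N) gauss_tail (eps ^+ 2 / 2) (V n)) ->
  {ae P, forall w, forall n0, exists2 n, (n0 <= n)%N & exists i,
    eps / (16 * d%:R) <= M (n.+1%:R * L) w i 0 - M (n%:R * L) w i 0}.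
Proof.
move=> e0 hS; pose x := eps / (16 * d%:R).
have x0 : 0 < x by rewrite divr_gt0// mulr_gt0.
have [f hf] := choice (window_choice x0).
pose S n := weighted_sum B (mesh L (f n).2) (row_weights sigma (mesh L (f n).2) (f n).1)
  (n * 2 ^ (f n).2) (2 ^ (f n).2).
pose dM n w := M (n.+1%:R * L) w (f n).1 0 - M (n%:R * L) w (f n).1 0.
have tau0 n : 0 <= n%:R * L by rewrite mulr_ge0// ltW.
have mp n := mesh_gt0 L_gt0 (f n).2.
have tauE n : (n * 2 ^ (f n).2 + 2 ^ (f n).2)%:R * mesh L (f n).2 = n.+1%:R * L.
  by rewrite -[X in (_ + X)%N]mul1n -mulnDl addn1 mesh_window.
have kS n : known F (n.+1%:R * L) (S n).
  by rewrite -tauE; exact: (weighted_sum_known F_filtration B_brownian).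
have mS n : measurable_fun setT (S n) by apply: known_measurable (kS n).
have M_meas t i : 0 <= t -> measurable_fun setT (fun w => M t w i 0).
  by move=> t0; have [h _] := M_integral t0; exact: h.
have close : {ae P, forall w, exists n0, forall n, (n0 <= n)%N -> `|dM n w - S n w| <= x}.
  have half01 : 0 <= (2^-1 : R) < 1 by rewrite invr_ge0 ler0n invf_lt1// ltr1n.
  have mD n : measurable [set w | x < `|dM n w - S n w|].
    apply: measurable_abs_gt; apply: measurable_funB => //.
    by apply: measurable_funB; apply: M_meas.
  have := borel_cantelli_eventually mD (fun n => (hf n).2) (fun N => geometric_sum_le N half01).
  apply: filterS => w [n0 hn]; exists n0 => n nn.
  by rewrite leNgt; apply/negP; exact: hn.
have often : {ae P, forall w, forall n0, exists2 n, (n0 <= n)%N & 2 * x <= S n w}.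
  pose c := 4^-1 * expR (- (8 : R)).
  have c0 : 0 < c by rewrite mulr_gt0 ?expR_gt0// invr_gt0.
  apply: (@borel_cantelli_infinitely_often _ _ _ P (fun n => F (n%:R * L)) _ _ _
    (fun n => [set w | 2 * x <= S n w]) (fun n => c * gauss_tail (eps ^+ 2 / 2) (V n))).
  - move=> n; rewrite -(past_measurableE F_filtration _ (tau0 n)); exact: measurableT.
  - by move=> n U; exact: past_measurable.
  - move=> n U U' FU FU'; rewrite -(past_measurableE F_filtration _ (tau0 n.+1)).
    apply: measurableD; rewrite past_measurableE//.
    have [_ inc] := F_filtration; apply: inc FU => //.
    by rewrite ler_pM2r// ler_nat.
  - by move=> n; apply: known_ge => //; exact: kS.
  - by move=> n; rewrite mulr_ge0 ?(ltW c0)// gauss_tail_ge0.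
  - move=> n U FU; rewrite /gauss_tail; case: ltP => [Vn|Vn]; last by rewrite mulr0 mul0e.
    have [hv _] := hf n.
    set v := weighted_sum_var _ _ _ _ in hv.
    have v0 : 0 < v by apply: lt_le_trans hv; rewrite divr_gt0// mulr_gt0.
    have FU' : F ((n * 2 ^ (f n).2)%:R * mesh L (f n).2) U by rewrite mesh_window.
    have x20 : 0 < 2 * x by rewrite mulr_gt0.
    have := weighted_sum_tail_ge F_filtration B_brownian (mp n) x20 FU' v0.
    apply: le_trans; rewrite lee_pmul// ?lee_fin ?mulr_ge0 ?expR_ge0 ?(ltW c0)//.
    rewrite /c -mulrA -expRD ler_pM2l ?invr_gt0 // ler_expR -opprD lerN2 lerD2l.
    rewrite -/v ler_pdivrMr//.
    have hv' : V n <= v * (2 * d%:R) by rewrite -ler_pdivrMr// mulr_gt0.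
    rewrite mulrAC ler_pdivlMr//.
    have d1 : 1 <= d%:R :> R by rewrite ler1n.
    apply: (@le_trans _ _ (8 * (2 * x) ^+ 2 * (v * (2 * d%:R)))).
      by rewrite ler_wpM2l// mulr_ge0// sqr_ge0.
    have -> : 8 * (2 * x) ^+ 2 * (v * (2 * d%:R)) = eps ^+ 2 * v / (4 * d%:R).
      by rewrite /x; field; rewrite gt_eqF.
    rewrite [leRHS]mulrAC; apply: ler_wpM2l; first by rewrite mulr_ge0 ?sqr_ge0// ltW.
    by rewrite lef_pV2 ?posrE ?mulr_gt0//; lra.
  - move=> S'; have [N hN] := hS (S' / c); exists N.
    by rewrite -mulr_sumr mulrC -ltr_pdivrMr.
move: close often; apply: filterS2 => w [n0 hn] ho n1.
have [n nn Sn] := ho (maxn n0 n1).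
move: nn; rewrite geq_max => /andP[nn0 nn1].
exists n => //; exists (f n).1.
have := hn n nn0; rewrite ler_norml => /andP[hl _].
by rewrite -/x -/(dM n w); lra.
Qed.

End lower_bound.

(** * Conclusions for the solutions of the equation *)

Lemma integral_path_continuous (R : realType) (f : R -> R) (b : R) : 0 <= b ->
  {within `[0, b], continuous f} ->
  {within `[0, b], continuous (fun t => \int[lebesgue_measure]_(s in `[0, t]) f s)}.
Proof.
by move=> b0 fc; apply: parameterized_integral_continuous => //; exact: within_integrable.
Qed.

(** The oscillation of a continuous path over a window, as the least upper bound
    of its deviations from the initial value. *)
Lemma window_osc_exists (R : realType) (d : nat) (L : R) (m : R -> 'cV[R]_d.+1) (j : nat) :
  0 < L -> (forall i, {within `[0, j.+1%:R * L], continuous (fun t => m t i 0)}) ->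
  exists eta, [/\ 0 <= eta, window_osc_le L m j eta &
    forall x, window_osc_le L m j x -> eta <= x].
Proof.
move=> L0 mc; have j0 : 0 <= j%:R * L by rewrite mulr_ge0// ltW.
have jj : j%:R * L <= j.+1%:R * L by rewrite ler_pM2r// ler_nat.
pose D := [set `|m ui.1 ui.2 0 - m (j%:R * L) ui.2 0| |
  ui in [set ui : R * 'I_d.+1 | j%:R * L <= ui.1 <= j.+1%:R * L]].
have D0 : D 0.
  by exists (j%:R * L, ord0) => /=; [rewrite lexx jj|rewrite subrr normr0].
have hD : has_sup D.
  split; first by exists 0.
  have bi (i : 'I_d.+1) : exists b, forall u, j%:R * L <= u <= j.+1%:R * L ->
      `|m u i 0 - m (j%:R * L) i 0| <= b.
    have : {within `[(j%:R * L), (j.+1%:R * L)], continuous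
        (fun u => `|m u i 0 - m (j%:R * L) i 0|)}.
      apply: (@within_comp _ _ (fun u => m u i 0 - m (j%:R * L) i 0) Num.norm).
        apply: within_sub; last exact: within_cst.
        exact: within_sub_itv (mc i).
      exact: norm_continuous.
    move=> /(EVT_max jj)[c _ hc]; exists `|m c i 0 - m (j%:R * L) i 0| => u hu.
    by apply: hc; rewrite in_itv.
  have [b hb] := choice bi.
  exists (\sum_i `|b i|) => _ [[u i] /= hu <-].
  rewrite (le_trans (hb i u hu))// (le_trans (ler_norm _))//.
  by rewrite (bigD1 i)//= lerDl sumr_ge0.
exists (sup D); split.
- by apply: ub_le_sup => //; case: hD.
- by move=> u i hu; apply: ub_le_sup; [case: hD|exists (u, i)].
- move=> x hx; apply: ge_sup; first by case: hD.
  by move=> _ [[u i] /= hu <-]; exact: hx.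
Qed.

(** [b n j] plays the role of the indicator of the indices where [eta j ^ 2]
    exceeds [1 / (n + 1)]. Outside a set of small density the squares are small,
    and on this set they are bounded. *)
Lemma mean_sqr_cvg0 (R : realType) (eta : nat -> R) (b : nat -> nat -> R) (x : R) (j0 : nat) :
  (forall n j, 0 <= b n j) -> (forall j, (j0 <= j)%N -> eta j ^+ 2 <= x ^+ 2) ->
  (forall n j, b n j = 1 \/ eta j ^+ 2 <= n.+1%:R^-1) ->
  (forall n, exists k0, forall k, (k0 <= k)%N ->
    \sum_(j < 4 ^ k) b n j < n.+1%:R^-1 * 4 ^+ k) ->
  (4 ^+ k)^-1 * (\sum_(j < 4 ^ k) eta j ^+ 2) @[k --> \oo] --> (0 : R).
Proof.
move=> b0 etax etab hb; apply/cvgrPdist_le => e e0.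
have s0 : 0 <= x ^+ 2 by exact: sqr_ge0.
have x1 : 0 < 2 * (1 + x ^+ 2) by rewrite mulr_gt0// ltr_wpDr.
pose n := Num.trunc (2 * (1 + x ^+ 2) / e); pose y : R := n.+1%:R^-1.
have y0 : 0 < y by rewrite invr_gt0 ltr0n.
have ye : (1 + x ^+ 2) * y <= e / 2.
  have := truncnS_gt (2 * (1 + x ^+ 2) / e); rewrite -/n ltr_pdivrMr// => h.
  rewrite /y ler_pdivrMr ?ltr0n//; lra.
have [k0 hk0] := hb n.
pose C := \sum_(0 <= j < j0) eta j ^+ 2.
have C0 : 0 <= C by apply: sumr_ge0 => j _; exact: sqr_ge0.
have qC : (4^-1 : R) ^+ k * C @[k --> \oo] --> 0 * C.
  apply: cvgM; last exact: cvg_cst.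
  by apply: cvg_expr; rewrite ger0_norm ?invr_ge0// invf_lt1// ltr1n.
have e2 : 0 < e / 2 by rewrite divr_gt0.
rewrite mul0r in qC.
near=> k.
have kk : (k0 <= k)%N by near: k; exists k0.
have Ck : (4^-1) ^+ k * C <= e / 2.
  have : `|0 - (4^-1) ^+ k * C| <= e / 2 by near: k; exact: (cvgrPdist_le _ _).1 qC _ e2.
  by rewrite sub0r normrN; apply: le_trans; exact: ler_norm.
have four : 0 < (4 : R) ^+ k by rewrite exprn_gt0.
rewrite sub0r normrN ger0_norm; last first.
  by rewrite mulr_ge0 ?invr_ge0 ?(ltW four)// sumr_ge0// => j _; exact: sqr_ge0.
have pt (j : nat) : eta j ^+ 2 <= y + x ^+ 2 * b n j + (if (j < j0)%N then eta j ^+ 2 else 0).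
  have [jj|jj] := ltnP j j0.
    by rewrite lerDr addr_ge0 ?(ltW y0)// mulr_ge0.
  rewrite addr0; have [->|h] := etab n j.
    by rewrite mulr1 (le_trans (etax j jj))// lerDr ltW.
  by rewrite (le_trans h)// lerDl mulr_ge0.
have first_terms N : \sum_(j < N) (if (j < j0)%N then eta j ^+ 2 else 0) <= C.
  rewrite -(big_mkord xpredT (fun j => if (j < j0)%N then eta j ^+ 2 else 0)) -big_mkcond/=.
  have [Nj|Nj] := leqP N j0.
    rewrite /C [leRHS](@big_cat_nat _ _ _ N 0%N j0)//= -[leLHS]addr0 lerD//.
      rewrite big_mkcond; apply: ler_sum => j _; case: ifP => // _; exact: sqr_ge0.
    by apply: sumr_ge0 => j _; exact: sqr_ge0.
  rewrite (@big_cat_nat _ _ _ j0 0%N N)//=; last exact: ltnW.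
  rewrite [X in _ + X](_ : _ = 0) ?addr0.
    by rewrite big_mkcond; apply: ler_sum => j _; case: ifP => // _; exact: sqr_ge0.
  by rewrite big_nat_cond big_pred0// => j; case: (leqP j0 j); rewrite ?andbF.
rewrite ler_pdivrMl//.
apply: (@le_trans _ _ (4 ^+ k * y + x ^+ 2 * (y * 4 ^+ k) + C)).
  apply: (le_trans (ler_sum _ (fun (j : 'I_(4 ^ k)) _ => pt j))).
  rewrite !big_split/= sumr_const card_ord -[y *+ _]mulr_natl natrX.
  rewrite -mulr_sumr; apply: lerD; last exact: first_terms.
  by rewrite lerD2l ler_wpM2l// ltW// hk0.
have -> : 4 ^+ k * y + x ^+ 2 * (y * 4 ^+ k) + C = 4 ^+ k * ((1 + x ^+ 2) * y + (4^-1) ^+ k * C).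
  by rewrite exprVn; field; rewrite gt_eqF.
by rewrite ler_wpM2l ?(ltW four)// [e]splitr lerD.
Unshelve. all: by end_near. Qed.

Section conclusions.
Context {R : realType} {disp : measure_display} {Omega : measurableType disp}.
Variables (P : probability Omega R) (F : R -> set (set Omega)).
Hypothesis F_filtration : filtration F.
Variables (d r : nat) (B : R -> Omega -> 'cV[R]_r).
Hypothesis B_brownian : brownian_motion P F B.
Variables (sigma : R -> 'M[R]_(d.+1, r)) (A Psi : R -> 'M[R]_d.+1) (T h : R).
Hypothesis sigma_cont : continuous_nonneg sigma.
Hypothesis A_cont : continuous_nonneg A.
Hypothesis T_gt0 : 0 < T.
Hypothesis A_periodic : forall t, 0 <= t -> A (t + T) = A t.
Hypothesis Psi_fund : is_fundamental_solution A Psi.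
Hypothesis Psi_stable : spectral_radius (Psi T) < 1.
Hypothesis h_gt0 : 0 < h.
Local Notation D := (d.+1).
Local Notation mu := (@lebesgue_measure R).
Local Notation solves X xi := (is_sde_solution P F A sigma B xi X).

Lemma sde_solution_paths (X : R -> Omega -> 'cV[R]_D) xi : solves X xi ->
  exists2 M : R -> Omega -> 'cV[R]_D,
    (forall t, 0 <= t -> is_stochastic_integral P sigma B t (M t)) &
    {ae P, forall w, solution_from A 0 (M^~ w) (X^~ w) /\
      forall i b, 0 <= b -> {within `[0, b], continuous (fun t => M t w i 0)}}.
Proof.
move=> [_ Xc [M MI Xe]]; exists M => //.
move: Xc Xe; apply: filterS2 => w Xc Xe.
have Xe' t i : 0 <= t -> X t w i 0 = xi i 0 +
    \int[mu]_(s in `[0, t]) ((A s *m X s w) i 0) + M t w i 0.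
  by move=> t0; rewrite (Xe t t0) !mxE.
have Xw t : {within `[0, t], continuous (X^~ w)} by exact: continuous_nonneg_within.
split.
  split => [//|t i t0]; rewrite (Xe' t i t0) (Xe' 0 i (lexx 0)).
  by rewrite set_itv1 Rintegral_set1; ring.
move=> i b b0.
have : {within `[0, b], continuous (fun t => X t w i 0 - xi i 0 -
    \int[mu]_(s in `[0, t]) ((A s *m X s w) i 0))}.
  apply: within_sub.
    by apply: within_sub; [exact: within_coord|exact: within_cst].
  apply: integral_path_continuous => //; apply: within_mulmx_coord => //.
  exact: continuous_nonneg_within.
apply: subspace_eq_continuous => t; rewrite inE/= in_itv/= => /andP[t0 _].
by rewrite /from_subspace (Xe' t i t0); ring.
Qed.

Let window_data : exists a L K : R, exists q : nat,
  [/\ 0 < a, (forall s i j, 0 <= s -> `|A s i j| <= a), h <= L & 0 < K] /\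
  [/\ (forall m x, solution_from A 0 m x -> forall j eta, 0 <= eta ->
    window_osc_le L m j eta ->
    `|x (j.+1%:R * L)| <= 2^-1 * `|x (j%:R * L)| + K * eta /\
    forall u, j%:R * L <= u <= j.+1%:R * L -> `|x u| <= K * (`|x (j%:R * L)| + eta)),
    (0 < q)%N &
    forall c S, 0 <= c ->
    (forall N, \sum_(0 <= n < N) gauss_tail c (sq_integral sigma (n%:R * h) (n.+1%:R * h)) <= S) ->
    forall J, \sum_(0 <= j < J)
      gauss_tail (q%:R * c) (sq_integral sigma (j%:R * L) (j.+1%:R * L)) <= q%:R * S].
Proof.
have [a a0 Aa] := periodic_bounded T_gt0 A_cont A_periodic.
have [L [K [hL K0 LK]]] :=
  stable_windows A_cont a0 Aa T_gt0 A_periodic Psi_fund Psi_stable h_gt0.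
have [q q0 hq] := long_window_sum_le sigma_cont h_gt0 hL.
by exists a, L, K, q.
Qed.

(** By Borel-Cantelli the oscillations over the long windows are eventually at most
    a constant multiple of [eps]. The constants account for the lossy exponents: the
    Gaussian tails are summable at [q * eps ^ 2], and the oscillation bound costs a
    factor 16. *)
Lemma solution_eventually_le : exists2 C : R, 0 < C &
  forall eps, 0 < eps -> (Sh' sigma h eps < +oo)%E ->
  forall X xi, solves X xi -> {ae P, forall w, \forall t \near +oo, `|X t w| <= C * eps}.
Proof.
have [a [L [K [q [[a0 Aa hL K0] [LK q0 hq]]]]]] := window_data.
have L0 : 0 < L by exact: lt_le_trans hL.
have q1 : 1 <= q%:R :> R by rewrite ler1n.
exists ((4 * K ^+ 2 + K) * (4 * q%:R)).
  by rewrite !mulr_gt0// ?addr_gt0// ?mulr_gt0 ?exprn_gt0// ltr0n.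
move=> eps e0 Sfin X xi Xsol.
have [M MI path] := sde_solution_paths Xsol.
have [S hS] := Sh_sum_le e0 Sfin.
pose x := 4 * q%:R * eps.
have x0 : 0 < x by rewrite !mulr_gt0// ltr0n.
have cx : q%:R * eps ^+ 2 <= x ^+ 2 / 16.
  rewrite /x (_ : (4 * q%:R * eps) ^+ 2 / 16 = q%:R * (q%:R * eps ^+ 2)); last by field.
  by rewrite ler_wpM2l// ler_peMl// sqr_ge0.
have small := osc_eventually_small F_filtration B_brownian sigma_cont MI L0 x0 cx
  (hq _ _ (sqr_ge0 eps) hS).
move: path small; apply: filterS2 => w [xs mc] [j0 hj].
rewrite -mulrA; apply: (path_eventually_le L0 K0 (@LK _ _ xs) x0).
exists j0 => // j /= jj u i hu.
apply: (osc_exceeds_path L0 (ltW x0) (hj j jj)) => // k.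
by apply: mc; rewrite mulr_ge0// ltW.
Qed.

(** Convergence at a single [eps] bounds the oscillations, and it also makes those
    above any fixed level rare: their squares average to zero. *)
Lemma solution_average_cvg0 (eps : R) : 0 < eps -> (Sh' sigma h eps < +oo)%E ->
  forall X xi, solves X xi -> {ae P, forall w,
    t^-1 * (\int[mu]_(s in `[0, t]) (fnorm (X s w) ^+ 2)) @[t --> +oo] --> (0 : R)}.
Proof.
move=> e0 Sfin X xi Xsol.
have [a [L [K [q [[a0 Aa hL K0] [LK q0 hq]]]]]] := window_data.
have L0 : 0 < L by exact: lt_le_trans hL.
have q1 : 1 <= q%:R :> R by rewrite ler1n.
have [M MI path] := sde_solution_paths Xsol.
have [S hS] := Sh_sum_le e0 Sfin.
pose x := 4 * q%:R * eps.
have x0 : 0 < x by rewrite !mulr_gt0// ltr0n.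
have cx : q%:R * eps ^+ 2 <= x ^+ 2 / 16.
  rewrite /x (_ : (4 * q%:R * eps) ^+ 2 / 16 = q%:R * (q%:R * eps ^+ 2)); last by field.
  by rewrite ler_wpM2l// ler_peMl// sqr_ge0.
have c0 : 0 < q%:R * eps ^+ 2 by rewrite mulr_gt0 ?exprn_gt0// ltr0n.
have hV := hq _ _ (sqr_ge0 eps) hS.
have small := osc_eventually_small F_filtration B_brownian sigma_cont MI L0 x0 cx hV.
have y0 (n : nat) : 0 < (n.+1%:R : R)^-1 by rewrite invr_gt0 ltr0n.
have rare : {ae P, forall w, forall n : nat, exists k0, forall k, (k0 <= k)%N ->
    \sum_(j < 4 ^ k) \1_(osc_exceeds M L j n.+1%:R^-1) w < n.+1%:R^-1 * 4 ^+ k :> R}.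
  apply/ae_foralln => n.
  exact: (osc_rare F_filtration B_brownian sigma_cont MI L0 (y0 n) (y0 n) c0 hV).
have path' : {ae P, forall w, (solution_from A 0 (M^~ w) (X^~ w) /\
      forall i b, 0 <= b -> {within `[0, b], continuous (fun t => M t w i 0)}) /\
      exists j0, forall j, (j0 <= j)%N -> ~ osc_exceeds M L j x w}.
  by move: path small; apply: filterS2 => w p s; split.
move: path' rare; apply: filterS2 => w [[xs mc] [j0 hj]] hr.
have mcw j i : {within `[0, j.+1%:R * L], continuous (fun t => M t w i 0)}.
  by apply: mc; rewrite mulr_ge0// ltW.
have [eta heta] := choice (fun j => window_osc_exists L0 (mcw j)).
have eta0 j : 0 <= eta j by have [] := heta j.
have osc_le y j : 0 <= y -> ~ osc_exceeds M L j y w -> eta j ^+ 2 <= y ^+ 2.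
  move=> yy nE; rewrite ler_sqr ?nnegrE//; have [_ _] := heta j; apply => u i hu.
  exact: (osc_exceeds_path L0 yy nE (mcw j)).
have eta_osc j : window_osc_le L (M^~ w) j (eta j) by have [] := heta j.
apply: (path_average_cvg0 L0 K0 xs.1 (@LK _ _ xs) eta0 eta_osc).
apply: (@mean_sqr_cvg0 _ _ (fun n j => \1_(osc_exceeds M L j n.+1%:R^-1) w) x j0) => //.
  by move=> j jj; apply: osc_le (hj j jj); exact: ltW.
move=> n j; have [Ew|Ew] := pselect (osc_exceeds M L j n.+1%:R^-1 w).
  by left; rewrite indicE mem_set.
right; apply: le_trans (osc_le _ _ (ltW (y0 n)) Ew) _.
by rewrite expr2 ler_piMl ?(ltW (y0 n))// invf_le1// ler1n.
Qed.

(** The increments of the stochastic integral over the windows of length [h] are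
    infinitely often at least a multiple of [eps], which a solution of smaller size
    cannot accommodate. *)
Lemma solution_infinitely_often_ge : exists2 c : R, 0 < c &
  forall eps, 0 < eps -> Sh' sigma h eps = +oo%E ->
  forall X xi, solves X xi -> {ae P, forall w, forall t0, exists2 t, t0 <= t & c * eps <= `|X t w|}.
Proof.
have [a a0 Aa] := periodic_bounded T_gt0 A_cont A_periodic.
pose k := 2 + D%:R * a * h.
have k0 : 0 < k by rewrite addr_gt0// !mulr_gt0.
have D0 : 0 < D%:R :> R by rewrite ltr0n.
exists (2 * k * (16 * D%:R))^-1; first by rewrite invr_gt0 !mulr_gt0.
move=> eps e0 Soo X xi Xsol.
have [M MI path] := sde_solution_paths Xsol.
have often := increments_infinitely_often F_filtration B_brownian sigma_cont MI h_gt0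
  (ltn0Sn d) e0 (Sh_sum_unbounded Soo).
move: path often; apply: filterS2 => w [xs mc] ho t0.
apply: contrapT => nt.
set z := (2 * k * (16 * D%:R))^-1 * eps in nt.
have z0 : 0 < z by rewrite mulr_gt0// invr_gt0 !mulr_gt0.
have {}nt t : t0 <= t -> `|X t w| <= z.
  by move=> tt; rewrite leNgt; apply/negP => zt; apply: nt; exists t => //; exact: ltW.
pose n0 := (Num.trunc (t0 / h)).+1.
have [n nn [i hi]] := ho n0.
have nt0 : t0 <= n%:R * h.
  rewrite -ler_pdivrMr// ltW// (lt_le_trans (truncnS_gt _))// ler_nat//.
have nh0 : 0 <= n%:R * h by rewrite mulr_ge0// ltW.
have := increment_le_bound A_cont a0 Aa i h_gt0 nh0 xs (fun t ht => nt t (le_trans nt0 ht)).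
rewrite (_ : n%:R * h + h = n.+1%:R * h); last by rewrite -natr1 mulrDl mul1r.
move=> /(le_trans (ler_norm _)) /(le_trans hi).
apply/negP; rewrite -ltNge -/k.
have -> : k * z = eps / (16 * D%:R) / 2 by rewrite /z; field; rewrite !gt_eqF.
by rewrite ltr_pdivrMr// ltr_pMr ?divr_gt0 ?mulr_gt0// ltr1n.
Qed.

End conclusions.

Theorem theorem12 (R : realType) (disp : measure_display)
    (Omega : measurableType disp) (P : probability Omega R)
    (F : R -> set (set Omega)) (d r : nat)
    (B : R -> Omega -> 'cV[R]_r)
    (sigma : R -> 'M[R]_(d, r)) (A : R -> 'M[R]_d) (T : R)
    (Psi : R -> 'M[R]_d)
    (X : 'cV[R]_d -> R -> Omega -> 'cV[R]_d) (h : R)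
    (d_gt0 : (0 < d)%N) (r_gt0 : (0 < r)%N)
    (F_filtration : filtration F)
    (B_brownian : brownian_motion P F B)
    (sigma_continuous : continuous_nonneg sigma)
    (A_continuous : continuous_nonneg A)
    (T_gt0 : 0 < T)
    (A_periodic : forall t, 0 <= t -> A (t + T) = A t)
    (Psi_solution : is_fundamental_solution A Psi)
    (Psi_stable : spectral_radius (Psi T) < 1)
    (X_solution : forall xi, is_sde_solution P F A sigma B xi (X xi))
    (h_gt0 : 0 < h) :
  [/\ (* (A) *)
      (forall eps, 0 < eps -> (Sh' sigma h eps < +oo)%E) ->
      forall xi, {ae P, forall w, X xi t w @[t --> +oo] --> (0 : 'cV[R]_d)},
      (* (B) *)
      (exists2 eps' : R, 0 < eps' &
        (forall eps, eps' < eps -> (Sh' sigma h eps < +oo)%E) /\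
        (forall eps, 0 < eps -> eps < eps' -> Sh' sigma h eps = +oo%E)) ->
      (exists c1 c2 : R, [/\ 0 < c1, c1 <= c2 &
        forall xi, {ae P, forall w,
          (c1%:E <= limsup_infty (fun t => fnorm (X xi t w)))%E /\
          (limsup_infty (fun t => fnorm (X xi t w)) <= c2%:E)%E}]) /\
      (forall xi, {ae P, forall w,
          liminf_infty (fun t => fnorm (X xi t w)) = 0%E /\
          t^-1 * (\int[lebesgue_measure]_(s in `[0, t])
                    (fnorm (X xi s w) ^+ 2)) @[t --> +oo] --> (0 : R)}) &
      (* (C) *)
      (forall eps, 0 < eps -> Sh' sigma h eps = +oo%E) ->
      forall xi, {ae P, forall w,
        limsup_infty (fun t => fnorm (X xi t w)) = +oo%E}].
Proof.
destruct d as [|d']; first by [].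
have [C C0 upper] := solution_eventually_le F_filtration B_brownian sigma_continuous
  A_continuous T_gt0 A_periodic Psi_solution Psi_stable h_gt0.
have [c c0 lower] := solution_infinitely_often_ge F_filtration B_brownian sigma_continuous
  A_continuous T_gt0 A_periodic h_gt0.
have average := solution_average_cvg0 F_filtration B_brownian sigma_continuous
  A_continuous T_gt0 A_periodic Psi_solution Psi_stable h_gt0.
split.
- move=> Sfin xi.
  have : {ae P, forall w, forall n : nat,
      \forall t \near +oo, `|X xi t w| <= C * n.+1%:R^-1 :> R}.
    apply/ae_foralln => n.
    have n0 : 0 < n.+1%:R^-1 :> R by rewrite invr_gt0 ltr0n.
    exact: upper n0 (Sfin _ n0) _ _ (X_solution xi).
  apply: filterS => w hw; apply/cvgrPdist_le => e e0.
  apply: filterS (hw (Num.trunc (C / e))) => t; rewrite sub0r normrN => /le_trans; apply.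
  by rewrite ler_pdivrMr ?ltr0n// mulrC -ler_pdivrMr// ltW// truncnS_gt.
- move=> [eps e0 [Sfin Soo]].
  have e20 : 0 < eps * 2 by rewrite mulr_gt0.
  have e2 : eps < eps * 2 by rewrite ltr_pMr// ltr1n.
  have e'0 : 0 < eps / 2 by rewrite divr_gt0.
  have e' : eps / 2 < eps by rewrite ltr_pdivrMr// ltr_pMr// ltr1n.
  split.
    exists (c * (eps / 2)), (Num.max (c * (eps / 2)) (d'.+1%:R * (C * (eps * 2)))); split.
    + exact: mulr_gt0.
    + by rewrite le_max lexx.
    move=> xi.
    have up := upper _ e20 (Sfin _ e2) _ _ (X_solution xi).
    have lo := lower _ e'0 (Soo _ e'0 e') _ _ (X_solution xi).
    move: up lo; apply: filterS2 => w up lo; split.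
      apply: le_limsup_infty => t0; have [t tt Xt] := lo t0.
      by exists t => //; apply: (le_trans Xt); exact: mx_norm_le_fnorm.
    apply: limsup_infty_le; apply: filterS up => t Xt.
    rewrite le_max; apply/orP; right; apply: (le_trans (fnorm_le _)).
    by rewrite ler_wpM2l.
  move=> xi; have av := average _ e20 (Sfin _ e2) _ _ (X_solution xi).
  have [_ Xc _] := X_solution xi.
  move: Xc av; apply: filterS2 => w Xc av; split => //.
  apply: (liminf_of_average (fun t => fnorm_ge0 (X xi t w))) => // t.
  by apply: path_energy_integrable => u; exact: continuous_nonneg_within.
- move=> Soo xi.
  have : {ae P, forall w, forall n : nat, forall t0 : R,
      exists2 t, t0 <= t & c * n.+1%:R <= `|X xi t w| :> R}.
    apply/ae_foralln => n.
    have n0 : 0 < n.+1%:R :> R by rewrite ltr0n.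
    exact: lower n0 (Soo _ n0) _ _ (X_solution xi).
  apply: filterS => w hw; apply/eqyP => b b0.
  apply: le_limsup_infty => t0; have [t tt Xt] := hw (Num.trunc (b / c)) t0.
  exists t => //; apply: le_trans (mx_norm_le_fnorm _); apply: le_trans Xt.
  by rewrite mulrC -ler_pdivrMr// ltW// truncnS_gt.
Qed.
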